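(* Assume Assumption A-0 holds, let $T\ge0$ and let $\psi_0,\dots,\psi_T:\mathbb{R}^d\to\mathbb{R}$ be bounded measurable functions. Let $(b_N)$ be positive reals with $b_N\to\infty$ and $\sqrt N/b_N\to\infty$. Then $$\mathbf I_T(\mathbf x)=\sup_{\boldsymbol\lambda\in\mathbb{R}^{T+1}}\Big\{\langle\mathbf x,\boldsymbol\lambda\rangle-\tfrac12\langle\boldsymbol\lambda,\mathbf V_T(\psi_{0:T})\boldsymbol\lambda\rangle\Big\},\quad \mathbf x\in\mathbb{R}^{T+1},$$ is a good rate function, and the random vectors $\mathbf M_N^T(\psi_{0:T})=(M_N^0(\psi_0),\dots,M_N^T(\psi_T))$ satisfy under $\mathbb{P}_T$ the moderate deviation principle with speed $b_N^2$ and rate function $\mathbf I_T$: for every Borel $\Gamma\subset\mathbb{R}^{T+1}$, $$-\inf_{\mathrm{int}(\Gamma)}\mathbf I_T\le\liminf_{N\to\infty}\frac1{b_N^2}\log\mathbb{P}_T(\mathbf M_N^T\in\Gamma)\le\limsup_{N\to\infty}\frac1{b_N^2}\log\mathbb{P}_T(\mathbf M_N^T\in\Gamma)\le-\inf_{\overline\Gamma}\mathbf I_T.$$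
   Context: Hidden Markov model: $(X_t)_{t\ge0}$ is an $\mathbb{R}^d$-valued Markov chain with $\mathbb{P}(X_0\in A)=\int_A a_0\,d\mu$ and $\mathbb{P}(X_t\in A\mid X_{t-1}=x)=\int_A a_t(x,x')\,\mu(dx')$ ($t\ge1$), where $\mu$ is a reference measure on $\mathbb{R}^d$. Observations $(Y_t)_{t\ge1}$ are $\mathbb{R}^m$-valued, conditionally independent given $(X_t)$, with $\mathbb{P}(Y_t\in B\mid X_t=x)=\int_B b_t(x,y)\,\nu(dy)$. Observations $y_1,\dots,y_T$ are fixed, $\mathbb{P}_T=\mathbb{P}(\cdot\mid Y_1=y_1,\dots,Y_T=y_T)$. Filter density: $f_{0|0}=a_0$, $f_{t|t}(x)\propto b_t(x,y_t)\int f_{t-1|t-1}(u)a_t(u,x)\mu(du)$ (normalized to a probability density w.r.t. $\mu$). Particle filter: $(x_{i,0})_{i\le N}$ i.i.d. with law $a_0d\mu$; given generations up to $t-1$, $(x_{i,t})_{i\le N}$ are i.i.d. with law $f^N_{t|t}d\mu$, $f^N_{t|t}(x)\propto b_t(x,y_t)\frac1N\sum_i a_t(x_{i,t-1},x)$ (normalized). Notation: $m_t(\psi)=\int\psi f_{t|t}d\mu$; $L_t\psi(x)=\int a_t(x,u)b_t(u,y_t)\psi(u)\mu(du)$; $\mathbb{1}\equiv1$; $M_N^t(\psi)=\frac1{b_N\sqrt N}\sum_{i=1}^N(\psi(x_{i,t})-m_t(\psi))$. Assumption A-0: for every $t\ge1$, $\sup_xL_t\mathbb{1}(x)<\infty$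 and $L_t\mathbb{1}(x)>0$ for all $x$; then $\kappa_t:=\int L_t\mathbb{1}\,f_{t-1|t-1}d\mu>0$. Variance quantities: $\sigma_t^2(\psi)=\int(\psi-m_t(\psi))^2f_{t|t}d\mu$; $V_0(\psi)=\sigma_0^2(\psi)$ and $V_t(\psi)=\sigma_t^2(\psi)+\kappa_t^{-2}V_{t-1}(L_t\psi-m_t(\psi)L_t\mathbb{1})$ for $t\ge1$; $V_{t,t}(\psi,\phi)=\frac12(V_t(\psi+\phi)-V_t(\psi)-V_t(\phi))$; for $r<t$, $V_{r,t}(\psi_r,\psi_t)=\kappa_t^{-1}V_{r,t-1}(\psi_r,L_t(\psi_t-m_t(\psi_t)))$, and $V_{t,r}(\psi_t,\psi_r)=V_{r,t}(\psi_r,\psi_t)$. The covariance matrix is $\mathbf V_T(\psi_{0:T})=(V_{s,t}(\psi_s,\psi_t))_{0\le s,t\le T}$.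
   Formalization: The reference measure μ is assumed σ-finite (the usual convention); without this the filter density f_{t|t} can be undefined (normalizing constant zero) even though Assumption A-0 holds. *)

(* Defs.v *)
From HB Require Import structures.
From mathcomp Require Import all_boot all_order all_algebra.
From mathcomp Require Import all_classical all_reals all_analysis.
Set Implicit Arguments. Unset Strict Implicit. Unset Printing Implicit Defensive.
Import Order.TTheory GRing.Theory Num.Theory.
Import numFieldNormedType.Exports.
Local Open Scope classical_set_scope.
Local Open Scope ring_scope.

Section HMM.
Context {R : realType} {d : nat}.
Local Notation X := (d.-tuple R).
Variable mu : {measure set X -> \bar R}.

Definition integ (f : X -> R) : R := Rintegral mu setT f.

Variables (a0 : X -> R) (a : nat -> X -> X -> R) (g : nat -> X -> R).
(* g t x stands for b_t(x, y_t) *)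

Fixpoint filt (t : nat) : X -> R :=
  match t with
  | 0 => a0
  | t'.+1 =>
      let u := fun x => g t'.+1 x * integ (fun v => filt t' v * a t'.+1 v x) in
      fun x => u x / integ u
  end.

Definition mt (t : nat) (psi : X -> R) : R := integ (fun x => psi x * filt t x).
Definition Lop (t : nat) (psi : X -> R) (x : X) : R :=
  integ (fun u => a t x u * g t u * psi u).
Definition one : X -> R := fun _ => 1.
Definition kappa (t : nat) : R := integ (fun x => Lop t one x * filt t.-1 x).
Definition sigma2 (t : nat) (psi : X -> R) : R :=
  integ (fun x => (psi x - mt t psi) ^+ 2 * filt t x).

Fixpoint Vvar (t : nat) (psi : X -> R) : R :=
  match t with
  | 0 => sigma2 0 psi
  | t'.+1 => sigma2 t'.+1 psi + (kappa t'.+1) ^- 2 *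
       Vvar t' (fun x => Lop t'.+1 psi x - mt t'.+1 psi * Lop t'.+1 one x)
  end.

Definition Vdiag (t : nat) (psi phi : X -> R) : R :=
  (Vvar t (fun x => psi x + phi x) - Vvar t psi - Vvar t phi) / 2.

Fixpoint Vlow (r t : nat) (psir psit : X -> R) : R :=
  match t with
  | 0 => Vdiag 0 psir psit
  | t'.+1 => if r == t'.+1 then Vdiag t'.+1 psir psit
             else (kappa t'.+1)^-1 *
                  Vlow r t' psir (Lop t'.+1 (fun x => psit x - mt t'.+1 psit))
  end.

Definition Vcov (s t : nat) (psis psit : X -> R) : R :=
  if (s <= t)%N then Vlow s t psis psit else Vlow t s psit psis.

Definition Vmat (T : nat) (psi : nat -> X -> R) : 'M[R]_(T.+1) :=
  \matrix_(s < T.+1, t < T.+1) Vcov s t (psi s) (psi t).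

Definition pf_dens (t N : nat) (prev : nat -> X) (x : X) : R :=
  let u := fun x => g t x * (N%:R^-1 * \sum_(i < N) a t (prev i) x) in
  u x / integ u.

Definition past_sets {dO} {Om : measurableType dO} (N t : nat)
  (xs : nat -> nat -> Om -> X) : set (set Om) :=
  [set S | exists j s (C : set X), [/\ (j < N)%N, (s < t)%N, measurable C &
                                     S = xs j s @^-1` C]].

Definition particle_law {dO} {Om : measurableType dO} (P : probability Om R)
  (T N : nat) (xs : nat -> nat -> Om -> X) : Prop :=
  [/\ (forall i t, (i < N)%N -> (t <= T)%N -> measurable_fun setT (xs i t)),
      (forall A : nat -> set X, (forall i, measurable (A i)) ->
         P (\bigcap_(i in `I_N) (xs i 0 @^-1` A i)) =
         (\prod_(i < N) fine (\int[mu]_(x in A i) (a0 x)%:E))%:E) &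
      (forall t, (1 <= t <= T)%N ->
       forall B, <<s past_sets N t xs >> B ->
       forall A : nat -> set X, (forall i, measurable (A i)) ->
         P (B `&` \bigcap_(i in `I_N) (xs i t @^-1` A i)) =
         (\int[P]_(w in B)
            (\prod_(i < N) fine (\int[mu]_(x in A i)
                 (pf_dens t N (fun j => xs j t.-1 w) x)%:E))%:E)%E)].

Definition Mvec (T N : nat) (bN : nat -> R) (psi : nat -> X -> R)
  {dO} {Om : measurableType dO} (xs : nat -> nat -> Om -> X) (w : Om)
  : 'rV[R]_(T.+1) :=
  \row_(t < T.+1) ((bN N * Num.sqrt N%:R)^-1 *
                   \sum_(i < N) (psi t (xs i t w) - mt t (psi t))).

End HMM.

Section LDP.
Context {R : realType}.
Local Open Scope ereal_scope.

Definition rateI (n : nat) (V : 'M[R]_n) (x : 'rV[R]_n) : \bar R :=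
  ereal_sup (range (fun lam : 'rV[R]_n =>
    (\sum_(i < n) x 0 i * lam 0 i - 2^-1 * (lam *m V *m lam^T) 0 0)%R%:E)).

Definition good_rate_function (n : nat) (I : 'rV[R]_n -> \bar R) : Prop :=
  [/\ forall x, 0 <= I x, lower_semicontinuous I &
      forall c : R, compact [set x | I x <= c%:E]].

Definition borel_rV (n : nat) : set (set 'rV[R]_n) :=
  <<s [set U : set 'rV[R]_n | open U] >>.

Definition elog (x : \bar R) : \bar R :=
  if x == 0 then -oo else (ln (fine x))%:E.

Definition dev_principle (n : nat) (s : nat -> R)
  (Pr : nat -> set 'rV[R]_n -> \bar R) (I : 'rV[R]_n -> \bar R) : Prop :=
  forall G, borel_rV G ->
  let u := fun N => (s N)^-1%:E * elog (Pr N G) in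
  [/\ - ereal_inf (I @` (G°)) <= limn_einf u,
      limn_einf u <= limn_esup u &
      limn_esup u <= - ereal_inf (I @` closure G)].

End LDP.

(* Main.v *)
Require Import Defs.
From HB Require Import structures.
From mathcomp Require Import all_boot all_order all_algebra.
From mathcomp Require Import all_classical all_reals all_analysis.
From mathcomp Require Import measurable_realfun ring lra.
Import Order.TTheory GRing.Theory Num.Theory.
Import numFieldNormedType.Exports.
Local Open Scope classical_set_scope.
Local Open Scope ring_scope.
Set Implicit Arguments. Unset Strict Implicit. Unset Printing Implicit Defensive.

(* Given the generations up to time t, the particles at time t+1 are i.i.d. and the mean of a
   function h under their law is the ratio [trans] of two empirical means of generation t. With
   eps = b_N / sqrt N, expanding the exponential moment of one particle to second order in eps
   shows that, up to errors negligible at speed b_N^2 = N eps^2, integrating out generation t+1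
   adds sigma^2(phi_{t+1}) / 2 to the exponent and replaces phi_t by
   phi_t + kappa^-1 L(phi_{t+1} - m(phi_{t+1})); the exceptional event where the empirical
   denominator is far from kappa has probability exp(-c N), which beats the crude bound
   exp(C N eps) on the integrand. By induction the normalised log-moment generating function of
   the fluctuation vector converges to a quadratic form, whose recursion is that of V. This form
   may be degenerate, but it is finite and smooth: half-spaces and Chernoff bounds give the upper
   bound, exponential tilting gives the lower bound at the points of the row space of V, and
   elsewhere the rate is infinite. *)

(** * Bounded measurable functions and positive functionals *)

(** The obstacle is the linear term eps * Y / D of the conditional exponent, where Y is the
    empirical mean of L(phi_{t+1} - m(phi_{t+1})) and D that of L 1. It is of second order only
    where Y is of order eps, while Y is merely bounded, and the event that |Y| exceeds A eps is not
    rare enough to be paid for by the crude bound. This region is handled by the induction itself.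
    With v = N eps^2 and k = kappa, exp(N eps (2/k) |Y|) is there at most exp(-v A) exp(N eps (2/k +
    1) |Y|), and the mean of the last factor against the remaining integrand is bounded by the
    induction hypothesis for phi_t plus or minus (2/k + 1) L(phi_{t+1} - m(phi_{t+1})). So the limit
    has to be proved for all families of bounded test functions at once. Filter, empirical measure,
    conditional law of a particle and expectation are all treated as positive linear functionals on
    bounded measurable functions. Two of them that agree on indicators agree everywhere, which
    extends a law given on product sets and past events to exponential integrands. *)

Section BoundedMeasurable.
Context d (T : measurableType d) (R : realType).
Implicit Types (f g : T -> R).

Definition bm f := measurable_fun setT f /\ exists M, forall x, `|f x| <= M.

Lemma bm_eq f g : f =1 g -> bm f -> bm g.
Proof. by move=> /funext ->. Qed.

Lemma bm_cst c : bm (fun=> c).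
Proof. by split; [exact: measurable_cst|exists `|c|]. Qed.

Lemma bmD f g : bm f -> bm g -> bm (fun x => f x + g x).
Proof.
move=> [mf [M hM]] [mg [M' hM']]; split; first exact: measurable_funD.
by exists (M + M') => x; apply: le_trans (ler_normD _ _) _; apply: lerD.
Qed.

Lemma bmM f g : bm f -> bm g -> bm (fun x => f x * g x).
Proof.
move=> [mf [M hM]] [mg [M' hM']]; split; first exact: measurable_funM.
by exists (M * M') => x; rewrite normrM; apply: ler_pM.
Qed.

Lemma bmZ c f : bm f -> bm (fun x => c * f x).
Proof. by move=> bf; apply: (bmM (bm_cst c) bf). Qed.

Lemma bmN f : bm f -> bm (fun x => - f x).
Proof.
by move=> /(bmZ (-1)); congr bm; apply/funext => x; rewrite mulN1r.
Qed.

Lemma bmB f g : bm f -> bm g -> bm (fun x => f x - g x).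
Proof. by move=> bf /bmN; exact: bmD. Qed.

Lemma bm_expR f : bm f -> bm (fun x => expR (f x)).
Proof.
move=> [mf [M hM]]; split; first exact: measurableT_comp.
exists (expR M) => x; rewrite ger0_norm ?expR_ge0// ler_expR.
exact: le_trans (ler_norm _) (hM x).
Qed.

Lemma bmX f n : bm f -> bm (fun x => f x ^+ n).
Proof.
move=> [mf [M hM]]; split; first exact: measurable_funX.
by exists (M ^+ n) => x; rewrite normrX lerXn2r ?nnegrE ?(le_trans (normr_ge0 _) (hM x)).
Qed.

Lemma bm_sum (I : Type) (r : seq I) (F : I -> T -> R) :
  (forall i, bm (F i)) -> bm (fun x => \sum_(i <- r) F i x).
Proof.
move=> bF; elim: r => [|i r IH].
  by apply: bm_eq (bm_cst 0) => x; rewrite big_nil.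
by apply: bm_eq (bmD (bF i) IH) => x; rewrite big_cons.
Qed.

Lemma bm_prod_in (I : eqType) (r : seq I) (P : pred I) (F : I -> T -> R) :
  (forall i, i \in r -> P i -> bm (F i)) -> bm (fun x => \prod_(i <- r | P i) F i x).
Proof.
elim: r => [|i r IH] bF.
  by apply: bm_eq (bm_cst 1) => x; rewrite big_nil.
have /IH {}IH : forall j, j \in r -> P j -> bm (F j).
  by move=> j jr; apply: bF; rewrite inE jr orbT.
case: (boolP (P i)) => Pi; last first.
  by apply: bm_eq IH => x; rewrite big_cons (negbTE Pi).
have bi : bm (F i) by apply: bF; rewrite ?inE ?eqxx.
by apply: bm_eq (bmM bi IH) => x; rewrite big_cons Pi.
Qed.

Lemma bm_indic (A : set T) : measurable A -> bm (\1_A).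
Proof.
move=> mA; split; first exact: measurable_indic.
by exists 1 => x; rewrite indicE; case: (x \in A); rewrite ?normr1 ?normr0.
Qed.

Lemma bm_ind (b : T -> bool) : measurable_fun setT b -> bm (fun x => (b x)%:R).
Proof.
move=> mb; split; last first.
  by exists 1 => x; case: (b x); rewrite ?normr1 ?normr0.
rewrite (_ : (fun _ => _) = (fun x => if b x then 1 else 0)).
  by apply: measurable_fun_ifT => //; exact: measurable_cst.
by apply/funext => x; case: (b x).
Qed.

Lemma bm_le f g : bm f -> bm g -> bm (fun x => (f x <= g x)%R%:R).
Proof. by move=> [mf _] [mg _]; apply: bm_ind; exact: measurable_fun_ler. Qed.

Lemma bm_ge c f : bm f -> bm (fun x => (c <= f x)%R%:R : R).
Proof. exact: bm_le (bm_cst c). Qed.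

Lemma bm_bounded f : bm f -> exists2 M, 0 < M & forall x, `|f x| <= M.
Proof.
move=> [_ [M hM]]; exists (`|M| + 1); first by rewrite ltr_wpDl.
by move=> x; apply: le_trans (hM x) _; rewrite ler_wpDr// ler_norm.
Qed.

End BoundedMeasurable.

Lemma bm_comp d d' (T : measurableType d) (T' : measurableType d') (R : realType)
  (f : T -> R) (X : T' -> T) :
  measurable_fun setT X -> bm f -> bm (fun x => f (X x)).
Proof.
move=> mX [mf [M hM]]; split; first exact: measurableT_comp.
by exists M => x.
Qed.

Section PosFun.
Context d (T : measurableType d) (R : realType).
Implicit Types (f g : T -> R) (Phi Psi : (T -> R) -> R).

(** Only values on bounded measurable functions matter, so no integrability condition appears later.
    Continuity along monotone sequences is not part of the notion: uniform approximation by step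
    functions does its work in [posfun_ext]. *)
Definition posfun Phi :=
  [/\ forall f g, bm f -> bm g -> Phi (fun x => f x + g x) = Phi f + Phi g,
      forall c f, bm f -> Phi (fun x => c * f x) = c * Phi f &
      forall f, bm f -> (forall x, 0 <= f x) -> 0 <= Phi f].

Section Basic.
Variable Phi : (T -> R) -> R.
Hypothesis pPhi : posfun Phi.

Lemma posfunD f g : bm f -> bm g -> Phi (fun x => f x + g x) = Phi f + Phi g.
Proof. by case: pPhi => + _ _; exact. Qed.

Lemma posfunZ c f : bm f -> Phi (fun x => c * f x) = c * Phi f.
Proof. by case: pPhi => _ + _; exact. Qed.

Lemma posfun_ge0 f : bm f -> (forall x, 0 <= f x) -> 0 <= Phi f.
Proof. by case: pPhi => _ _; exact. Qed.

Lemma posfunN f : bm f -> Phi (fun x => - f x) = - Phi f.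
Proof.
move=> bf; rewrite -[RHS]mulN1r -posfunZ//; congr Phi.
by apply/funext => x; rewrite mulN1r.
Qed.

Lemma posfunB f g : bm f -> bm g -> Phi (fun x => f x - g x) = Phi f - Phi g.
Proof. by move=> bf bg; rewrite posfunD ?posfunN//; exact: bmN. Qed.

Lemma posfun_cst c : Phi (fun=> c) = c * Phi (fun=> 1).
Proof.
rewrite -posfunZ; last exact: bm_cst.
by congr Phi; apply/funext => x; rewrite mulr1.
Qed.

Lemma posfun_le f g : bm f -> bm g -> (forall x, f x <= g x) -> Phi f <= Phi g.
Proof.
move=> bf bg fg; rewrite -subr_ge0 -posfunB//; apply: posfun_ge0.
  exact: bmB.
by move=> x; rewrite subr_ge0.
Qed.

Lemma posfun_sum (I : Type) (r : seq I) (F : I -> T -> R) :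
  (forall i, bm (F i)) ->
  Phi (fun x => \sum_(i <- r) F i x) = \sum_(i <- r) Phi (F i).
Proof.
move=> bF; elim: r => [|i r IH].
  rewrite big_nil -[RHS](mul0r (Phi (fun=> 1))) -posfun_cst; congr Phi.
  by apply/funext => x; rewrite big_nil.
rewrite big_cons -IH -posfunD//; last exact: bm_sum.
by congr Phi; apply/funext => x; rewrite big_cons.
Qed.

Lemma posfun_norm f M : bm f -> (forall x, `|f x| <= M) -> `|Phi f| <= M * Phi (fun=> 1).
Proof.
move=> bf hM; rewrite ler_norml -mulNr -!posfun_cst; apply/andP; split.
  by apply: posfun_le => // [|x]; [exact: bm_cst|move: (hM x); rewrite ler_norml => /andP[]].
by apply: posfun_le => // [|x]; [exact: bm_cst|move: (hM x); rewrite ler_norml => /andP[]].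
Qed.

End Basic.

(** The sum counts the integers of [1, y], so it is the integer part of [y]. *)
Lemma sum_threshold (n : nat) (y : R) : 0 <= y <= n%:R ->
  (\sum_(k < n) (k.+1%:R <= y)%R%:R : R) <= y
    <= \sum_(k < n) (k.+1%:R <= y)%R%:R + 1.
Proof.
elim: n => [|n IH] /andP[y0 yn].
  by rewrite big_ord0 y0/= add0r (le_trans yn).
rewrite big_ord_recr/=; case: (leP y n%:R) => [yn'|yn'].
  rewrite [(n.+1%:R <= y)]leNgt (_ : y < n.+1%:R) ?addr0.
    by apply: IH; rewrite y0.
  by rewrite (le_lt_trans yn')// ltr_nat.
rewrite (eq_bigr (fun=> 1)); last first.
  move=> i _; rewrite (_ : _ <= y)// (le_trans _ (ltW yn'))// ler_nat.
  exact: ltn_ord.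
rewrite sumr_const card_ord; case: (leP n.+1%:R y) => h /=.
  by rewrite -[n.+1%:R]natr1 in h yn *; lra.
by rewrite -[n.+1%:R]natr1 in h yn *; lra.
Qed.

(* A function with values in [0, 1] is within 1/n of the average of the indicators of
   [k/n <= f], 1 <= k <= n. *)
Lemma posfun_ext Phi Psi : posfun Phi -> posfun Psi ->
  (forall A, measurable A -> Phi \1_A = Psi \1_A) ->
  forall f, bm f -> Phi f = Psi f.
Proof.
have half Phi1 Psi1 f : posfun Phi1 -> posfun Psi1 ->
    (forall A, measurable A -> Phi1 \1_A = Psi1 \1_A) ->
    bm f -> (forall x, 0 <= f x <= 1) -> Phi1 f <= Psi1 f.
  move=> p1 p2 h bf f01.
  have key n : Phi1 f <= Psi1 f + n.+1%:R^-1 * Phi1 (fun=> 1).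
    have n0 : (0 : R) < n.+1%:R by [].
    pose A k := [set x | (k.+1%:R : R) <= n.+1%:R * f x].
    have mA k : measurable (A k).
      rewrite -[A k]setTI; have := @measurable_fun_ler _ _ _ setT (fun=> k.+1%:R)
        (fun x => n.+1%:R * f x) (@measurable_cst _ _ _ _ _ _) (bmZ n.+1%:R bf).1.
      by move=> /(_ measurableT [set true] I).
    pose s x : R := \sum_(k < n.+1) \1_(A k) x.
    have sE x : s x = \sum_(k < n.+1) (k.+1%:R <= n.+1%:R * f x)%R%:R.
      apply: eq_bigr => k _; rewrite indicE; congr (_%:R).
      congr nat_of_bool; apply/idP/idP; first by rewrite inE.
      by move=> ?; rewrite inE.
    have bs : bm s by apply: bm_sum => k; exact: bm_indic.
    have sP x : s x <= n.+1%:R * f x <= s x + 1.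
      rewrite sE; apply: sum_threshold; case/andP: (f01 x) => f0 f1.
      by rewrite mulr_ge0//= ler_piMr.
    have Es : Phi1 s = Psi1 s.
      have bA (i : 'I_n.+1) : bm (\1_(A i) : T -> R) by exact: bm_indic.
      by rewrite !posfun_sum//; apply: eq_bigr => i _; exact: h.
    rewrite -(ler_pM2l n0) mulrDr mulrA divff// mul1r -!posfunZ//.
    apply: (@le_trans _ _ (Phi1 (fun x => s x + 1))).
      apply: posfun_le => //; [exact: bmZ|apply: bmD => //; exact: bm_cst|].
      by move=> x; case/andP: (sP x).
    rewrite posfunD// ?lerD2r ?Es; last exact: bm_cst.
    by apply: posfun_le => //; [exact: bmZ|move=> x; case/andP: (sP x)].
  apply/ler_addgt0Pr => e e0.
  have c0 : 0 <= Phi1 (fun=> 1) by apply: posfun_ge0 => //; exact: bm_cst.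
  have [n hn] : exists n, Phi1 (fun=> 1) / e < n.+1%:R.
    exists (Num.truncn (Phi1 (fun=> 1) / e)).
    by have /andP[] := truncn_itv (divr_ge0 c0 (ltW e0)).
  apply: le_trans (key n) _; rewrite lerD2l mulrC ler_pdivrMr//.
  by rewrite mulrC -ler_pdivrMr// ltW.
move=> p1 p2 h f bf; have [M M0 hM] := bm_bounded bf.
pose g x := (2 * M)^-1 * (f x + M).
have bg : bm g by apply: bmZ; apply: bmD => //; exact: bm_cst.
have M20 : 0 < 2 * M by rewrite mulr_gt0.
have g01 x : 0 <= g x <= 1.
  move: (hM x); rewrite ler_norml => /andP[h1 h2].
  have fM0 : 0 <= f x + M by lra.
  rewrite /g mulrC divr_ge0 ?(ltW M20)//=.
  by rewrite ler_pdivrMr//; lra.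
have Eg : Phi g = Psi g.
  by apply/eqP; rewrite eq_le !half// => A mA; rewrite h.
have -> : f = (fun x => 2 * M * g x - M * \1_setT x).
  apply/funext => x; rewrite /g indicT/= mulrA divff ?gt_eqF// mul1r mulr1.
  by rewrite addrK.
have bT : bm (fun x : T => M * \1_setT x).
  by apply: bmZ; exact: bm_indic.
rewrite !posfunB//; try exact: bmZ.
have bT1 : bm (\1_setT : T -> R) by exact: bm_indic.
by rewrite (posfunZ p1 _ bg) (posfunZ p2 _ bg) (posfunZ p1 _ bT1) (posfunZ p2 _ bT1) Eg h.
Qed.

End PosFun.

Section WeightedIntegral.
Context d (T : measurableType d) (R : realType) (mu : {measure set T -> \bar R}).
Implicit Types (f g p : T -> R).

Definition weight p := [/\ measurable_fun setT p, forall x, 0 <= p x &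
  (\int[mu]_x (p x)%:E < +oo)%E].

Lemma weight_integrable p f : weight p -> bm f ->
  mu.-integrable setT (EFin \o (fun x => f x * p x)).
Proof.
move=> [mp p0 ip] [mf [M hM]].
have pI : mu.-integrable setT (EFin \o p).
  apply/integrableP; split; first exact/measurable_EFinP.
  by under eq_integral do rewrite /= ger0_norm//.
apply: (@le_integrable _ _ _ mu setT measurableT _ (EFin \o (fun x => M * p x))).
- by apply/measurable_EFinP; exact: measurable_funM.
- move=> x _; rewrite /= lee_fin normrM [leRHS]normrM (ger0_norm (p0 x)).
  by apply: ler_wpM2r => //; apply: le_trans (hM x) (ler_norm _).
- rewrite (_ : _ \o _ = (fun x => M%:E * (EFin \o p) x)%E) //.
  exact: integrableZl.
Qed.

Lemma posfun_weight p : weight p -> posfun (fun f => Rintegral mu setT (fun x => f x * p x)).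
Proof.
move=> wp; split.
- move=> f g bf bg; rewrite -RintegralD//; try exact: weight_integrable.
  by congr (Rintegral mu setT _); apply/funext => x; rewrite mulrDl.
- move=> c f bf; rewrite -RintegralZl//; last exact: weight_integrable.
  by congr (Rintegral mu setT _); apply/funext => x; rewrite mulrA.
- move=> f bf f0; apply: Rintegral_ge0 => x _; apply: mulr_ge0 => //.
  by case: wp.
Qed.

End WeightedIntegral.

(** * One step of the filter *)

Section Tonelli.
Context d (T : measurableType d) (R : realType) (mu : {measure set T -> \bar R}).
Hypothesis smu : sigma_finite setT mu.

(** Fubini-Tonelli is stated for bundled sigma-finite measures, whereas sigma-finiteness is here a
    hypothesis on [mu]; the same set function is repackaged. *)
Lemma sigma_finite_measure_of :
  exists mu' : {sigma_finite_measure set T -> \bar R}, mu' = mu :> (set T -> \bar R).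
Proof.
pose K1 := isSFinite.Build _ _ _ (mu : set T -> \bar R)
  (sfinite_measure_sigma_finite smu).
pose K2 := isSigmaFinite.Build _ _ _ (mu : set T -> \bar R) smu.
pose mu' := HB.pack_for (SigmaFiniteMeasure.type T R) (Measure.sort mu) K1 K2.
by exists mu'.
Qed.

Lemma tonelli (f : T * T -> \bar R) : measurable_fun setT f ->
  (forall z, 0 <= f z)%E ->
  [/\ measurable_fun setT (fun x => \int[mu]_y f (x, y))%E,
      measurable_fun setT (fun y => \int[mu]_x f (x, y))%E &
      (\int[mu]_x \int[mu]_y f (x, y) = \int[mu]_y \int[mu]_x f (x, y))%E].
Proof.
move=> mf f0; have [mu' <-] := sigma_finite_measure_of; split.
- exact: (measurable_fun_fubini_tonelli_F (m2 := mu')).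
- exact: (measurable_fun_fubini_tonelli_G (m1 := mu')).
- exact: fubini_tonelli.
Qed.

End Tonelli.

Section Transition.
Context d (T : measurableType d) (R : realType) (mu : {measure set T -> \bar R}).
Hypothesis smu : sigma_finite setT mu.
Variables (a : T -> T -> R) (g : T -> R) (C : R).
Hypotheses (ma : measurable_fun setT (fun z : T * T => a z.1 z.2))
  (a0 : forall x y, 0 <= a x y) (a1 : forall x, (\int[mu]_y (a x y)%:E = 1)%E)
  (mg : measurable_fun setT g) (g0 : forall x, 0 <= g x)
  (ag : forall x, (0 < \int[mu]_u (a x u * g u)%:E <= C%:E)%E).

Let L (h : T -> R) (x : T) : R := Rintegral mu setT (fun u => a x u * g u * h u).

Let ma1 x : measurable_fun setT (a x).
Proof. exact: (measurable_fun_pair2 x ma). Qed.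

Lemma weight_kernel x : weight mu (fun u => a x u * g u).
Proof.
split; first exact: measurable_funM.
  by move=> u; rewrite mulr_ge0.
by case/andP: (ag x) => _ h; rewrite (le_lt_trans h)// ltry.
Qed.

Lemma posfun_kernel x : posfun (L ^~ x).
Proof.
have := posfun_weight (weight_kernel x); congr posfun.
apply/funext => f; congr (Rintegral mu setT _).
by apply/funext => u; rewrite mulrC.
Qed.

Lemma kernel_one_bounds x : 0 < L (fun=> 1) x <= C.
Proof.
rewrite /L /Rintegral.
have -> : (\int[mu]_u (a x u * g u * 1)%:E = \int[mu]_u (a x u * g u)%:E)%E.
  by apply: eq_integral => u _; rewrite mulr1.
have := ag x; set I := (\int[mu]_x0 _)%E => /andP[I0 IC].
have If : I \is a fin_num by rewrite ge0_fin_numE ?ltW// (le_lt_trans IC)// ltry.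
by move: I0 IC; rewrite -(fineK If) !lte_fin !lee_fin => -> ->.
Qed.

Lemma kernel_bound h M x : bm h -> (forall u, `|h u| <= M) -> `|L h x| <= M * L (fun=> 1) x.
Proof. by move=> bh hM; apply: (posfun_norm (posfun_kernel x) bh hM). Qed.

Lemma bm_kernel h : bm h -> bm (L h).
Proof.
have pos f : bm f -> (forall x, 0 <= f x) -> measurable_fun setT (L f).
  move=> [mf _] f0.
  pose z (z : T * T) := (a z.1 z.2 * g z.2 * f z.2)%:E.
  have mz : measurable_fun setT z.
    apply/measurable_EFinP; apply: measurable_funM; last exact: measurableT_comp.
    by apply: measurable_funM => //; exact: measurableT_comp.
  have z0 t : (0 <= z t)%E by rewrite lee_fin !mulr_ge0.
  have [m1 _ _] := tonelli smu mz z0.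
  exact: measurableT_comp m1.
move=> bh; have [M M0 hM] := bm_bounded bh.
have bhM : bm (fun x => h x + M) by apply: bmD => //; exact: bm_cst.
split; last first.
  exists (M * C) => x; apply: le_trans (kernel_bound x bh hM) _.
  by rewrite ler_pM2l//; case/andP: (kernel_one_bounds x).
(* Tonelli gives measurability for nonnegative integrands only, hence the shift of [h] by its
   bound. *)
have E : L h = (fun x => L (fun u => h u + M) x - L (fun=> M) x).
  apply/funext => x; rewrite (posfunD (posfun_kernel x) bh (bm_cst T M)).
  by rewrite addrK.
rewrite E; apply: measurable_funB; apply: pos => //.
- by move=> x; have := hM x; rewrite ler_norml => /andP[? _]; lra.
- exact: bm_cst.
- by move=> x; exact: ltW.
Qed.

Variable p : T -> R.
Hypotheses (wp : weight mu p) (p1 : (\int[mu]_x (p x)%:E = 1)%E).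

Let F x := Rintegral mu setT (fun v => p v * a v x).
Let u x := g x * F x.

Let mpa : measurable_fun setT (fun z : T * T => p z.1 * a z.1 z.2).
Proof.
by case: wp => mp _ _; apply: measurable_funM => //; exact: measurableT_comp.
Qed.

Let p0 x : 0 <= p x. Proof. by case: wp. Qed.

Let pa (z : T * T) := (p z.1 * a z.1 z.2)%:E.

Let mpaE : measurable_fun setT pa. Proof. exact/measurable_EFinP. Qed.

Let pa0 z : (0 <= pa z)%E. Proof. by rewrite lee_fin mulr_ge0. Qed.

Let mF : measurable_fun setT F.
Proof.
have [_ m2 _] := tonelli smu mpaE pa0.
exact: measurableT_comp m2.
Qed.

Let F0 x : 0 <= F x.
Proof. by apply: Rintegral_ge0 => v _; rewrite mulr_ge0. Qed.

(* The integral [F x] may be infinite on a null set of [x], where [fine] makes it 0. *)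
Lemma transition_adjoint_ge0 h : bm h -> (forall x, 0 <= h x) ->
  (\int[mu]_x (h x * u x)%:E = \int[mu]_v (L h v * p v)%:E)%E.
Proof.
move=> [mh bh] h0.
pose G x := (\int[mu]_v (p v * a v x)%:E)%E.
have [_ mG EG] := tonelli smu mpaE pa0.
have G0 x : (0 <= G x)%E by apply: integral_ge0 => v _; rewrite lee_fin mulr_ge0.
(* Kernel and density both have mass 1, so [G] is integrable and thus finite almost everywhere;
   there [F] is its true value. *)
have IG : (\int[mu]_x G x = 1)%E.
  rewrite -EG -p1; apply: eq_integral => v _.
  transitivity (\int[mu]_x ((p v)%:E * (a v x)%:E))%E; first exact: eq_integral.
  rewrite ge0_integralZl_EFin//; last 2 first.
  - by move=> x _; rewrite lee_fin.
  - exact/measurable_EFinP.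
  by rewrite a1 mule1.
have iG : mu.-integrable setT G.
  apply/integrableP; split => //; under eq_integral do rewrite gee0_abs//.
  by rewrite IG ltry.
have mhg : measurable_fun setT (fun x => h x * g x) by exact: measurable_funM.
have E1 : (\int[mu]_x (h x * u x)%:E = \int[mu]_x ((h x * g x)%:E * G x))%E.
  apply: ge0_ae_eq_integral => //.
  - apply/measurable_EFinP; apply: measurable_funM => //.
    exact: measurable_funM.
  - by apply: emeasurable_funM => //; exact/measurable_EFinP.
  - by move=> x _; rewrite lee_fin !mulr_ge0.
  - by move=> x _; rewrite mule_ge0// lee_fin mulr_ge0.
  apply: filterS (integrable_ae measurableT iG) => x /(_ I) Gf _.
  by rewrite /u mulrA EFinM /F /Rintegral fineK.
rewrite E1.
pose hpa (z : T * T) := (h z.2 * g z.2 * (p z.1 * a z.1 z.2))%:E.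
have mhpa : measurable_fun setT hpa.
  by apply/measurable_EFinP; apply: measurable_funM => //; exact: measurableT_comp mhg _.
have hpa0 z : (0 <= hpa z)%E by rewrite lee_fin !mulr_ge0.
have [_ _ EK] := tonelli smu mhpa hpa0.
transitivity (\int[mu]_x \int[mu]_v (h x * g x * (p v * a v x))%:E)%E.
  apply: eq_integral => x _; rewrite /G -ge0_integralZl_EFin//.
  - by move=> v _; rewrite lee_fin mulr_ge0.
  - by apply/measurable_EFinP; exact: (measurable_fun_pair1 x mpa).
  - by rewrite mulr_ge0.
rewrite -EK; apply: eq_integral => v _.
have iL : (\int[mu]_x (a v x * g x * h x)%:E = (L h v)%:E)%E.
  rewrite /L /Rintegral fineK//; apply: integrable_fin_num => //.
  have := weight_integrable (weight_kernel v) (conj mh bh).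
  by congr (_.-integrable _ _); apply/funext => x /=; rewrite mulrC.
rewrite EFinM -iL muleC -ge0_integralZl_EFin//.
- by apply: eq_integral => x _; rewrite -EFinM; congr EFin; ring.
- by move=> x _; rewrite lee_fin !mulr_ge0.
- by apply/measurable_EFinP; apply: measurable_funM => //; exact: measurable_funM.
Qed.

(** The mass of [u] is read off the adjoint identity at the constant 1: it is the mean of the
    bounded function [L 1]. *)
Lemma weight_transition : weight mu u.
Proof.
split; first exact: measurable_funM.
  by move=> x; rewrite mulr_ge0.
have mLp : measurable_fun setT (fun v => L (fun=> 1) v * p v).
  by case: wp => mp _ _; apply: measurable_funM => //; case: (bm_kernel (bm_cst T 1)).
have := transition_adjoint_ge0 (bm_cst T 1) (fun=> ler01).
under eq_integral do rewrite mul1r; move=> ->.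
have := weight_integrable wp (bm_kernel (bm_cst T 1)).
move=> /integrableP[_]; apply: le_lt_trans; apply: ge0_le_integral => //.
- move=> x _; rewrite lee_fin mulr_ge0//.
  by case/andP: (kernel_one_bounds x) => /ltW.
- exact/measurable_EFinP.
- by apply: measurableT_comp => //; exact/measurable_EFinP.
- by move=> x _; rewrite lee_fin ler_norm.
Qed.

(** Both sides are positive functionals of [h], so the nonnegative case, applied to indicators,
    determines them. *)
Lemma transition_adjoint h : bm h ->
  Rintegral mu setT (fun x => h x * u x) = Rintegral mu setT (fun v => L h v * p v).
Proof.
move=> bh; pose Psi f := Rintegral mu setT (fun v => L f v * p v).
have pPsi : posfun Psi.
  rewrite /Psi; have [pD pZ p0'] := posfun_weight wp; split.
  - move=> f1 f2 b1 b2; rewrite -pD; try exact: bm_kernel.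
    congr (Rintegral mu setT _); apply/funext => x.
    by rewrite (posfunD (posfun_kernel x)).
  - move=> c f bf; rewrite -pZ; last exact: bm_kernel.
    congr (Rintegral mu setT _); apply/funext => x.
    by rewrite (posfunZ (posfun_kernel x)).
  - move=> f bf f0; apply: p0' => [|x]; first exact: bm_kernel.
    by case: (posfun_kernel x) => _ _; exact.
rewrite -[RHS]/(Psi h); apply: (posfun_ext (posfun_weight weight_transition) pPsi _ bh).
move=> A mA; rewrite /Psi /Rintegral transition_adjoint_ge0//.
exact: bm_indic.
Qed.

(** If the mean vanished, [L 1 * p] would be 0 almost everywhere; as [L 1] is positive everywhere,
    so would [p], against its mass 1. *)
Lemma kernel_one_mean_gt0 : 0 < Rintegral mu setT (fun v => L (fun=> 1) v * p v).
Proof.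
have iL := weight_integrable wp (bm_kernel (bm_cst T 1)).
have L0 v : 0 < L (fun=> 1) v by case/andP: (kernel_one_bounds v).
rewrite lt_neqAle Rintegral_ge0 ?andbT; last first.
  by move=> v _; rewrite mulr_ge0// ltW.
apply/eqP => E; have [mLp _] := integrableP _ _ _ iL.
have E0 : (\int[mu]_v `|(L (fun=> 1) v * p v)%:E| = 0)%E.
  under eq_integral do rewrite gee0_abs ?lee_fin ?mulr_ge0 ?(ltW (L0 _))//.
  rewrite -[LHS]fineK; first by rewrite [X in X%:E](esym E).
  by have := integrable_fin_num measurableT iL.
have /(ae_eq_integral_abs mu measurableT mLp) ae0 := E0.
have : (\int[mu]_x (p x)%:E = \int[mu]_x (cst 0 x))%E.
  case: wp => mp _ _.
  apply: ge0_ae_eq_integral => //.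
  - by apply/measurable_EFinP.
  - by move=> x _; rewrite lee_fin.
  apply: filterS ae0 => x /(_ I) /= [] /eqP; rewrite mulf_eq0 gt_eqF//=.
  by move=> /eqP ->.
by rewrite p1 integral0 => /eqP; rewrite onee_eq0.
Qed.

End Transition.

(** * Independent sampling *)

Lemma Rintegral_sum d (T : measurableType d) (R : realType) (mu : {measure set T -> \bar R})
  (I : Type) (r : seq I) (F : I -> T -> R) :
  (forall i, mu.-integrable setT (EFin \o F i)) ->
  mu.-integrable setT (EFin \o (fun x => \sum_(i <- r) F i x)) /\
  Rintegral mu setT (fun x => \sum_(i <- r) F i x) = \sum_(i <- r) Rintegral mu setT (F i).
Proof.
move=> iF; elim: r => [|i r [IH1 IH2]].
  have -> : (fun x => \sum_(i <- [::]) F i x) = cst 0.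
    by apply/funext => x; rewrite big_nil.
  split; first exact: integrable0.
  by rewrite big_nil /Rintegral integral0.
have -> : (fun x => \sum_(j <- i :: r) F j x) = (fun x => F i x + \sum_(j <- r) F j x).
  by apply/funext => x; rewrite big_cons.
split; last by rewrite RintegralD// big_cons IH2.
by have := integrableD measurableT (iF i) IH1.
Qed.

Section Expectation.
Context d (Om : measurableType d) (R : realType) (P : probability Om R).

Definition Ex (f : Om -> R) : R := Rintegral P setT f.

Lemma posfun_Ex : posfun Ex.
Proof.
have w1 : weight P (fun=> 1).
  split; [exact: measurable_cst|by []|].
  by rewrite integral_cst//= mul1e; have := ltry (1 : R); rewrite -(probability_setT P).
have := posfun_weight w1; congr posfun; apply/funext => f.
by congr (Rintegral P setT _); apply/funext => x; rewrite mulr1.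
Qed.

Lemma Ex_cst c : Ex (fun=> c) = c.
Proof.
rewrite /Ex Rintegral_cst// -[RHS]mulr1; congr (_ * _).
by rewrite -[RHS]/(fine 1%E) -(probability_setT P).
Qed.

Lemma Ex_indic A : measurable A -> P A = (Ex \1_A)%:E.
Proof.
move=> mA; rewrite /Ex /Rintegral integral_indic// setIT fineK//.
exact: fin_num_measure.
Qed.

Lemma Ex_le f g : bm f -> bm g -> (forall w, f w <= g w) -> Ex f <= Ex g.
Proof. exact: posfun_le posfun_Ex _ _. Qed.

Lemma ExD f g : bm f -> bm g -> Ex (fun w => f w + g w) = Ex f + Ex g.
Proof. exact: posfunD posfun_Ex _ _. Qed.

Lemma ExZ c f : bm f -> Ex (fun w => c * f w) = c * Ex f.
Proof. exact: posfunZ posfun_Ex _ _. Qed.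

End Expectation.

Section ProductLaw.
Context d (Om : measurableType d) d' (T : measurableType d') (R : realType)
  (P : probability Om R) (N : nat) (X : nat -> Om -> T).
Hypothesis mX : forall i, (i < N)%N -> measurable_fun setT (X i).
(** [K w] stands for the conditional law of one particle given the past, and [H] for a nonnegative
    weight that depends on the past. *)
Variables (K : Om -> (T -> R) -> R) (H : Om -> R).
Hypotheses (pK : forall w, posfun (K w)) (bK : forall h, bm h -> bm (K ^~ h))
  (bH : bm H) (H0 : forall w, 0 <= H w).
Hypothesis lawX : forall A : nat -> set T, (forall i, measurable (A i)) ->
  Ex P (fun w => H w * \prod_(i < N) \1_(A i) (X i w)) =
  Ex P (fun w => H w * \prod_(i < N) K w \1_(A i)).

Let bprodX (Q : pred 'I_N) (h : nat -> T -> R) : (forall i, bm (h i)) ->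
  bm (fun w => \prod_(i < N | Q i) h i (X i w)).
Proof.
by move=> bh; apply: bm_prod_in => i _ _; apply: bm_comp => //; exact: mX.
Qed.

Let bprodK (Q : pred 'I_N) (h : nat -> T -> R) : (forall i, bm (h i)) ->
  bm (fun w => \prod_(i < N | Q i) K w (h i)).
Proof. by move=> bh; apply: bm_prod_in => i _ _; exact: bK. Qed.

(* Indicators are replaced by arbitrary functions one coordinate at a time. *)
Let law_upto (k : nat) (h : nat -> T -> R) : (k <= N)%N ->
  (forall i, bm (h i)) -> (forall i x, 0 <= h i x) ->
  (forall i, (k <= i)%N -> exists2 A, measurable A & h i = \1_A) ->
  Ex P (fun w => H w * \prod_(i < N) h i (X i w)) =
  Ex P (fun w => H w * \prod_(i < N) K w (h i)).
Proof.
elim: k h => [|k IH] h kN bh h0 hA.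
  have /choice[A AP] : forall i, exists A, measurable A /\ h i = \1_A.
    by move=> i; have [A] := hA i (leq0n i); exists A.
  have -> : h = (fun i => \1_(A i)) by apply/funext => i; case: (AP i).
  by apply: lawX => i; case: (AP i).
pose k' := Ordinal kN.
pose h' f (i : nat) := if i == k then f else h i.
have bh' f : bm f -> forall i, bm (h' f i) by move=> bf i; rewrite /h'; case: eqP.
(* With all other factors frozen, both sides are positive functionals of the function at coordinate
   [k]. They agree on indicators by induction, hence everywhere. *)
pose Phi f := Ex P (fun w => (H w * \prod_(i < N | i != k') h i (X i w)) * f (X k w)).
pose Psi f := Ex P (fun w => (H w * \prod_(i < N | i != k') K w (h i)) * K w f).
have PhiE f : Phi f = Ex P (fun w => H w * \prod_(i < N) h' f i (X i w)).
  congr Ex; apply/funext => w; rewrite [in RHS](bigD1 k')//= /h' eqxx -mulrA.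
  congr (_ * _); rewrite mulrC; congr (_ * _); apply: eq_bigr => i ik.
  by rewrite ifN.
have PsiE f : Psi f = Ex P (fun w => H w * \prod_(i < N) K w (h' f i)).
  congr Ex; apply/funext => w; rewrite [in RHS](bigD1 k')//= /h' eqxx -mulrA.
  congr (_ * _); rewrite mulrC; congr (_ * _); apply: eq_bigr => i ik.
  by rewrite ifN.
have bW1 : bm (fun w => H w * \prod_(i < N | i != k') h i (X i w)).
  by apply: bmM => //; exact: bprodX.
have bW2 : bm (fun w => H w * \prod_(i < N | i != k') K w (h i)).
  by apply: bmM => //; exact: bprodK.
have W10 w : 0 <= H w * \prod_(i < N | i != k') h i (X i w).
  by apply: mulr_ge0 => //; apply: prodr_ge0.
have W20 w : 0 <= H w * \prod_(i < N | i != k') K w (h i).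
  by apply: mulr_ge0 => //; apply: prodr_ge0 => i _; apply: (posfun_ge0 (pK w)).
have bfX f : bm f -> bm (fun w => f (X k w)).
  by move=> bf; apply: bm_comp => //; exact: mX.
have pPhi : posfun Phi.
  split=> [f1 f2 b1 b2|c f bf|f bf f0].
  - rewrite /Phi -ExD; [|by apply: bmM => //; exact: bfX..].
    by congr Ex; apply/funext => w; rewrite mulrDr.
  - rewrite /Phi -ExZ; last by apply: bmM => //; exact: bfX.
    by congr Ex; apply/funext => w; rewrite mulrCA.
  - apply: (posfun_ge0 (posfun_Ex P)); first by apply: bmM => //; exact: bfX.
    by move=> w; apply: mulr_ge0.
have pPsi : posfun Psi.
  split=> [f1 f2 b1 b2|c f bf|f bf f0].
  - rewrite /Psi -ExD; [|by apply: bmM => //; exact: bK..].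
    by congr Ex; apply/funext => w; rewrite (posfunD (pK w))// mulrDr.
  - rewrite /Psi -ExZ; last by apply: bmM => //; exact: bK.
    by congr Ex; apply/funext => w; rewrite (posfunZ (pK w))// mulrCA.
  - apply: (posfun_ge0 (posfun_Ex P)); first by apply: bmM => //; exact: bK.
    by move=> w; apply: mulr_ge0 => //; apply: (posfun_ge0 (pK w)).
have hk : h' (h k) = h by apply/funext => i; rewrite /h'; case: eqP => [->|].
have := posfun_ext pPhi pPsi _ (bh k); rewrite PhiE PsiE hk; apply.
move=> A mA; rewrite PhiE PsiE; have bA : bm (\1_A : T -> R) by exact: bm_indic.
apply: IH => [|i|i x|i ki].
- exact: ltnW.
- exact: bh'.
- by rewrite /h'; case: eqP => // _; rewrite indicE.
- rewrite /h'; case: eqP => [_|/eqP ik]; first by exists A.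
  by apply: hA; rewrite ltn_neqAle eq_sym ik.
Qed.

Lemma product_law (h : T -> R) : bm h -> (forall x, 0 <= h x) ->
  Ex P (fun w => H w * \prod_(i < N) h (X i w)) = Ex P (fun w => H w * K w h ^+ N).
Proof.
(* [law_upto] at [k = N] asks for indicators at all indices from [N] on; these indices do not enter
   the products. *)
move=> bh h0; pose h' i := if (i < N)%N then h else \1_setT.
have b1 : bm (\1_setT : T -> R) by exact: bm_indic.
have := @law_upto N h' (leqnn N); rewrite /h'.
have -> : (fun w => H w * \prod_(i < N) (if (i < N)%N then h else \1_setT) (X i w)) =
          (fun w => H w * \prod_(i < N) h (X i w)).
  by apply/funext => w; congr (_ * _); apply: eq_bigr => i _; rewrite ltn_ord.
have -> : (fun w => H w * \prod_(i < N) K w (if (i < N)%N then h else \1_setT)) =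
          (fun w => H w * K w h ^+ N).
  apply/funext => w; congr (_ * _); rewrite (eq_bigr (fun=> K w h)); last first.
    by move=> i _; rewrite ltn_ord.
  by rewrite prodr_const card_ord.
apply.
- by move=> i; case: ifP.
- by move=> i x; case: ifP => // _; rewrite indicE.
- by move=> i Ni; exists setT => //; rewrite ltnNge Ni.
Qed.

End ProductLaw.

(** * The particle filter *)

Section HiddenMarkov.
Context (R : realType) (d : nat) (mu : {measure set (d.-tuple R) -> \bar R}).
Local Notation X := (d.-tuple R).
Variables (a0 : X -> R) (a : nat -> X -> X -> R) (g : nat -> X -> R) (T : nat).

(** The model and Assumption A-0 as seen by the filter: times up to [T] only, with the fixed
    observations absorbed in [g]. *)
Definition hmm := [/\ sigma_finite setT mu,
  weight mu a0 /\ (\int[mu]_x (a0 x)%:E = 1)%E,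
  forall t, (1 <= t <= T)%N ->
     [/\ measurable_fun setT (fun p : X * X => a t p.1 p.2),
         (forall x x', 0 <= a t x x') &
         (forall x, \int[mu]_x' (a t x x')%:E = 1)%E],
  forall t, (1 <= t <= T)%N -> measurable_fun setT (g t) /\ forall x, 0 <= g t x &
  forall t, (1 <= t <= T)%N ->
     exists C : R, forall x, (0 < \int[mu]_u (a t x u * g t u)%:E <= C%:E)%E].

Hypothesis model : hmm.

Let m := mt mu a0 a g.
Let L := Lop mu a g.
Let kap := kappa mu a0 a g.
Let f_ := filt mu a0 a g.

Lemma posfun_Lop t x : (1 <= t <= T)%N -> posfun (fun h => L t h x).
Proof.
case: model => smu _ ha hg hC tT.
have [ma a_ge0 a1] := ha t tT; have [mg g_ge0] := hg t tT; have [C hC'] := hC t tT.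
exact: (posfun_kernel ma a_ge0 mg g_ge0 hC' x).
Qed.

Lemma bm_Lop t h : (1 <= t <= T)%N -> bm h -> bm (L t h).
Proof.
case: model => smu _ ha hg hC tT.
have [ma a_ge0 a1] := ha t tT; have [mg g_ge0] := hg t tT; have [C hC'] := hC t tT.
exact: (bm_kernel smu ma a_ge0 mg g_ge0 hC').
Qed.

Lemma Lop_one_gt0 t x : (1 <= t <= T)%N -> 0 < L t (fun=> 1) x.
Proof.
case: model => smu _ ha hg hC tT.
have [ma a_ge0 a1] := ha t tT; have [mg g_ge0] := hg t tT; have [C hC'] := hC t tT.
by have /andP[] := kernel_one_bounds hC' x.
Qed.

Lemma integrable_Lop t x h : (1 <= t <= T)%N -> bm h ->
  mu.-integrable setT (EFin \o (fun u => h u * (a t x u * g t u))).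
Proof.
case: model => smu _ ha hg hC tT bh.
have [ma a_ge0 a1] := ha t tT; have [mg g_ge0] := hg t tT; have [C hC'] := hC t tT.
exact: weight_integrable (weight_kernel ma a_ge0 mg g_ge0 hC' x) bh.
Qed.

(** Here [u] is the unnormalised filter at time [t.+1]. The last clause is the adjoint identity, and
    its case [h = 1] identifies the normalising constant with kappa. *)
Let filt_step t : (t.+1 <= T)%N -> weight mu (f_ t) -> (\int[mu]_x (f_ t x)%:E = 1)%E ->
  let u := fun x => g t.+1 x * integ mu (fun v => f_ t v * a t.+1 v x) in
  [/\ weight mu u, integ mu u = kap t.+1, 0 < kap t.+1 &
      forall h, bm h -> integ mu (fun x => h x * u x) = m t (L t.+1 h)].
Proof.
move=> tT wf f1 u; have tT' : (1 <= t.+1 <= T)%N by [].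
case: model => smu _ ha hg hC.
have [ma a_ge0 a1] := ha _ tT'; have [mg g_ge0] := hg _ tT'; have [C hC'] := hC _ tT'.
have wu : weight mu u := weight_transition smu ma a_ge0 a1 mg g_ge0 hC' wf f1.
have adj h : bm h -> integ mu (fun x => h x * u x) = m t (L t.+1 h).
  exact: (transition_adjoint smu ma a_ge0 a1 mg g_ge0 hC' wf f1).
split=> //.
- rewrite -[RHS]/(m t (L t.+1 (fun=> 1))) -(adj _ (bm_cst X 1)).
  by congr (Rintegral mu setT _); apply/funext => x; rewrite mul1r.
- exact: (kernel_one_mean_gt0 smu ma a_ge0 mg g_ge0 hC' wf f1).
Qed.

Lemma weight_filt t : (t <= T)%N -> weight mu (f_ t) /\ (\int[mu]_x (f_ t x)%:E = 1)%E.
Proof.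
elim: t => [|t IH] tT; first by case: model.
have [wf f1] := IH (ltnW tT); have /= [wu iu k0 _] := filt_step tT wf f1.
move: wu iu; set u := (fun x => _) => wu iu.
have [mu_ u0 iuoo] := wu.
have fE x : f_ t.+1 x = (kap t.+1)^-1 * u x by rewrite mulrC -iu.
have iuE : (\int[mu]_x (f_ t.+1 x)%:E = 1)%E.
  under eq_integral do rewrite fE EFinM.
  rewrite ge0_integralZl_EFin//; last 3 first.
  - by move=> x _; rewrite lee_fin.
  - exact/measurable_EFinP.
  - by rewrite invr_ge0 ltW.
  rewrite -[X in (_ * X)%E]fineK; last first.
    by rewrite ge0_fin_numE// integral_ge0// => x _; rewrite lee_fin.
  rewrite -[fine _]/(integ mu u) iu -EFinM mulVf//.
  by rewrite gt_eqF.
have mf : measurable_fun setT (f_ t.+1).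
  have -> : f_ t.+1 = (fun x => (kap t.+1)^-1 * u x) by exact/funext.
  exact: measurable_funM.
have f0 x : 0 <= f_ t.+1 x by rewrite fE mulr_ge0// invr_ge0 ltW.
by split=> //; split => //; rewrite iuE ltry.
Qed.

Lemma posfun_mt t : (t <= T)%N -> posfun (m t).
Proof. by move=> tT; apply: posfun_weight; case: (weight_filt tT). Qed.

Lemma mt_one t : (t <= T)%N -> m t (fun=> 1) = 1.
Proof.
move=> tT; have [_ f1] := weight_filt tT; rewrite /m /mt /integ /Rintegral.
by under eq_integral do rewrite mul1r; rewrite f1.
Qed.

Lemma mt_cst t c : (t <= T)%N -> m t (fun=> c) = c.
Proof. by move=> tT; rewrite (posfun_cst (posfun_mt tT)) mt_one// mulr1. Qed.

Lemma kappa_gt0 t : (t.+1 <= T)%N -> 0 < kap t.+1.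
Proof.
move=> tT; have [wf f1] := weight_filt (ltnW tT).
by have [] := filt_step tT wf f1.
Qed.

(** The adjoint identity after normalisation. It is used mainly to see that [L t.+1] sends functions
    centred at time [t.+1] to functions centred at time [t]. *)
Lemma mt_Lop t h : (t.+1 <= T)%N -> bm h -> m t (L t.+1 h) = kap t.+1 * m t.+1 h.
Proof.
move=> tT bh; have [wf f1] := weight_filt (ltnW tT).
have /= [wu iu k0 <-//] := filt_step tT wf f1.
move: wu iu; set u := (fun x => _) => wu iu.
rewrite /m /mt /integ /= -/u iu.
have -> : (fun x => h x * (u x / kap t.+1)) = (fun x => (kap t.+1)^-1 * (h x * u x)).
  by apply/funext => x; rewrite mulrA mulrC.
rewrite RintegralZl//; last exact: weight_integrable.
by rewrite mulrA divff ?mul1r// gt_eqF.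
Qed.

End HiddenMarkov.

Section Particles.
Context (R : realType) (d : nat) (mu : {measure set (d.-tuple R) -> \bar R}).
Local Notation X := (d.-tuple R).
Variables (a0 : X -> R) (a : nat -> X -> X -> R) (g : nat -> X -> R) (T : nat).
Hypothesis model : hmm mu a0 a g T.
Context (dO : measure_display) (Om : measurableType dO) (P : probability Om R).
Variables (N : nat) (xs : nat -> nat -> Om -> X).
Hypothesis N0 : (0 < N)%N.
Hypothesis law : particle_law mu a0 a g P T N xs.

Let m := mt mu a0 a g.
Let L := Lop mu a g.

Definition emp (t : nat) (h : X -> R) (w : Om) : R := N%:R^-1 * \sum_(i < N) h (xs i t w).

(** A copy of [Om] carrying the sigma-algebra of the generations before [t], so that
    [@bm _ (past t)] expresses measurability with respect to the past. *)
Definition past (t : nat) : Type := g_sigma_algebraType (past_sets N t xs).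

HB.instance Definition _ t := Measurable.on (past t).

Let N0R : (0 : R) < N%:R. Proof. by rewrite ltr0n. Qed.

Let mxs i t : (i < N)%N -> (t <= T)%N -> measurable_fun setT (xs i t).
Proof. by case: law => + _ _; exact. Qed.

Lemma past_measurable t B : (t <= T.+1)%N -> <<s past_sets N t xs >> B -> measurable B.
Proof.
move=> tT; apply: smallest_sub; first exact: sigma_algebra_measurable.
move=> _ [j [s [C [jN st mC ->]]]]; rewrite -[_ @^-1` _]setTI.
by apply: mxs => //; rewrite -ltnS (leq_trans st).
Qed.

Lemma bm_past t (H : Om -> R) : (t <= T.+1)%N -> @bm _ (past t) R H -> bm H.
Proof.
move=> tT [mH bH]; split => // _ B mB; rewrite setTI.
by apply: (past_measurable tT); have := mH measurableT B mB; rewrite setTI.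
Qed.

Lemma past_emp t s h : (s < t)%N -> bm h -> @bm _ (past t) R (emp s h).
Proof.
move=> st bh; apply: bmZ; apply: bm_sum => i; apply: bm_comp => // _ B mB.
by rewrite setTI; apply: sub_sigma_algebra; exists i, s, B.
Qed.

Lemma bm_emp t h : (t <= T)%N -> bm h -> bm (emp t h).
Proof.
by move=> tT bh; apply: bmZ; apply: bm_sum => i; apply: bm_comp => //; exact: mxs.
Qed.

Lemma posfun_emp t w : posfun (fun h => emp t h w).
Proof.
split=> [h1 h2 _ _|c h _|h _ h0].
- by rewrite /emp big_split mulrDr.
- by rewrite /emp -mulr_sumr mulrCA.
- apply: mulr_ge0; first by rewrite invr_ge0 ltW.
  by apply: sumr_ge0.
Qed.

Lemma emp_one t w : emp t (fun=> 1) w = 1.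
Proof. by rewrite /emp sumr_const card_ord mulVf// gt_eqF. Qed.

Lemma prod_emp t (h : X -> R) s w :
  \prod_(i < N) expR (s * h (xs i t w)) = expR (N%:R * (s * emp t h w)).
Proof.
rewrite -expR_sum; congr expR; rewrite -mulr_sumr /emp mulrCA.
by rewrite [N%:R * _]mulrA divff ?mul1r// gt_eqF.
Qed.

(* The conditional expectation of h(x_{i,t+1}) given the generations up to t. *)
Definition trans (t : nat) (w : Om) (h : X -> R) : R :=
  emp t (L t.+1 h) w / emp t (L t.+1 (fun=> 1)) w.

Lemma emp_Lop_one_gt0 t w : (t.+1 <= T)%N -> 0 < emp t (L t.+1 (fun=> 1)) w.
Proof.
move=> tT; rewrite /emp mulr_gt0 ?invr_gt0//.
case: N N0 => // n _; rewrite big_ord_recl ltr_wpDr//; last exact: (Lop_one_gt0 model).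
by apply: sumr_ge0 => i _; apply: ltW; exact: (Lop_one_gt0 model).
Qed.

Lemma posfun_trans t w : (t.+1 <= T)%N -> posfun (trans t w).
Proof.
move=> tT; have D0 := emp_Lop_one_gt0 w tT.
have pL x := posfun_Lop model x (tT : (1 <= t.+1 <= T)%N).
have pe := posfun_emp t w.
split=> [h1 h2 b1 b2|c h bh|h bh h0].
- rewrite /trans -mulrDl -(posfunD pe); [|exact: (bm_Lop model)..].
  congr (emp t _ w / _); apply/funext => x; exact: (posfunD (pL x)).
- rewrite /trans mulrA -(posfunZ pe); last exact: (bm_Lop model).
  congr (emp t _ w / _); apply/funext => x; exact: (posfunZ (pL x)).
- rewrite /trans divr_ge0 ?(ltW D0)//; apply: (posfun_ge0 pe); first exact: (bm_Lop model).
  by move=> x; apply: (posfun_ge0 (pL x)).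
Qed.

Lemma trans_one t w : (t.+1 <= T)%N -> trans t w (fun=> 1) = 1.
Proof. by move=> tT; rewrite /trans divff// gt_eqF// emp_Lop_one_gt0. Qed.

Lemma bm_trans t h : (t.+1 <= T)%N -> bm h -> @bm _ (past t.+1) R (trans t ^~ h).
Proof.
move=> tT bh; have [M M0 hM] := bm_bounded bh; split; last first.
  exists M => w; rewrite -[leRHS]mulr1 -(trans_one w tT).
  exact: (posfun_norm (posfun_trans w tT)).
have [m1 _] := @past_emp t.+1 t _ (ltnSn t) (bm_Lop model (tT : (1 <= t.+1 <= T)%N) bh).
have [m2 _] := @past_emp t.+1 t _ (ltnSn t) (bm_Lop model (tT : (1 <= t.+1 <= T)%N) (bm_cst X 1)).
(* The inverse of the positive denominator is written as exp(-ln) to obtain its measurability by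
   composition. *)
have -> : trans t ^~ h = (fun w => emp t (L t.+1 h) w * expR (- ln (emp t (L t.+1 (fun=> 1)) w))).
  by apply/funext => w; rewrite expRN lnK// posrE emp_Lop_one_gt0.
apply: measurable_funM => //; apply: measurableT_comp => //.
by apply: measurableT_comp => //; exact: measurableT_comp.
Qed.

(** Exchanging the mean over the particles with the integral turns the unnormalised sampling
    density, integrated against [h], into [emp t (L h)]; the case [h = 1] gives its normalising
    constant. *)
Lemma trans_indic t w A : (t.+1 <= T)%N -> measurable A ->
  fine (\int[mu]_(x in A) (pf_dens mu a g t.+1 N (fun j => xs j t w) x)%:E) =
  trans t w \1_A.
Proof.
move=> tT mA; have tT' : (1 <= t.+1 <= T)%N by [].
pose u x := g t.+1 x * (N%:R^-1 * \sum_(i < N) a t.+1 (xs i t w) x).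
have key h : bm h -> mu.-integrable setT (EFin \o (fun x => h x * u x)) /\
    Rintegral mu setT (fun x => h x * u x) = emp t (L t.+1 h) w.
  move=> bh; pose F (i : 'I_N) x := h x * (a t.+1 (xs i t w) x * g t.+1 x).
  have iF i : mu.-integrable setT (EFin \o F i) by exact: (integrable_Lop model).
  have [iS ES] := Rintegral_sum (index_enum 'I_N) iF.
  have -> : (fun x => h x * u x) = (fun x => N%:R^-1 * \sum_(i < N) F i x).
    apply/funext => x; rewrite /u mulrCA [in LHS]mulrA [LHS]mulrCA; congr (_ * _).
    rewrite mulr_sumr; apply: eq_bigr => i _; rewrite /F; ring.
  split; first by have := integrableZl measurableT (N%:R^-1 : R) iS.
  rewrite RintegralZl// ES; congr (_ * _); apply: eq_bigr => i _.
  by congr (Rintegral mu setT _); apply/funext => x; rewrite mulrC.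
have iu : integ mu u = emp t (L t.+1 (fun=> 1)) w.
  have [_ <-] := key _ (bm_cst X 1); congr (Rintegral mu setT _).
  by apply/funext => x; rewrite mul1r.
have bA : bm (\1_A : X -> R) by exact: bm_indic.
have [iA EA] := key _ bA.
rewrite -[LHS]/(Rintegral mu A _) Rintegral_mkcond /trans -EA mulrC -RintegralZl//.
congr (Rintegral mu setT _); apply/funext => x; rewrite patchE indicE.
case: (x \in A); rewrite ?mul0r ?mulr0// mul1r /pf_dens -/u iu.
by rewrite mulrC.
Qed.

Lemma indic_bigcap t (A : nat -> set X) (B : set Om) w :
  \1_(B `&` \bigcap_(i in `I_N) (xs i t @^-1` A i)) w =
  \1_B w * \prod_(i < N) \1_(A i) (xs i t w) :> R.
Proof.
rewrite !indicE; case: (pselect (B w)) => Bw; last first.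
  by rewrite (memNset Bw) mul0r memNset// => -[].
rewrite (mem_set Bw) mul1r.
case: (pselect (forall i : 'I_N, A i (xs i t w))) => h.
  rewrite mem_set; last by split => // i iN; exact: (h (Ordinal iN)).
  by rewrite big1// => i _; rewrite indicE mem_set.
rewrite memNset; last by move=> [_ hA]; apply: h => i; apply: hA; exact: ltn_ord.
have [i Ai] : exists i : 'I_N, ~ A i (xs i t w) by exact/existsNP.
by rewrite (bigD1 i)//= indicE memNset// mul0r.
Qed.

Lemma measurable_bigcap_xs t (A : nat -> set X) : (t <= T)%N ->
  (forall i, measurable (A i)) -> measurable (\bigcap_(i in `I_N) (xs i t @^-1` A i)).
Proof.
move=> tT mA; apply: bigcap_measurableType => // i iN.
by rewrite -[_ @^-1` _]setTI; exact: mxs.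
Qed.

Lemma step_law t (H : Om -> R) (h : X -> R) : (t.+1 <= T)%N ->
  @bm _ (past t.+1) R H -> (forall w, 0 <= H w) -> bm h -> (forall x, 0 <= h x) ->
  Ex P (fun w => H w * \prod_(i < N) h (xs i t.+1 w)) =
  Ex P (fun w => H w * trans t w h ^+ N).
Proof.
move=> tT bH H0 bh h0; have tT1 : (t.+1 <= T.+1)%N by exact: leqW.
apply: (@product_law _ _ _ _ _ P N (fun i => xs i t.+1) _ (trans t) H) => // [i iN|w|f bf||A mA].
- exact: mxs.
- exact: posfun_trans.
- by apply: (bm_past tT1); exact: bm_trans.
- exact: bm_past bH.
have bU1 : bm (fun w => \prod_(i < N) (\1_(A i) (xs i t.+1 w) : R)).
  apply: bm_prod_in => i _ _; apply: bm_comp; last exact: bm_indic.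
  exact: mxs.
have bU2 : bm (fun w => \prod_(i < N) trans t w \1_(A i)).
  by apply: bm_prod_in => i _ _; apply: (bm_past tT1); apply: bm_trans => //; exact: bm_indic.
(* The law is given on past events only, that is, for indicators in place of [H]. Both sides are
   positive functionals of [H] over [past t.+1], so this is enough. *)
have pos U : bm U -> (forall w, 0 <= U w) ->
    @posfun _ (past t.+1) R (fun H => Ex P (fun w => H w * U w)).
  move=> bU U0; split=> [f1 f2 b1 b2|c f bf|f bf f0].
  - rewrite -ExD; [|by apply: bmM => //; exact: bm_past tT1 _..].
    by congr Ex; apply/funext => w; rewrite mulrDl.
  - rewrite -ExZ; last by apply: bmM => //; exact: bm_past tT1 _.
    by congr Ex; apply/funext => w; rewrite mulrA.
  - apply: (posfun_ge0 (posfun_Ex P)); first by apply: bmM => //; exact: bm_past tT1 _.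
    by move=> w; rewrite mulr_ge0.
have U10 w : 0 <= \prod_(i < N) (\1_(A i) (xs i t.+1 w) : R).
  by apply: prodr_ge0 => i _; rewrite indicE.
have U20 w : 0 <= \prod_(i < N) trans t w \1_(A i).
  apply: prodr_ge0 => i _; apply: (posfun_ge0 (posfun_trans w tT)); first exact: bm_indic.
  by move=> x; rewrite indicE.
apply: (posfun_ext (pos _ bU1 U10) (pos _ bU2 U20) _ bH) => B mB.
have sB : <<s past_sets N t.+1 xs >> B by exact: mB.
have mB' : dO.-measurable B by exact: (past_measurable tT1).
case: law => _ _ /(_ t.+1 (tT : (1 <= t.+1 <= T)%N) B sB A mA).
rewrite Ex_indic; last by apply: measurableI => //; exact: measurable_bigcap_xs.
have -> : Ex P \1_(B `&` \bigcap_(i in `I_N) xs i t.+1 @^-1` A i) =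
    Ex P (fun w => \1_B w * \prod_(i < N) \1_(A i) (xs i t.+1 w)).
  by congr Ex; apply/funext => w; exact: indic_bigcap.
move=> E; have := congr1 fine E; move=> /= ->.
rewrite -[LHS]/(Rintegral P B _) Rintegral_mkcond; congr (Rintegral P setT _).
apply/funext => w; rewrite patchE indicE; case: (w \in B); rewrite ?mul0r// mul1r.
by apply: eq_bigr => i _; exact: trans_indic.
Qed.

Lemma init_law (h : X -> R) : bm h -> (forall x, 0 <= h x) ->
  Ex P (fun w => \prod_(i < N) h (xs i 0 w)) = m 0 h ^+ N.
Proof.
move=> bh h0; pose H (w : Om) : R := 1.
have pm0 : posfun (m 0) := posfun_mt model (leq0n T).
have := @product_law _ _ _ _ _ P N (fun i => xs i 0) _ (fun=> m 0) H _ _ _ _ _ h bh h0.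
have -> : (fun w => H w * m 0 h ^+ N) = (fun=> m 0 h ^+ N).
  by apply/funext => w; rewrite mul1r.
rewrite Ex_cst => <-.
- by congr Ex; apply/funext => w; rewrite mul1r.
- by move=> i iN; exact: mxs.
- by [].
- by move=> f bf; exact: bm_cst.
- exact: bm_cst.
- by [].
move=> A mA; case: law => _ /(_ A mA) + _.
rewrite -[\bigcap_(_ in _) _]setTI Ex_indic; last first.
  by apply: measurableI => //; exact: measurable_bigcap_xs.
have -> : Ex P \1_(setT `&` \bigcap_(i in `I_N) xs i 0 @^-1` A i) =
    Ex P (fun w => H w * \prod_(i < N) \1_(A i) (xs i 0 w)).
  by congr Ex; apply/funext => w; rewrite indic_bigcap indicT.
move=> [->]; rewrite -[LHS](Ex_cst P); congr Ex; apply/funext => w.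
rewrite mul1r; apply: eq_bigr => i _.
rewrite -[LHS]/(Rintegral mu (A i) _) Rintegral_mkcond; congr (Rintegral mu setT _).
by apply/funext => x; rewrite patchE indicE; case: (x \in A i); rewrite ?mul0r// mul1r.
Qed.

End Particles.

(** * Exponential moments *)

Section ExpBounds.
Context (R : realType).
Implicit Types (x y c : R).

(** From exp(-x) >= 1 - x follows exp(x) <= 1 / (1 - x), and (1 - x)(1 + x + 2 x^2) = 1 + x^2 (1 - 2
    x) >= 1. *)
Lemma expR_le2 x : `|x| <= 2^-1 -> expR x <= 1 + x + 2 * x ^+ 2.
Proof.
rewrite ler_norml => /andP[x1 x2].
have h1 := expR_ge1Dx (- x); have e0 := expR_gt0 x.
have h2 : (1 - x) * expR x <= 1.
  apply: le_trans (_ : expR (- x) * expR x <= 1); last first.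
    by rewrite expRN mulVf// gt_eqF.
  by rewrite ler_pM2r.
have h3 : 0 <= x ^+ 2 * (1 - 2 * x) by rewrite mulr_ge0 ?sqr_ge0//; lra.
have h4 : (1 - x) * expR x <= (1 - x) * (1 + x + 2 * x ^+ 2).
  apply: le_trans h2 _; rewrite -subr_ge0; apply: le_trans h3 _.
  rewrite le_eqVlt; apply/orP; left; apply/eqP; ring.
by rewrite -(@ler_pM2l _ (1 - x))//; lra.
Qed.

(** One application of the mean value theorem to the remainder, whose derivative exp(y) - 1 - y lies
    between 0 and 2 y^2 by [expR_le2]. *)
Lemma expR_taylor2 x : `|x| <= 2^-1 ->
  `|expR x - (1 + x + 2^-1 * x ^+ 2)| <= 2 * `|x| ^+ 3.
Proof.
move=> hx; pose G (y : R) := expR y - (1 + y + 2^-1 * y ^+ 2).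
have dG y : is_derive y 1 G (expR y - (1 + y)).
  apply: is_derive_eq; rewrite /GRing.scale/=; lra.
have G0 : G 0 = 0 by rewrite /G expR0; ring.
have key c : `|c| <= `|x| -> `|(expR c - (1 + c)) * x| <= 2 * `|x| ^+ 3.
  move=> cx; have c2 : `|c| <= 2^-1 by exact: le_trans cx hx.
  have l1 := expR_ge1Dx c; have l2 := expR_le2 c2.
  have cx2 : c ^+ 2 <= `|x| ^+ 2.
    by rewrite -[c ^+ 2]real_normK ?num_real// lerXn2r ?nnegrE.
  rewrite normrM [`|x| ^+ 3]exprSr mulrA ler_wpM2r//.
  by rewrite ger0_norm; lra.
have cG : continuous G.
  by move=> y; apply/differentiable_continuous/derivable1_diffP; case: (dG y).
rewrite -/(G x); case: (ltgtP x 0) => x0.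
- have [c] := @MVT R G _ x 0 x0 (fun y _ => dG y) (continuous_subspaceT cG).
  rewrite in_itv/= => /andP[c1 c2]; rewrite G0 !sub0r => /(congr1 -%R).
  rewrite opprK mulrN opprK => ->; apply: key.
  by rewrite !ltr0_norm//; lra.
- have [c] := @MVT R G _ 0 x x0 (fun y _ => dG y) (continuous_subspaceT cG).
  rewrite in_itv/= => /andP[c1 c2]; rewrite G0 !subr0 => ->; apply: key.
  by rewrite !gtr0_norm//; lra.
- by rewrite x0 G0 normr0 expr0n/= mulr0.
Qed.

(** A lower bound for log(1 + x). With y = x - 2 x^2, exp(y) <= 1 / (1 - y) and (1 - y)(1 + x) = 1 +
    x^2 (1 + 2 x) >= 1. *)
Lemma expR_le_1D x : - 2^-1 <= x -> expR (x - 2 * x ^+ 2) <= 1 + x.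
Proof.
move=> x1; set y := x - _; have h1 := expR_ge1Dx (- y); have e0 := expR_gt0 y.
have h2 : (1 - y) * expR y <= 1.
  apply: le_trans (_ : expR (- y) * expR y <= 1); last first.
    by rewrite expRN mulVf// gt_eqF.
  by rewrite ler_pM2r.
have y0 : 0 < 1 - y.
  by rewrite /y; have := sqr_ge0 (x - 4^-1); rewrite !expr2; lra.
rewrite -(@ler_pM2l _ (1 - y))//; apply: le_trans h2 _.
have h3 : 0 <= x ^+ 2 * (1 + 2 * x) by rewrite mulr_ge0 ?sqr_ge0//; lra.
rewrite -subr_ge0; apply: le_trans h3 _.
rewrite le_eqVlt; apply/orP; left; apply/eqP; rewrite /y; ring.
Qed.

End ExpBounds.

Section PosFunExp.
Context d (T : measurableType d) (R : realType) (Phi : (T -> R) -> R).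
Hypotheses (pPhi : posfun Phi) (Phi1 : Phi (fun=> 1) = 1).

Lemma posfun_le_cst h M : bm h -> (forall x, h x <= M) -> Phi h <= M.
Proof.
move=> bh hM; rewrite -[M]mulr1 -Phi1 -(posfun_cst pPhi).
by apply: (posfun_le pPhi) => //; exact: bm_cst.
Qed.

Lemma posfun_normr_le h M : bm h -> (forall x, `|h x| <= M) -> `|Phi h| <= M.
Proof. by move=> bh hM; have := posfun_norm pPhi bh hM; rewrite Phi1 mulr1. Qed.

Variables (h : T -> R) (M s : R).
Hypotheses (bh : bm h) (hM : forall x, `|h x| <= M) (s0 : 0 <= s) (sM : s * M <= 2^-1).

Let shM x : `|s * h x| <= s * M.
Proof. by rewrite normrM ger0_norm// ler_wpM2l. Qed.

Let bsh : bm (fun x => expR (s * h x)). Proof. by apply: bm_expR; exact: bmZ. Qed.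

Let poly_affine c1 c2 c3 :
  Phi (fun x => c1 + c2 * h x + c3 * h x ^+ 2) = c1 + c2 * Phi h + c3 * Phi (fun x => h x ^+ 2).
Proof.
have b2 : bm (fun x => h x ^+ 2) by exact: bmX.
rewrite (posfunD pPhi) ?(posfunD pPhi)//; try exact: bmZ; try exact: bm_cst.
  by rewrite (posfunZ pPhi)// (posfunZ pPhi)// (posfun_cst pPhi) Phi1 mulr1.
by apply: bmD; [exact: bm_cst|exact: bmZ].
Qed.

Let bpoly c1 c2 c3 : bm (fun x => c1 + c2 * h x + c3 * h x ^+ 2).
Proof.
apply: bmD; last by apply: bmZ; exact: bmX.
by apply: bmD; [exact: bm_cst|exact: bmZ].
Qed.

Lemma posfun_sqr_bounds : 0 <= Phi (fun x => h x ^+ 2) <= M ^+ 2.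
Proof.
have b2 : bm (fun x => h x ^+ 2) by exact: bmX.
apply/andP; split; first by apply: (posfun_ge0 pPhi) => // x; exact: sqr_ge0.
apply: posfun_le_cst => // x; rewrite -[_ ^+ 2]real_normK ?num_real//.
by rewrite lerXn2r ?nnegrE// (le_trans (normr_ge0 (h x))).
Qed.

(** Serves concentration, where [s] is fixed and constants are immaterial; the expansions with the
    exact second moment below serve [s = eps]. *)
Lemma posfun_expR_le : Phi (fun x => expR (s * h x)) <= expR (s * Phi h + 2 * s ^+ 2 * M ^+ 2).
Proof.
apply: le_trans (_ : 1 + s * Phi h + 2 * s ^+ 2 * Phi (fun x => h x ^+ 2) <= _).
  rewrite -poly_affine; apply: (posfun_le pPhi) => // x.
  have := expR_le2 (le_trans (shM x) sM); rewrite exprMn; lra.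
apply: le_trans (expR_ge1Dx _); rewrite -addrA lerD2l lerD2l.
by rewrite ler_wpM2l ?mulr_ge0 ?sqr_ge0//; case/andP: posfun_sqr_bounds.
Qed.

Lemma posfun_expR_taylor :
  `|Phi (fun x => expR (s * h x)) -
    (1 + s * Phi h + 2^-1 * s ^+ 2 * Phi (fun x => h x ^+ 2))| <= 2 * (s * M) ^+ 3.
Proof.
rewrite -poly_affine -(posfunB pPhi)//; apply: posfun_normr_le; first exact: bmB.
move=> x; have := expR_taylor2 (le_trans (shM x) sM); rewrite exprMn [2^-1 * _]mulrA.
move=> /le_trans; apply; rewrite ler_pM2l// lerXn2r ?nnegrE//.
exact: le_trans (shM x).
Qed.

Lemma posfun_expR_le3 : Phi (fun x => expR (s * h x)) <=
  expR (s * Phi h + 2^-1 * s ^+ 2 * Phi (fun x => h x ^+ 2) + 2 * (s * M) ^+ 3).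
Proof.
have := posfun_expR_taylor; rewrite ler_norml => /andP[_ h2].
by apply: le_trans (expR_ge1Dx _); lra.
Qed.

(** Turning 1 + x back into an exponential costs 2 x^2. This is of order s^4 when [Phi h] is of
    order s, hence negligible against the second-order term. *)
Lemma posfun_expR_ge3
  (x := s * Phi h + 2^-1 * s ^+ 2 * Phi (fun x => h x ^+ 2) - 2 * (s * M) ^+ 3) :
  - 2^-1 <= x -> expR (x - 2 * x ^+ 2) <= Phi (fun x => expR (s * h x)).
Proof.
move=> hx; apply: le_trans (expR_le_1D hx) _.
by have := posfun_expR_taylor; rewrite ler_norml => /andP[h2 _]; rewrite /x; lra.
Qed.

End PosFunExp.

(** * Concentration *)

Section ParticleSequence.
Context (R : realType) (d : nat) (mu : {measure set (d.-tuple R) -> \bar R}).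
Local Notation X := (d.-tuple R).
Variables (a0 : X -> R) (a : nat -> X -> X -> R) (g : nat -> X -> R) (T : nat).
Hypothesis model : hmm mu a0 a g T.
Context (dO : nat -> measure_display) (Om : forall N : nat, measurableType (dO N))
  (P : forall N : nat, probability (Om N) R) (xs : forall N : nat, nat -> nat -> Om N -> X).
Hypothesis law : forall N, particle_law mu a0 a g (P N) T N (@xs N).

Let m := mt mu a0 a g.
Let L := Lop mu a g.
Let kap := kappa mu a0 a g.
Local Notation E N := (Ex (P N)).
Local Notation em N := (emp N (@xs N)).
Local Notation tr N := (trans mu a g N (@xs N)).

Definition expsmall (F : forall N, Om N -> R) :=
  (forall N, (0 < N)%N -> bm (F N)) /\
  exists C c, [/\ 0 <= C, 0 < c &
    forall N, (0 < N)%N -> Ex (P N) (F N) <= C * expR (- (c * N%:R))].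

Lemma expsmallD F G : expsmall F -> expsmall G -> expsmall (fun N w => F N w + G N w).
Proof.
move=> [bF [C1 [c1 [C10 c10 h1]]]] [bG [C2 [c2 [C20 c20 h2]]]]; split.
  by move=> N N0; apply: bmD; [exact: bF|exact: bG].
exists (C1 + C2), (Num.min c1 c2); split; [exact: addr_ge0|by rewrite lt_min c10|].
move=> N N0; rewrite ExD ?mulrDl; [|exact: bF|exact: bG].
apply: lerD.
  apply: le_trans (h1 N N0) _; rewrite ler_wpM2l// ler_expR lerN2.
  by rewrite ler_wpM2r// ge_min lexx.
apply: le_trans (h2 N N0) _; rewrite ler_wpM2l// ler_expR lerN2.
by rewrite ler_wpM2r// ge_min lexx orbT.
Qed.

Lemma expsmall_le F G : (forall N, (0 < N)%N -> bm (F N)) ->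
  (forall N, (0 < N)%N -> forall w, F N w <= G N w) -> expsmall G -> expsmall F.
Proof.
move=> bF FG [bG [C [c [C0 c0 h]]]]; split=> //; exists C, c; split=> // N N0.
by apply: le_trans (h N N0); apply: Ex_le; [exact: bF|exact: bG|exact: FG].
Qed.

Lemma chernoff (N : nat) (s eta e : R) : 0 < s ->
  (eta <= e)%R%:R <= expR (N%:R * (s * e)) * expR (- (N%:R * (s * eta))).
Proof.
move=> s0; rewrite -expRD; case: (leP eta e) => h; last exact: expR_ge0.
rewrite mulr1n -[leLHS]expR0 ler_expR -mulrBr -mulrBr mulr_ge0//.
by apply: mulr_ge0; [exact: ltW|rewrite subr_ge0].
Qed.

(** The Chernoff parameter: small enough for [posfun_expR_le] to apply and for its quadratic term to
    cost at most a quarter of the linear gain [s * eta]. *)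
Lemma exists_small_rate (eta M : R) : 0 < eta -> 0 < M ->
  exists s, [/\ 0 < s, s * M <= 2^-1 & 2 * s ^+ 2 * M ^+ 2 <= s * eta / 4].
Proof.
move=> e0 M0; exists (Num.min (2^-1 / M) (eta / (8 * M ^+ 2))).
have s1 : Num.min (2^-1 / M) (eta / (8 * M ^+ 2)) <= 2^-1 / M by rewrite ge_min lexx.
have s2 : Num.min (2^-1 / M) (eta / (8 * M ^+ 2)) <= eta / (8 * M ^+ 2).
  by rewrite ge_min lexx orbT.
have : 0 < Num.min (2^-1 / M) (eta / (8 * M ^+ 2)).
  by rewrite lt_min !divr_gt0// mulr_gt0// exprn_gt0.
move: (Num.min _ _) s1 s2 => s; rewrite ler_pdivlMr// => s1.
rewrite ler_pdivlMr ?mulr_gt0 ?exprn_gt0// => s2 s0; split => //.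
have : s * (s * (8 * M ^+ 2)) <= s * eta by rewrite ler_wpM2l// ltW.
by rewrite expr2; lra.
Qed.

(** If the empirical mean at time t+1 is at least eta, then either the empirical denominator is at
    most kappa / 2, or the numerator is at least eta * kappa / 4, or the conditional mean is at most
    eta / 2 and the sample deviates from it. The first two concern centred functions of generation t
    and fall to the induction hypothesis, the third to a conditional Chernoff bound. *)
Lemma concentration t (h : X -> R) (eta : R) : (t <= T)%N -> bm h -> m t h = 0 -> 0 < eta ->
  expsmall (fun N w => (eta <= em N t h w)%R%:R).
Proof.
elim: t h eta => [|t IH] h eta tT bh mh eta0.
  have [M M0 hM] := bm_bounded bh; have [s [s0 sM s2]] := exists_small_rate eta0 M0.
  have bi N : (0 < N)%N -> bm (fun w => (eta <= em N 0 h w)%R%:R : R).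
    by move=> N0; apply: bm_ge; exact: (bm_emp (law N)).
  split=> //; exists 1, (s * eta / 4); split => //.
    by rewrite !mulr_gt0.
  move=> N N0; rewrite mul1r.
  have be : bm (fun w => expR (N%:R * (s * em N 0 h w))).
    by apply: bm_expR; do 2 apply: bmZ; exact: (bm_emp (law N)).
  apply: le_trans (_ : expR (- (N%:R * (s * eta))) * E N (fun w => expR (N%:R * (s * em N 0 h w))) <= _).
    rewrite -ExZ//; apply: Ex_le; [exact: bi|exact: bmZ|] => w.
    by rewrite mulrC; exact: chernoff.
  have -> : E N (fun w => expR (N%:R * (s * em N 0 h w))) =
      Ex (P N) (fun w => \prod_(i < N) expR (s * h (xs i 0 w))).
    by congr Ex; apply/funext => w; rewrite (prod_emp (@xs N) N0).
  rewrite (init_law model (law N) (h := fun x => expR (s * h x))); last 2 first.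
  - by apply: bm_expR; exact: bmZ.
  - by move=> x; exact: expR_ge0.
  have := posfun_expR_le (posfun_mt model tT) (mt_one model tT) bh hM (ltW s0) sM.
  rewrite -/m mh mulr0 add0r => hm.
  have hm0 : 0 <= m 0 (fun x => expR (s * h x)).
    apply: (posfun_ge0 (posfun_mt model tT)) => [|x]; last exact: expR_ge0.
    by apply: bm_expR; exact: bmZ.
  have hm' : m 0 (fun x => expR (s * h x)) ^+ N <= expR (s * eta / 4) ^+ N.
    by rewrite lerXn2r ?nnegrE ?expR_ge0//; apply: le_trans hm _; rewrite ler_expR.
  apply: le_trans (ler_wpM2l (expR_ge0 _) hm') _.
  rewrite -expRM_natl -mulr_natl -expRD ler_expR.
  have : 0 <= N%:R * (s * eta) by apply: mulr_ge0 => //; apply: mulr_ge0; exact: ltW.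
  lra.
have tT' := ltnW tT.
have tT1 : (1 <= t.+1 <= T)%N by [].
have k0 : 0 < kap t.+1 := kappa_gt0 model tT.
have b1 : bm (fun x => kap t.+1 - L t.+1 (fun=> 1) x).
  by apply: bmB; [exact: bm_cst|exact: (bm_Lop model tT1 (bm_cst _ 1))].
have b2 : bm (L t.+1 h) by exact: (bm_Lop model tT1 bh).
have m1 : m t (fun x => kap t.+1 - L t.+1 (fun=> 1) x) = 0.
  rewrite /m (posfunB (posfun_mt model tT')); [|exact: bm_cst|exact: (bm_Lop model tT1 (bm_cst _ 1))].
  rewrite (mt_cst model _ tT') (mt_Lop model tT (bm_cst _ 1)) (mt_one model tT) mulr1.
  by rewrite subrr.
have m2 : m t (L t.+1 h) = 0.
  by rewrite /m (mt_Lop model tT bh) -/m mh mulr0.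
have eta1 : 0 < kap t.+1 / 2 by rewrite divr_gt0.
have eta2 : 0 < eta * kap t.+1 / 4 by rewrite divr_gt0// mulr_gt0.
have S1 := IH _ _ tT' b1 m1 eta1; have S2 := IH _ _ tT' b2 m2 eta2.
have [M M0 hM] := bm_bounded bh; have [s [s0 sM s2]] := exists_small_rate eta0 M0.
(* The indicator restricts to small conditional means and the exponential is the Chernoff factor;
   both depend on the past only, so generation t+1 can be integrated out against [H]. *)
pose H N w : R := (tr N t w h <= eta / 2)%R%:R * expR (- (N%:R * (s * eta))).
have pH N : (0 < N)%N -> @bm _ (past N (@xs N) t.+1) R (H N).
  move=> N0; apply: bmM; last exact: bm_cst.
  by apply: (@bm_le _ (past N (@xs N) t.+1)); [exact: (bm_trans model)|exact: bm_cst].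
have bH N : (0 < N)%N -> bm (H N) by move=> N0; exact: (bm_past (law N) _ (pH N N0)).
have H0 N w : 0 <= H N w by rewrite mulr_ge0 ?expR_ge0.
have be N : (0 < N)%N -> bm (fun w => expR (N%:R * (s * em N t.+1 h w))).
  by move=> N0; apply: bm_expR; do 2 apply: bmZ; exact: (bm_emp (law N)).
have S3 : expsmall (fun N w => H N w * expR (N%:R * (s * em N t.+1 h w))).
  split; first by move=> N N0; apply: bmM; [exact: bH|exact: be].
  exists 1, (s * eta / 4); split => //; first by rewrite !mulr_gt0.
  move=> N N0; rewrite mul1r.
  have -> : Ex (P N) (fun w => H N w * expR (N%:R * (s * em N t.+1 h w))) =
      Ex (P N) (fun w => H N w * \prod_(i < N) expR (s * h (xs i t.+1 w))).
    by congr Ex; apply/funext => w; rewrite (prod_emp (@xs N) N0).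
  have bx : bm (fun x => expR (s * h x)) by apply: bm_expR; exact: bmZ.
  rewrite (step_law model N0 (law N) (h := fun x => expR (s * h x)) tT (pH N N0))//.
  rewrite -[leRHS](Ex_cst (P N)); apply: Ex_le; [|exact: bm_cst|].
    apply: bmM; first exact: bH.
    apply: bmX; apply: (bm_past (law N) (leqW tT)); exact: (bm_trans model).
  move=> w; have pt := posfun_trans model (@xs N) N0 w tT.
  have t1 := trans_one model (@xs N) N0 w tT.
  have := posfun_expR_le pt t1 bh hM (ltW s0) sM.
  rewrite /H; case: (leP (tr N t w h) (eta / 2)) => h1; last by rewrite !mul0r expR_ge0.
  rewrite mul1r => h2.
  have t0 : 0 <= tr N t w (fun x => expR (s * h x)).
    by apply: (posfun_ge0 pt) => // x; exact: expR_ge0.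
  (* The conditional mean contributes [s * eta / 2] and the quadratic term [s * eta / 4], so the
     factor with [- (s * eta)] leaves the rate [s * eta / 4]. *)
  have h3 : tr N t w (fun x => expR (s * h x)) ^+ N <= expR (3 * s * eta / 4) ^+ N.
    rewrite lerXn2r ?nnegrE ?expR_ge0//; apply: le_trans h2 _; rewrite ler_expR.
    have : s * tr N t w h <= s * (eta / 2) by rewrite ler_wpM2l// ltW.
    lra.
  apply: le_trans (ler_wpM2l (expR_ge0 _) h3) _.
  rewrite -expRM_natl -mulr_natl -expRD ler_expR.
  lra.
apply: expsmall_le (expsmallD (expsmallD S1 S2) S3).
  by move=> N N0; apply: bm_ge; exact: (bm_emp (law N)).
move=> N N0 w; have pe := posfun_emp (@xs N) N0 t w.
have D0 := emp_Lop_one_gt0 model (@xs N) N0 w tT.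
have E1 : em N t (fun x => kap t.+1 - L t.+1 (fun=> 1) x) w =
    kap t.+1 - em N t (L t.+1 (fun=> 1)) w.
  rewrite [LHS](posfunB pe); [|exact: bm_cst|exact: (bm_Lop model tT1 (bm_cst _ 1))].
  by rewrite (posfun_cst pe) emp_one// mulr1.
have c1 : 0 <= (kap t.+1 / 2 <= em N t (fun x => kap t.+1 - L t.+1 (fun=> 1) x) w)%R%:R :> R by [].
have c2 : 0 <= (eta * kap t.+1 / 4 <= em N t (L t.+1 h) w)%R%:R :> R by [].
have c3 : 0 <= H N w * expR (N%:R * (s * em N t.+1 h w)).
  by rewrite mulr_ge0 ?expR_ge0.
case: (leP eta (em N t.+1 h w)) => he /=; last first.
  by rewrite !addr_ge0.
case: (leP (kap t.+1 / 2) (em N t (fun x => kap t.+1 - L t.+1 (fun=> 1) x) w)) => hb1 /=.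
  by move: c2 c3 => /=; lra.
case: (leP (eta * kap t.+1 / 4) (em N t (L t.+1 h) w)) => hb2 /=.
  by move: c3 => /=; lra.
rewrite !add0r /H.
have -> : (tr N t w h <= eta / 2)%R.
  rewrite /trans ler_pdivrMr//; apply: le_trans (ltW hb2) _.
  move: hb1; rewrite E1 /L /= => hb1.
  have : eta / 2 * (kap t.+1 / 2) <= eta / 2 * emp N (@xs N) t (Lop mu a g t.+1 (fun=> 1)) w.
    by rewrite ler_wpM2l ?divr_ge0 ?(ltW eta0)//; lra.
  lra.
rewrite mul1r -expRD -[leLHS]expR0 ler_expR.
have : N%:R * (s * eta) <= N%:R * (s * em N t.+1 h w).
  by rewrite ler_wpM2l// ler_wpM2l// ltW.
lra.
Qed.

End ParticleSequence.

(** * Deterministic estimates for integrating out one generation *)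

Section CoreBounds.
Context (R : realType).

(** The error e^2 * del is split into quarters: replacing [Y / D] by [Y / k], replacing [q / 2] by
    [s2 / 2], the cubic remainder, and the 2 x^2 of the lower bound. Since |Y / D| <= e G, the
    linear term is of second order, and [H] bounds |x| / e^2. *)
Lemma core_exponent (e Y D k q s2 M del G : R) :
  0 < e -> e <= 1 -> `|Y / D - Y / k| <= e * (del / 4) -> `|q - s2| <= del / 2 ->
  0 <= M -> 2 * (e * M ^+ 3) <= del / 4 -> `|Y / D| <= e * G -> 0 <= q <= M ^+ 2 ->
  let H := G + M ^+ 2 + 2 * M ^+ 3 in
  2 * (e * H ^+ 2) <= del / 4 -> e * H <= 2^-1 ->
  let x := e * (Y / D) + 2^-1 * e ^+ 2 * q - 2 * (e * M) ^+ 3 in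
  [/\ e * (Y / D) + 2^-1 * e ^+ 2 * q + 2 * (e * M) ^+ 3 <= e * (Y / k) + e ^+ 2 * (s2 / 2 + del),
      - 2^-1 <= x & e * (Y / k) + e ^+ 2 * (s2 / 2 - del) <= x - 2 * x ^+ 2].
Proof.
move=> e0 e1 hY hq M0 hM hG /andP[q0 qM] H hH1 hH2 x.
set p := Y / D in hY hG x *; set r := Y / k in hY *.
have [hY1 hY2] : - (e * (del / 4)) <= p - r /\ p - r <= e * (del / 4).
  by move: hY; rewrite ler_norml => /andP[].
have [hq1 hq2] : - (del / 2) <= q - s2 /\ q - s2 <= del / 2.
  by move: hq; rewrite ler_norml => /andP[].
have [hG1 hG2] : - (e * G) <= p /\ p <= e * G by move: hG; rewrite ler_norml => /andP[].
have e2 : 0 < e ^+ 2 by rewrite exprn_gt0.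
have eY1 : - (e ^+ 2 * (del / 4)) <= e * (p - r).
  by rewrite expr2 -mulrA -mulrN ler_pM2l.
have eY2 : e * (p - r) <= e ^+ 2 * (del / 4) by rewrite expr2 -mulrA ler_pM2l.
have eq1 : - (e ^+ 2 * (del / 2)) <= e ^+ 2 * (q - s2) by rewrite -mulrN ler_pM2l.
have eq2 : e ^+ 2 * (q - s2) <= e ^+ 2 * (del / 2) by rewrite ler_pM2l.
have eM : 2 * (e * M) ^+ 3 <= e ^+ 2 * (del / 4).
  have -> : 2 * (e * M) ^+ 3 = e ^+ 2 * (2 * (e * M ^+ 3)) by ring.
  by rewrite ler_pM2l.
have eM0 : 0 <= 2 * (e * M) ^+ 3.
  by rewrite mulr_ge0// exprn_ge0// mulr_ge0// ltW.
have ep1 : - (e ^+ 2 * G) <= e * p by rewrite expr2 -mulrA -mulrN ler_pM2l.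
have ep2 : e * p <= e ^+ 2 * G by rewrite expr2 -mulrA ler_pM2l.
have eq3 : 0 <= e ^+ 2 * q <= e ^+ 2 * M ^+ 2.
  by rewrite mulr_ge0 ?(ltW e2)//= ler_pM2l.
have eM2 : 2 * (e * M) ^+ 3 <= e ^+ 2 * (2 * M ^+ 3).
  have -> : 2 * (e * M) ^+ 3 = e ^+ 2 * (2 * (e * M ^+ 3)) by ring.
  by rewrite ler_pM2l// ler_pM2l// ler_piMl// exprn_ge0.
have M20 : 0 <= e ^+ 2 * M ^+ 2 by rewrite mulr_ge0 ?(ltW e2)// sqr_ge0.
have M30 : 0 <= e ^+ 2 * (2 * M ^+ 3) by apply: mulr_ge0; [exact: ltW|apply: mulr_ge0 => //; exact: exprn_ge0].
have hx : `|x| <= e ^+ 2 * H.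
  by rewrite ler_norml /x /H; case/andP: eq3 => eq3 eq4; apply/andP; split; lra.
have hxx : x ^+ 2 <= e ^+ 2 * (e * H ^+ 2).
  rewrite -[x ^+ 2]real_normK ?num_real//.
  have H0 : 0 <= e ^+ 2 * H by apply: le_trans hx.
  apply: le_trans (_ : (e ^+ 2 * H) ^+ 2 <= _).
    by rewrite lerXn2r ?nnegrE.
  have -> : (e ^+ 2 * H) ^+ 2 = e ^+ 2 * (e * (e * H ^+ 2)) by ring.
  rewrite ler_pM2l// ler_pM2l// ler_piMl//; exact: sqr_ge0.
have hxx2 : 2 * x ^+ 2 <= e ^+ 2 * (del / 4).
  apply: le_trans (_ : e ^+ 2 * (2 * (e * H ^+ 2)) <= _); last by rewrite ler_pM2l.
  by lra.
split.
- lra.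
- have : e ^+ 2 * H <= 2^-1.
    apply: le_trans hH2; rewrite expr2 -mulrA ler_piMl//.
    have : 0 <= e ^+ 2 * H by apply: le_trans hx.
    by rewrite pmulr_rge0// => H0; rewrite mulr_ge0// ltW.
  by move: hx; rewrite ler_norml => /andP[hx _] ?; lra.
- by rewrite /x in hxx2 *; lra.
Qed.
Lemma le_expRn (N : nat) (t u : R) : 0 <= t -> t <= expR u -> t ^+ N <= expR (N%:R * u).
Proof. by move=> t0 tu; rewrite expRM_natl lerXn2r ?nnegrE ?expR_ge0. Qed.

Lemma ge_expRn (N : nat) (t u : R) : expR u <= t -> expR (N%:R * u) <= t ^+ N.
Proof.
move=> tu; rewrite expRM_natl lerXn2r ?nnegrE ?expR_ge0//.
exact: le_trans (expR_ge0 _) tu.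
Qed.

(* [J] is the integrand after integrating out one generation and [Z] its second-order
   approximation; [r] controls both where [Y] is not of order [e], and, through [bad], where the
   empirical denominator [D] or the conditional second moment [q] is off. *)
Lemma sandwich (N : nat) (e S Y D k q q2 s2 t M MY BS A d1 d : R) :
  0 < e -> e <= 1 -> 0 < k -> 0 < D -> 0 <= A -> 0 <= M -> 0 <= MY ->
  `|S| <= BS -> `|Y| <= MY -> q - s2 = q2 / D -> 0 <= q <= M ^+ 2 -> 0 <= s2 <= M ^+ 2 ->
  d1 <= k / 2 -> 2 * A * d1 <= d / 4 * k ^+ 2 -> 2 * d1 <= d / 2 * k ->
  2 * (e * M ^+ 3) <= d / 4 ->
  let H := 2 * A / k + M ^+ 2 + 2 * M ^+ 3 in
  2 * (e * H ^+ 2) <= d / 4 -> e * H <= 2^-1 ->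
  0 <= t -> t <= expR (e * M) ->
  t <= expR (e * (Y / D) + 2^-1 * e ^+ 2 * q + 2 * (e * M) ^+ 3) ->
  let x := e * (Y / D) + 2^-1 * e ^+ 2 * q - 2 * (e * M) ^+ 3 in
  (- 2^-1 <= x -> expR (x - 2 * x ^+ 2) <= t) ->
  let J := expR (N%:R * (e * S)) * t ^+ N in
  let v := N%:R * e ^+ 2 in
  let Z := expR (v * (s2 / 2)) * expR (N%:R * (e * (S + k^-1 * Y))) in
  let c := 2 / k + 1 in
  let bad := (d1 <= D - k)%R%:R + (d1 <= k - D)%R%:R + (d1 <= q2)%R%:R + (d1 <= - q2)%R%:R in
  let r := expR (v * (M ^+ 2 + 2 * M ^+ 3 - A)) *
             (expR (N%:R * (e * (S + c * Y))) + expR (N%:R * (e * (S + (- c) * Y)))) +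
           expR (N%:R * (e * (BS + M + MY / k + s2))) * bad in
  J <= expR (v * d) * Z + r /\ Z <= expR (v * d) * J + r.
Proof.
move=> e0 e1 k0 D0 A0 M0 MY0 hS hY hq qM sM hd1 hd2 hd3 hM H hH1 hH2 t0 tM tu x tl J v Z c bad r.
have [hS1 hS2] : - BS <= S /\ S <= BS by move: hS; rewrite ler_norml => /andP[].
have n0 : (0 : R) <= N%:R by [].
have J0 : 0 <= J by rewrite mulr_ge0 ?expR_ge0// exprn_ge0.
have Z0 : 0 <= Z by rewrite mulr_ge0 ?expR_ge0.
set r1 := expR (v * (M ^+ 2 + 2 * M ^+ 3 - A)) * _ in r *.
have r10 : 0 <= r1 by rewrite mulr_ge0 ?expR_ge0// addr_ge0 ?expR_ge0.
set F := expR (N%:R * (e * (BS + M + MY / k + s2))) in r *.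
have F0 : 0 <= F by exact: expR_ge0.
have bad0 : 0 <= bad by rewrite !addr_ge0.
have Yk : k^-1 * Y <= MY / k.
  rewrite mulrC ler_wpM2r ?invr_ge0 ?(ltW k0)//; exact: le_trans (ler_norm _) hY.
have YD : k^-1 * Y = Y / k by rewrite mulrC.
have e20 : 0 <= e ^+ 2 by exact: sqr_ge0.
have [s20 s2M] := andP sM.
have MYk : 0 <= MY / k by rewrite divr_ge0// ltW.
have e2e : e ^+ 2 <= e by rewrite expr2 ler_piMr// ltW.
(* On the bad event [J] and [Z] are compared with nothing but the crude bound [F], which is then a
   lower bound of [r]. *)
have isbad : 1 <= bad -> J <= expR (v * d) * Z + r /\ Z <= expR (v * d) * J + r.
  move=> bad1; have Fr : F <= r.
    have : F * 1 <= F * bad by rewrite ler_wpM2l.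
    by rewrite /r; lra.
  split.
    apply: (@le_trans _ _ F); last first.
      by apply: le_trans Fr _; rewrite lerDr mulr_ge0 ?expR_ge0.
    apply: (@le_trans _ _ (expR (N%:R * (e * S)) * expR (N%:R * (e * M)))).
      by rewrite ler_wpM2l ?expR_ge0//; exact: le_expRn.
    rewrite -expRD ler_expR -!mulrDr ler_wpM2l// ler_pM2l//; lra.
  apply: (@le_trans _ _ F); last first.
    by apply: le_trans Fr _; rewrite lerDr mulr_ge0 ?expR_ge0.
  rewrite /Z -expRD ler_expR /v -mulrA -mulrDr ler_wpM2l//.
  have : e ^+ 2 * (s2 / 2) <= e * (s2 / 2) by rewrite ler_wpM2r// divr_ge0.
  have : e * (S + k^-1 * Y + s2) <= e * (BS + M + MY / k + s2).
    by rewrite ler_pM2l//; lra.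
  have : 0 <= e * s2 by rewrite mulr_ge0// ltW.
  lra.
move: isbad; rewrite /bad; case: (leP d1 (D - k)) => b1 isbad.
  by apply: isbad; rewrite mulr1n -!addrA lerDl !addr_ge0.
move: isbad; case: (leP d1 (k - D)) => b2 isbad.
  by apply: isbad; rewrite mulr1n mulr0n add0r -!addrA lerDl !addr_ge0.
move: isbad; case: (leP d1 q2) => b3 isbad.
  by apply: isbad; rewrite mulr1n !mulr0n !add0r lerDl.
move: isbad; case: (leP d1 (- q2)) => b4 isbad.
  by apply: isbad; rewrite mulr1n !mulr0n !add0r.
move=> {isbad}.
have rr1 : r1 <= r by rewrite /r lerDl mulr_ge0.
have D2 : k / 2 <= D by lra.
have kD : D^-1 <= 2 / k.
  by rewrite -[leRHS]invrK lef_pV2 ?posrE ?invr_gt0 ?divr_gt0// invf_div.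
have iD0 : 0 <= D^-1 by rewrite invr_ge0 ltW.
have ik0 : 0 <= k^-1 by rewrite invr_ge0 ltW.
have q2D : `|q2| <= d1 by rewrite ler_norml; apply/andP; split; lra.
have d10 : 0 <= d1 by exact: le_trans q2D.
have absYD : `|Y / D| <= `|Y| * (2 / k).
  by rewrite normrM ler_wpM2l// ger0_norm.
have vE a : v * a = N%:R * (e ^+ 2 * a) by rewrite /v mulrA.
(* Off the bad event D >= k / 2. If moreover |Y| <= A e, then |Y / D| <= e (2 A / k), so
   [core_exponent] applies with G = 2 A / k. *)
case: (leP `|Y| (A * e)) => hYA.
  have c1 : `|Y / D - Y / k| <= e * (d / 4).
    have -> : Y / D - Y / k = Y * (k - D) * (D^-1 * k^-1).
      by rewrite -invfM; field; rewrite !gt_eqF.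
    rewrite !normrM (ger0_norm iD0) (ger0_norm ik0).
    have a1 : `|k - D| <= d1 by rewrite ler_norml; apply/andP; split; lra.
    apply: (@le_trans _ _ (A * e * d1 * (2 / k * k^-1))).
      apply: ler_pM; rewrite ?mulr_ge0//; first exact: ler_pM.
      by rewrite ler_wpM2r.
    have -> : A * e * d1 * (2 / k * k^-1) = e * (2 * A * d1 * k^-1 ^+ 2) by ring.
    rewrite ler_pM2l// exprVn ler_pdivrMr// exprn_gt0//.
  have c2 : `|q - s2| <= d / 2.
    rewrite hq normrM (ger0_norm iD0); apply: (@le_trans _ _ (d1 * (2 / k))).
      exact: ler_pM.
    by rewrite mulrA ler_pdivrMr// mulrC.
  have c3 : `|Y / D| <= e * (2 * A / k).
    apply: le_trans absYD _; apply: (@le_trans _ _ (A * e * (2 / k))).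
      by rewrite ler_wpM2r// divr_ge0// ltW.
    rewrite le_eqVlt; apply/orP; left; apply/eqP; ring.
  have [u1 u2 u3] := core_exponent e0 e1 c1 c2 M0 hM c3 qM hH1 hH2.
  have {}tl := tl u2.
  split.
    apply: (@le_trans _ _ (expR (v * d) * Z)); last first.
      by rewrite lerDl; apply: le_trans rr1.
    apply: (@le_trans _ _ (expR (N%:R * (e * S)) * expR (N%:R * (e * (Y / k) + e ^+ 2 * (s2 / 2 + d))))).
      rewrite ler_wpM2l ?expR_ge0//; apply: le_expRn => //.
      by apply: le_trans tu _; rewrite ler_expR.
    rewrite /Z -!expRD ler_expR !vE YD; lra.
  apply: (@le_trans _ _ (expR (v * d) * J)); last first.
    by rewrite lerDl; apply: le_trans rr1.
  apply: (@le_trans _ _ (expR (v * d) * (expR (N%:R * (e * S)) *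
      expR (N%:R * (e * (Y / k) + e ^+ 2 * (s2 / 2 - d)))))).
    rewrite /Z -!expRD ler_expR !vE YD; lra.
  rewrite ler_wpM2l ?expR_ge0// ler_wpM2l ?expR_ge0//; apply: ge_expRn.
  by apply: le_trans tl; rewrite ler_expR.
have M30 : 0 <= M ^+ 3 by exact: exprn_ge0.
(* Now A e < |Y|, so raising the coefficient of |Y| from 2 / k to [c] gains at least e * (A e),
   which pays for the factor exp(-v A). The two terms with [c] and [- c] stand for the absolute
   value. *)
have big E : E <= expR (N%:R * (e * (S + 2 / k * `|Y|)) + v * (M ^+ 2 + 2 * M ^+ 3)) -> E <= r.
  move=> /le_trans; apply; apply: le_trans rr1.
  apply: (@le_trans _ _ (expR (v * (M ^+ 2 + 2 * M ^+ 3 - A)) * expR (N%:R * (e * (S + c * `|Y|))))).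
    rewrite -expRD ler_expR !vE -!mulrDr ler_wpM2l//.
    have : e * (A * e) <= e * `|Y| by rewrite ler_pM2l// ltW.
    rewrite /c expr2; lra.
  rewrite ler_wpM2l ?expR_ge0//; case: (ger0P Y) => Y0.
    by rewrite lerDl expR_ge0.
  by rewrite mulrN -mulNr lerDr expR_ge0.
have vd0 E : 0 <= E -> r <= expR (v * d) * E + r.
  by move=> E0; rewrite lerDr mulr_ge0 ?expR_ge0.
have [q0 qM2] := andP qM.
have e2M : e ^+ 2 * q <= e ^+ 2 * M ^+ 2 by rewrite ler_wpM2l.
have e2s : e ^+ 2 * s2 <= e ^+ 2 * M ^+ 2 by rewrite ler_wpM2l.
have e2s0 : 0 <= e ^+ 2 * s2 by rewrite mulr_ge0.
have e2q0 : 0 <= e ^+ 2 * q by rewrite mulr_ge0.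
have e3 : 2 * (e * M) ^+ 3 <= e ^+ 2 * (2 * M ^+ 3).
  have -> : 2 * (e * M) ^+ 3 = e ^+ 2 * (2 * (e * M ^+ 3)) by ring.
  by rewrite ler_wpM2l// ler_pM2l// ler_piMl.
have e30 : 0 <= e ^+ 2 * (2 * M ^+ 3) by apply: mulr_ge0 => //; apply: mulr_ge0.
split; apply: le_trans (vd0 _ _) => //; apply: big.
  apply: (@le_trans _ _ (expR (N%:R * (e * S)) *
    expR (N%:R * (e * (Y / D) + 2^-1 * e ^+ 2 * q + 2 * (e * M) ^+ 3)))).
    by rewrite ler_wpM2l ?expR_ge0//; exact: le_expRn.
  rewrite -expRD ler_expR !vE -!mulrDr ler_wpM2l//.
  have : e * (Y / D) <= e * (2 / k * `|Y|).
    rewrite ler_pM2l//; apply: le_trans (ler_norm _) _.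
    by rewrite [leRHS]mulrC.
  lra.
rewrite /Z -expRD ler_expR !vE -!mulrDr ler_wpM2l//.
have : e * (k^-1 * Y) <= e * (2 / k * `|Y|).
  rewrite ler_pM2l//; apply: (@le_trans _ _ (k^-1 * `|Y|)).
    by rewrite ler_wpM2l// ler_norm.
  rewrite ler_wpM2r//; lra.
lra.
Qed.

Lemma exists_threshold (A k de : R) : 0 <= A -> 0 < k -> 0 < de ->
  exists d1, [/\ 0 < d1, d1 <= k / 2, 2 * A * d1 <= de / 4 * k ^+ 2 & 2 * d1 <= de / 2 * k].
Proof.
move=> A0 k0 de0.
have k20 : 0 < k ^+ 2 by rewrite exprn_gt0.
have A10 : 0 < 2 * A + 1 by rewrite ltr_wpDl// mulr_ge0.
pose x1 := k / 2; pose x2 := de / 4 * k ^+ 2 / (2 * A + 1); pose x3 := de / 4 * k.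
have x10 : 0 < x1 by rewrite divr_gt0.
have x20 : 0 < x2 by rewrite divr_gt0// mulr_gt0// divr_gt0.
have x30 : 0 < x3 by rewrite mulr_gt0// divr_gt0.
exists (Num.min x1 (Num.min x2 x3)).
have y1 : Num.min x1 (Num.min x2 x3) <= x1 by rewrite ge_min lexx.
have y2 : Num.min x1 (Num.min x2 x3) <= x2 by rewrite !ge_min lexx orbT.
have y3 : Num.min x1 (Num.min x2 x3) <= x3 by rewrite !ge_min lexx !orbT.
have y0 : 0 < Num.min x1 (Num.min x2 x3) by rewrite !lt_min x10 x20.
move: (Num.min _ _) y0 y1 y2 y3 => y y0 y1; rewrite /x2 ler_pdivlMr// => y2.
by rewrite /x3 => y3; split => //; lra.
Qed.

(** [Qp] and [Qm] will be the limits for the coefficients c and -c with c = 2 / k + 1. As c does not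
    involve the cutoff, there is no circularity in taking [A] large with respect to these limits. *)
Lemma exists_cutoff (Qp Qm q0 c1 : R) : 0 <= c1 ->
  exists A, [/\ 0 <= A, c1 - A + (Qp + 1) <= q0 - 1 & c1 - A + (Qm + 1) <= q0 - 1].
Proof.
move=> c10; exists (`|Qp| + `|Qm| + `|q0| + c1 + 2).
have := ler_norm Qp; have := ler_norm Qm; have := ler_norm (- q0); rewrite normrN.
have := normr_ge0 Qp; have := normr_ge0 Qm; have := normr_ge0 q0.
by move=> *; split; lra.
Qed.

(** Of the three units of [de], one is the precision of [EZ], one the factor exp(v de) of the
    comparison, and one absorbs numerical constants, which are at most 4 <= 1 + v de. The remainder
    lies lower by almost a full unit in the exponent. *)
Lemma combine_bounds (v q0 de EJ EZ Er : R) :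
  10 <= v -> 0 < de -> de <= 6^-1 -> 3 <= v * de ->
  expR (v * (q0 - de)) <= EZ <= expR (v * (q0 + de)) -> Er <= 3 * expR (v * (q0 - 1)) ->
  EJ <= expR (v * de) * EZ + Er -> EZ <= expR (v * de) * EJ + Er ->
  expR (v * (q0 - 3 * de)) <= EJ <= expR (v * (q0 + 3 * de)).
Proof.
move=> v10 de0 de6 vde /andP[k1 k1'] Er3 EJ1 EJ2; have v0 : 0 <= v by apply: le_trans v10.
apply/andP; split.
  have k2 : 6 * expR (v * (q0 - 1)) <= expR (v * (q0 - de)).
    have -> : expR (v * (q0 - de)) = expR (v * (1 - de)) * expR (v * (q0 - 1)).
      by rewrite -expRD; congr expR; ring.
    rewrite ler_wpM2r ?expR_ge0//; apply: le_trans (expR_ge1Dx _).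
    have : v * (5 / 6) <= v * (1 - de) by rewrite ler_wpM2l//; lra.
    lra.
  have k3 : expR (v * (q0 - de)) <= 2 * (expR (v * de) * EJ) by lra.
  have k4 : 2 <= expR (v * de) by apply: le_trans (expR_ge1Dx _); lra.
  rewrite -(@ler_pM2l _ (2 * expR (v * de))); last by rewrite mulr_gt0// expR_gt0.
  rewrite -[leRHS]mulrA; apply: le_trans k3.
  have -> : expR (v * (q0 - de)) = expR (v * de) * (expR (v * de) * expR (v * (q0 - 3 * de))).
    by rewrite -!expRD; congr expR; ring.
  by rewrite -mulrA ler_wpM2r// mulr_ge0// expR_ge0.
have k2 : expR (v * de) * EZ <= expR (v * (q0 + 2 * de)).
  apply: le_trans (ler_wpM2l (expR_ge0 _) k1') _.
  by rewrite -expRD ler_expR; lra.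
have k3 : expR (v * (q0 - 1)) <= expR (v * (q0 + 2 * de)).
  by rewrite ler_expR ler_wpM2l//; lra.
have k4 : 4 <= expR (v * de) by apply: le_trans (expR_ge1Dx _); lra.
have -> : expR (v * (q0 + 3 * de)) = expR (v * de) * expR (v * (q0 + 2 * de)).
  by rewrite -expRD; congr expR; ring.
apply: (@le_trans _ _ (4 * expR (v * (q0 + 2 * de)))); first lra.
by rewrite ler_wpM2r ?expR_ge0.
Qed.

End CoreBounds.

(** * Limit of the moment generating function *)

Section ParticleSequence.
Context (R : realType) (d : nat) (mu : {measure set (d.-tuple R) -> \bar R}).
Local Notation X := (d.-tuple R).
Variables (a0 : X -> R) (a : nat -> X -> X -> R) (g : nat -> X -> R) (T : nat).
Hypothesis model : hmm mu a0 a g T.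
Context (dO : nat -> measure_display) (Om : forall N : nat, measurableType (dO N))
  (P : forall N : nat, probability (Om N) R) (xs : forall N : nat, nat -> nat -> Om N -> X).
Hypothesis law : forall N, particle_law mu a0 a g (P N) T N (@xs N).

Let m := mt mu a0 a g.
Let L := Lop mu a g.
Let kap := kappa mu a0 a g.
Local Notation E N := (Ex (P N)).
Local Notation em N := (emp N (@xs N)).
Local Notation tr N := (trans mu a g N (@xs N)).

Variable eps : nat -> R.
Local Notation v N := (N%:R * eps N ^+ 2).
Hypothesis eps_gt0 : forall N, (0 < N)%N -> 0 < eps N.
Hypothesis eps_small : forall del, 0 < del -> \forall N \near \oo, eps N <= del.
Hypothesis v_large : forall K, \forall N \near \oo, K <= v N.

Lemma eps_smallM c del : 0 <= c -> 0 < del -> \forall N \near \oo, eps N * c <= del.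
Proof.
move=> c0 d0; have c1 : 0 < c + 1 by lra.
near=> N; have N0 : (0 < N)%N by near: N; exists 1%N.
have : eps N <= del / (c + 1) by near: N; apply: eps_small; rewrite divr_gt0.
rewrite ler_pdivlMr// => h; apply: le_trans h; rewrite ler_pM2l ?eps_gt0//; lra.
Unshelve. all: by end_near. Qed.

Lemma expsmall_near (F : forall N, Om N -> R) B K : expsmall P F -> 0 <= B ->
  \forall N \near \oo, expR (N%:R * (eps N * B)) * E N (F N) <= expR (v N * K).
Proof.
move=> [bF [C [c [C0 c0 h]]]] B0.
have K0 : 0 <= `|K| + 1 by rewrite addr_ge0.
near=> N; have N0 : (0 < N)%N by near: N; exists 1%N.
have e0 := eps_gt0 N0.
have e1 : eps N <= 1 by near: N; apply: eps_small.
have e2 : eps N * (B + (`|K| + 1)) <= c by near: N; apply: eps_smallM => //; rewrite addr_ge0.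
have vC : C <= v N by near: N; exact: v_large.
have CE : C <= expR (v N) by apply: le_trans (expR_ge1Dx _); lra.
apply: le_trans (ler_wpM2l (expR_ge0 _) (h N N0)) _.
apply: le_trans (_ : expR (N%:R * (eps N * B)) * (expR (v N) * expR (- (c * N%:R))) <= _).
  by rewrite ler_pM2l ?expR_gt0// ler_pM2r ?expR_gt0.
rewrite -!expRD ler_expR.
have : eps N ^+ 2 * (`|K| + 1) <= eps N * (`|K| + 1).
  by rewrite ler_wpM2r// expr2 ler_piMr// ltW.
have := ler_norm (- K); rewrite normrN => hK hh.
have e20 : 0 <= eps N ^+ 2 by exact: sqr_ge0.
have hK2 : eps N ^+ 2 * (- K) <= eps N ^+ 2 * `|K| by rewrite ler_wpM2l.
have : N%:R * (eps N * B + eps N ^+ 2 - c - eps N ^+ 2 * K) <= 0.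
  by apply: mulr_ge0_le0 => //; lra.
lra.
Unshelve. all: by end_near. Qed.

Definition cem N s (h : X -> R) (w : Om N) : R := em N s h w - m s h.
Definition SN N t (phi : nat -> X -> R) (w : Om N) : R := \sum_(s < t.+1) cem s (phi s) w.
(** With eps = b_N / sqrt N and phi_s = lambda_s psi_s, the exponent at [t = T] is b_N^2 times the
    scalar product of the fluctuation vector with lambda. *)
Definition WN N t phi (w : Om N) : R := expR (N%:R * (eps N * SN t phi w)).

Definition centered t (h : X -> R) (x : X) : R := h x - m t h.

(* The test functions that remain after integrating out generation t+1, up to the choice of c. *)
Definition fold_last t (c : R) (phi : nat -> X -> R) (s : nat) : X -> R :=
  if s == t then (fun x => phi t x + c * L t.+1 (centered t.+1 (phi t.+1)) x) else phi s.

(** Half of the limiting quadratic form, in the order in which generations are integrated out.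
    [Qlim_Vlow] matches it with the recursion of the covariances. *)
Fixpoint Qlim (t : nat) (phi : nat -> X -> R) : R :=
  match t with
  | 0 => sigma2 mu a0 a g 0 (phi 0) / 2
  | t'.+1 => sigma2 mu a0 a g t'.+1 (phi t'.+1) / 2 +
             Qlim t' (fold_last t' (kap t'.+1)^-1 phi)
  end.

Lemma bm_centered t h : bm h -> bm (centered t h).
Proof. by move=> bh; apply: bmB => //; exact: bm_cst. Qed.

Lemma mt_centered t h : (t <= T)%N -> bm h -> m t (centered t h) = 0.
Proof.
move=> tT bh; rewrite /m (posfunB (posfun_mt model tT))//; last exact: bm_cst.
by rewrite (mt_cst model)// subrr.
Qed.

Lemma bm_fold_last t c phi : (t.+1 <= T)%N -> (forall s, bm (phi s)) ->
  forall s, bm (fold_last t c phi s).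
Proof.
move=> tT bphi s; rewrite /fold_last; case: eqP => // _.
apply: bmD => //; apply: bmZ; apply: (bm_Lop model) => //; exact: bm_centered.
Qed.

Lemma em_centered N t h w : (0 < N)%N -> bm h -> em N t (centered t h) w = cem t h w.
Proof.
move=> N0 bh; have pe := posfun_emp (@xs N) N0 t w.
have := posfunB pe bh (bm_cst _ (m t h)); rewrite /= (posfun_cst pe) emp_one// mulr1.
exact.
Qed.

(** The added function has mean 0 under the filter at time [t] by [mt_Lop], so its empirical mean
    enters without a centring term. *)
Lemma SN_fold_last N t c phi w : (0 < N)%N -> (t.+1 <= T)%N -> (forall s, bm (phi s)) ->
  SN t (fold_last t c phi) w = SN (N := N) t phi w + c * em N t (L t.+1 (centered t.+1 (phi t.+1))) w.
Proof.
move=> N0 tT bphi; rewrite /SN !big_ord_recr/= -addrA; congr (_ + _).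
  by apply: eq_bigr => s _; rewrite /fold_last ltn_eqF//; exact: ltn_ord.
have pe := posfun_emp (@xs N) N0 t w.
have bl : bm (L t.+1 (centered t.+1 (phi t.+1))).
  by apply: (bm_Lop model) => //; exact: bm_centered.
have pm := posfun_mt model (ltnW tT).
rewrite /fold_last eqxx /cem (posfunD pe)//; last exact: bmZ.
rewrite (posfunZ pe)// /m (posfunD pm)//; last exact: bmZ.
rewrite (posfunZ pm)// (mt_Lop model tT); last exact: bm_centered.
by rewrite -/m mt_centered// !mulr0 addr0 addrAC.
Qed.

Lemma SN_bounded t phi : (t <= T)%N -> (forall s, bm (phi s)) ->
  exists2 B, 0 <= B & forall N, (0 < N)%N -> forall w, `|SN (N := N) t phi w| <= B.
Proof.
move=> tT bphi.
have /choice[Ms hMs] : forall s, exists M, 0 <= M /\ forall x, `|centered s (phi s) x| <= M.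
  by move=> s; have [M M0 hM] := bm_bounded (bm_centered s (bphi s)); exists M; split => //; exact: ltW.
exists (\sum_(s < t.+1) Ms s); first by apply: sumr_ge0 => s _; case: (hMs s).
move=> N N0 w; apply: le_trans (ler_norm_sum _ _ _) _; apply: ler_sum => s _.
have [_ hM] := hMs s; rewrite -em_centered//.
exact: (posfun_normr_le (posfun_emp (@xs N) N0 s w) (emp_one (@xs N) N0 s w)
  (bm_centered s (bphi s)) hM).
Qed.

Lemma bm_cem N s h : (0 < N)%N -> (s <= T)%N -> bm h -> bm (cem (N := N) s h).
Proof.
by move=> N0 sT bh; apply: bmB; [exact: (bm_emp (law N))|exact: bm_cst].
Qed.

Lemma bm_WN N t phi : (0 < N)%N -> (t <= T)%N -> (forall s, bm (phi s)) -> bm (WN (N := N) t phi).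
Proof.
move=> N0 tT bphi; apply: bm_expR; do 2 apply: bmZ; apply: bm_sum => s.
by apply: bm_cem => //; apply: leq_trans tT; rewrite -ltnS.
Qed.

Lemma past_WN N t phi : (0 < N)%N -> (t.+1 <= T)%N -> (forall s, bm (phi s)) ->
  @bm _ (past N (@xs N) t.+1) R (WN (N := N) t phi).
Proof.
move=> N0 tT bphi; apply: bm_expR; do 2 apply: bmZ; apply: bm_sum => s.
by apply: bmB; [apply: past_emp => //; exact: ltn_ord|exact: bm_cst].
Qed.

Lemma WN_step N t phi : (0 < N)%N -> (t.+1 <= T)%N -> (forall s, bm (phi s)) ->
  E N (WN (N := N) t.+1 phi) = E N (fun w => WN t phi w *
    tr N t w (fun x => expR (eps N * centered t.+1 (phi t.+1) x)) ^+ N).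
Proof.
move=> N0 tT bphi.
rewrite -(step_law model N0 (law N) (h := fun x => expR (eps N * centered t.+1 (phi t.+1) x)))//.
- congr Ex; apply/funext => w; rewrite (prod_emp (@xs N) N0) em_centered//.
  by rewrite /WN -expRD -!mulrDr /SN [in LHS]big_ord_recr.
- exact: past_WN.
- by move=> w; exact: expR_ge0.
- by apply: bm_expR; apply: bmZ; exact: bm_centered.
Qed.

Lemma WN_init N phi : (0 < N)%N -> (forall s, bm (phi s)) ->
  E N (WN (N := N) 0 phi) = m 0 (fun x => expR (eps N * centered 0 (phi 0) x)) ^+ N.
Proof.
move=> N0 bphi.
rewrite -(init_law model (law N) (h := fun x => expR (eps N * centered 0 (phi 0) x)))//.
- congr Ex; apply/funext => w; rewrite (prod_emp (@xs N) N0) em_centered//.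
  by rewrite /WN /SN big_ord1.
- by apply: bm_expR; apply: bmZ; exact: bm_centered.
Qed.

Lemma mgf_init phi del : (forall s, bm (phi s)) -> 0 < del ->
  \forall N \near \oo, expR (v N * (Qlim 0 phi - del)) <= E N (WN (N := N) 0 phi)
     <= expR (v N * (Qlim 0 phi + del)).
Proof.
move=> bphi del0; have bc := bm_centered 0 (bphi 0).
have [M M0 hM] := bm_bounded bc.
have p0 := posfun_mt model (leq0n T); have m1 := mt_one model (leq0n T).
pose s2 := m 0 (fun x => centered 0 (phi 0) x ^+ 2).
pose H := 0 + M ^+ 2 + 2 * M ^+ 3.
have M30 : 0 <= M ^+ 3 by rewrite exprn_ge0// ltW.
have H0 : 0 <= H by rewrite /H add0r addr_ge0 ?sqr_ge0// mulr_ge0.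
near=> N; have N0 : (0 < N)%N by near: N; exists 1%N.
have e0 := eps_gt0 N0.
have e1 : eps N <= 1 by near: N; apply: eps_small.
have e2 : eps N * M <= 2^-1 by near: N; apply: eps_smallM => //; rewrite ltW.
have e3 : eps N * M ^+ 3 <= del / 4 / 2 by near: N; apply: eps_smallM => //; rewrite !divr_gt0.
have e4 : eps N * H ^+ 2 <= del / 4 / 2.
  by near: N; apply: eps_smallM; [exact: sqr_ge0|rewrite !divr_gt0].
have e5 : eps N * H <= 2^-1 by near: N; apply: eps_smallM.
(* Generation 0 is sampled from the exact law: no linear term, denominators equal to 1 and the exact
   second moment, so [Y = 0], [D = k = 1], [q = s2] and [G = 0]. *)
have := @core_exponent R (eps N) 0 1 1 s2 s2 M del 0 e0 e1.
rewrite !mul0r !subrr normr0 => /(_ _ _ (ltW M0)).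
have q0 : 0 <= s2 <= M ^+ 2 by exact: (posfun_sqr_bounds p0 m1 bc hM).
case=> //; try by rewrite mulr0//; lra.
- by rewrite mulr_ge0 ?ltW// divr_gt0.
- by rewrite divr_ge0// ltW.
- by lra.
- by rewrite /H in e4 *; lra.
rewrite mulr0 !add0r => u1 u2 u3.
have mc : m 0 (centered 0 (phi 0)) = 0 by exact: mt_centered.
rewrite WN_init//; set t := m 0 _.
have t0 : 0 <= t.
  apply: (posfun_ge0 p0) => [|x]; last exact: expR_ge0.
  by apply: bm_expR; exact: bmZ.
have := posfun_expR_le3 p0 m1 bc hM (ltW e0) e2.
have := posfun_expR_ge3 p0 m1 bc hM (ltW e0) e2.
rewrite -/m mc mulr0 add0r -/s2 -/t => /(_ u2) tl tu.
have -> : Qlim 0 phi = s2 / 2 by [].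
have vE c : v N * c = N%:R * (eps N ^+ 2 * c) by rewrite mulrA.
rewrite !vE; apply/andP; split.
  by apply: ge_expRn; apply: le_trans tl; rewrite ler_expR.
by apply: le_expRn => //; apply: le_trans tu _; rewrite ler_expR.
Unshelve. all: by end_near. Qed.

Lemma em_bounded N t h B w : (0 < N)%N -> bm h -> (forall x, `|h x| <= B) -> `|em N t h w| <= B.
Proof.
move=> N0 bh hB.
exact: (posfun_normr_le (posfun_emp (@xs N) N0 t w) (emp_one (@xs N) N0 t w) bh hB).
Qed.

(** The induction hypothesis is used for three families: coefficient 1 / k with precision [de] for
    the main term, and coefficients c and -c with precision 1 for the remainder where the linear
    term is not of second order. *)
Lemma mgf_step t phi : (t.+1 <= T)%N -> (forall s, bm (phi s)) ->
  (forall phi', (forall s, bm (phi' s)) -> forall del, 0 < del ->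
    \forall N \near \oo, expR (v N * (Qlim t phi' - del)) <= E N (WN (N := N) t phi')
      <= expR (v N * (Qlim t phi' + del))) ->
  forall de, 0 < de -> de <= 6^-1 ->
  \forall N \near \oo, expR (v N * (Qlim t.+1 phi - 3 * de)) <= E N (WN (N := N) t.+1 phi)
     <= expR (v N * (Qlim t.+1 phi + 3 * de)).
Proof.
move=> tT bphi IH de d0 d6; have tT' := ltnW tT.
have tT1 : (1 <= t.+1 <= T)%N by [].
set h := centered t.+1 (phi t.+1); set k := kap t.+1.
have bh : bm h := bm_centered t.+1 (bphi t.+1).
have k0 : 0 < k := kappa_gt0 model tT.
have mh : m t.+1 h = 0 by exact: mt_centered.
have b2 : bm (fun x => h x ^+ 2) by exact: bmX.
set s2 := m t.+1 (fun x => h x ^+ 2).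
(* The conditional second moment minus [s2] is the conditional mean of this centred function, hence
   a ratio whose numerator concentrates at 0. *)
have bh2 : bm (fun x => h x ^+ 2 - s2) by apply: bmB => //; exact: bm_cst.
have m2 : m t.+1 (fun x => h x ^+ 2 - s2) = 0.
  rewrite /m (posfunB (posfun_mt model tT))//; last exact: bm_cst.
  by rewrite (mt_cst model)// subrr.
have bL1 : bm (L t.+1 (fun=> 1)) := bm_Lop model tT1 (bm_cst _ 1).
have bLh : bm (L t.+1 h) := bm_Lop model tT1 bh.
have bLh2 : bm (L t.+1 (fun x => h x ^+ 2 - s2)) := bm_Lop model tT1 bh2.
have mL2 : m t (L t.+1 (fun x => h x ^+ 2 - s2)) = 0.
  by rewrite /m (mt_Lop model tT bh2) -/m m2 mulr0.
have mL1 : m t (fun x => L t.+1 (fun=> 1) x - k) = 0.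
  rewrite /m (posfunB (posfun_mt model tT'))//; last exact: bm_cst.
  by rewrite (mt_cst model)// (mt_Lop model tT (bm_cst _ 1)) (mt_one model tT) mulr1 subrr.
have bL1k : bm (fun x => L t.+1 (fun=> 1) x - k) by apply: bmB => //; exact: bm_cst.
have mN f : bm f -> m t f = 0 -> m t (fun x => - f x) = 0.
  by move=> bf mf; rewrite /m (posfunN (posfun_mt model tT') bf) -/m mf oppr0.
have [M M0 hM] := bm_bounded bh; have [MY MY0 hMY] := bm_bounded bLh.
have [BS BS0 hBS] := SN_bounded tT' bphi.
have s2M : 0 <= s2 <= M ^+ 2 by exact: (posfun_sqr_bounds (posfun_mt model tT) (mt_one model tT) bh hM).
set c := 2 / k + 1.
pose q0 := s2 / 2 + Qlim t (fold_last t k^-1 phi).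
have Qq0 : Qlim t.+1 phi = q0 by [].
pose Qp := Qlim t (fold_last t c phi); pose Qm := Qlim t (fold_last t (- c) phi).
pose c1 := M ^+ 2 + 2 * M ^+ 3.
have M30 : 0 <= M ^+ 3 by rewrite exprn_ge0// ltW.
have c10 : 0 <= c1 by rewrite addr_ge0 ?sqr_ge0// mulr_ge0.
have [A [A0 Ap Am]] := exists_cutoff Qp Qm q0 c10.
have [d1 [d10 hd1 hd2 hd3]] := exists_threshold A0 k0 d0.
pose bad N w : R := (d1 <= em N t (fun x => L t.+1 (fun=> 1) x - k) w)%R%:R +
  (d1 <= em N t (fun x => - (L t.+1 (fun=> 1) x - k)) w)%R%:R +
  (d1 <= em N t (L t.+1 (fun x => h x ^+ 2 - s2)) w)%R%:R +
  (d1 <= em N t (fun x => - L t.+1 (fun x => h x ^+ 2 - s2) x) w)%R%:R.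
have sbad : expsmall P bad.
  apply: expsmallD; [apply: expsmallD; [apply: expsmallD|]|];
    apply: (concentration model law) => //; try exact: bmN; exact: mN.
pose B := BS + M + MY / k + s2.
have B0 : 0 <= B.
  have MYk : 0 <= MY / k by rewrite divr_ge0// ltW.
  have s20 : 0 <= s2 by case/andP: s2M.
  apply: addr_ge0 => //; apply: addr_ge0 => //; apply: addr_ge0 => //; exact: ltW.
pose H := 2 * A / k + M ^+ 2 + 2 * M ^+ 3.
have H0 : 0 <= H.
  have Ak : 0 <= 2 * A / k by rewrite divr_ge0 ?(ltW k0)// mulr_ge0.
  by rewrite /H -addrA; exact: (addr_ge0 Ak c10).
have bs c' : forall s, bm (fold_last t c' phi s) by exact: bm_fold_last.
near=> N; have N0 : (0 < N)%N by near: N; exists 1%N.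
have e0 := eps_gt0 N0.
have e1 : eps N <= 1 by near: N; apply: eps_small.
have e2 : eps N * M <= 2^-1 by near: N; apply: eps_smallM => //; rewrite ltW.
have e3 : eps N * (2 * M ^+ 3) <= de / 4.
  by near: N; apply: eps_smallM; [exact: mulr_ge0|exact: divr_gt0].
have e4 : eps N * (2 * H ^+ 2) <= de / 4.
  near: N; apply: eps_smallM; last exact: divr_gt0.
  by apply: mulr_ge0 => //; exact: sqr_ge0.
have e5 : eps N * H <= 2^-1 by near: N; apply: eps_smallM.
have /andP[I1 I2] : expR (v N * (Qlim t (fold_last t k^-1 phi) - de)) <= E N (WN (N := N) t (fold_last t k^-1 phi))
      <= expR (v N * (Qlim t (fold_last t k^-1 phi) + de)) by near: N; exact: IH.
have /andP[_ I3] : expR (v N * (Qp - 1)) <= E N (WN (N := N) t (fold_last t c phi))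
      <= expR (v N * (Qp + 1)) by near: N; exact: IH.
have /andP[_ I4] : expR (v N * (Qm - 1)) <= E N (WN (N := N) t (fold_last t (- c) phi))
      <= expR (v N * (Qm + 1)) by near: N; exact: IH.
have Ib : expR (N%:R * (eps N * B)) * E N (bad N) <= expR (v N * (q0 - 1)).
  by near: N; exact: expsmall_near.
have v10 : 10 <= v N by near: N; exact: v_large.
have vd : 3 <= v N * de.
  have : 3 / de <= v N by near: N; exact: v_large.
  by rewrite ler_pdivrMr.
pose J w := WN (N := N) t phi w * tr N t w (fun x => expR (eps N * h x)) ^+ N.
pose Z w := expR (v N * (s2 / 2)) * WN (N := N) t (fold_last t k^-1 phi) w.
pose r w := expR (v N * (c1 - A)) * (WN (N := N) t (fold_last t c phi) w + WN t (fold_last t (- c) phi) w)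
   + expR (N%:R * (eps N * B)) * bad N w.
have sand w : J w <= expR (v N * de) * Z w + r w /\ Z w <= expR (v N * de) * J w + r w.
  have pe := posfun_emp (@xs N) N0 t w.
  have pt := posfun_trans model (@xs N) N0 w tT.
  have t1 := trans_one model (@xs N) N0 w tT.
  have D0 := emp_Lop_one_gt0 model (@xs N) N0 w tT.
  have ED : em N t (fun x => L t.+1 (fun=> 1) x - k) w = em N t (L t.+1 (fun=> 1)) w - k.
    have := posfunB pe bL1 (bm_cst _ k); rewrite /= (posfun_cst pe) emp_one// mulr1.
    exact.
  have ENN f : bm f -> em N t (fun x => - f x) w = - em N t f w by exact: (posfunN pe).
  have := @sandwich R N (eps N) (SN t phi w) (em N t (L t.+1 h) w)
    (em N t (L t.+1 (fun=> 1)) w) k (tr N t w (fun x => h x ^+ 2))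
    (em N t (L t.+1 (fun x => h x ^+ 2 - s2)) w) s2 (tr N t w (fun x => expR (eps N * h x)))
    M MY BS A d1 de e0 e1 k0 D0 A0 (ltW M0) (ltW MY0) (hBS N N0 w) (em_bounded t w N0 bLh hMY).
  have -> : em N t (L t.+1 (fun=> 1)) w - k = em N t (fun x => L t.+1 (fun=> 1) x - k) w by [].
  have -> : k - em N t (L t.+1 (fun=> 1)) w = em N t (fun x => - (L t.+1 (fun=> 1) x - k)) w.
    by rewrite ENN// ED opprB.
  rewrite -ENN// => sw; rewrite /J /Z /r /WN !SN_fold_last//; apply: sw => //.
  - have := posfunB pt b2 (bm_cst _ s2); rewrite /= (posfun_cst pt) t1 mulr1 => <-.
    by [].
  - exact: (posfun_sqr_bounds pt t1 bh hM).
  - by rewrite mulrCA.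
  - by rewrite mulrCA.
  - apply: (posfun_ge0 pt) => [|x]; last exact: expR_ge0.
    by apply: bm_expR; exact: bmZ.
  - apply: (posfun_le_cst pt t1); first by apply: bm_expR; exact: bmZ.
    move=> x; rewrite ler_expR ler_pM2l//; exact: le_trans (ler_norm _) (hM x).
  - exact: (posfun_expR_le3 pt t1 bh hM (ltW e0) e2).
  - exact: (posfun_expR_ge3 pt t1 bh hM (ltW e0) e2).
have bW c' : bm (WN (N := N) t (fold_last t c' phi)) by exact: bm_WN.
have bJ : bm J.
  apply: bmM; first exact: bm_WN.
  apply: bmX; apply: (bm_past (law N) (leqW tT)); apply: (bm_trans model) => //.
  by apply: bm_expR; exact: bmZ.
have bZ : bm Z by exact: bmZ.
have bb : bm (bad N) := sbad.1 N N0.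
have br : bm r by apply: bmD; [apply: bmZ; exact: bmD|exact: bmZ].
have EZ : E N Z = expR (v N * (s2 / 2)) * E N (WN (N := N) t (fold_last t k^-1 phi)).
  exact: (ExZ _ _ (bW k^-1)).
have Er : E N r <= 3 * expR (v N * (q0 - 1)).
  have -> : E N r = expR (v N * (c1 - A)) * (E N (WN (N := N) t (fold_last t c phi)) +
      E N (WN (N := N) t (fold_last t (- c) phi))) + expR (N%:R * (eps N * B)) * E N (bad N).
    rewrite /r (ExD _ (bmZ _ (bmD (bW c) (bW (- c)))) (bmZ _ bb)).
    by rewrite (ExZ _ _ (bmD (bW c) (bW (- c)))) (ExZ _ _ bb) (ExD _ (bW c) (bW (- c))).
  have j1 : expR (v N * (c1 - A)) * E N (WN (N := N) t (fold_last t c phi)) <= expR (v N * (q0 - 1)).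
    apply: le_trans (ler_wpM2l (expR_ge0 _) I3) _; rewrite -expRD ler_expR -mulrDr.
    by rewrite ler_wpM2l//; apply: le_trans v10.
  have j2 : expR (v N * (c1 - A)) * E N (WN (N := N) t (fold_last t (- c) phi)) <= expR (v N * (q0 - 1)).
    apply: le_trans (ler_wpM2l (expR_ge0 _) I4) _; rewrite -expRD ler_expR -mulrDr.
    by rewrite ler_wpM2l//; apply: le_trans v10.
  have E3 (x : R) : 3 * x = x + x + x by ring.
  rewrite [leRHS]E3 (mulrDr (expR (v N * (c1 - A)))).
  exact: (lerD (lerD j1 j2) Ib).
have v0 : 0 <= v N by apply: le_trans v10.
have EJ1 : E N J <= expR (v N * de) * E N Z + E N r.
  rewrite -(ExZ _ _ bZ) -(ExD _ (bmZ _ bZ) br); apply: Ex_le => //.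
    by apply: bmD => //; exact: bmZ.
  by move=> w; case: (sand w).
have EJ2 : E N Z <= expR (v N * de) * E N J + E N r.
  rewrite -(ExZ _ _ bJ) -(ExD _ (bmZ _ bJ) br); apply: Ex_le => //.
    by apply: bmD => //; exact: bmZ.
  by move=> w; case: (sand w).
have kZ : expR (v N * (q0 - de)) <= E N Z <= expR (v N * (q0 + de)).
  have -> : q0 - de = s2 / 2 + (Qlim t (fold_last t k^-1 phi) - de) by rewrite /q0 addrA.
  have -> : q0 + de = s2 / 2 + (Qlim t (fold_last t k^-1 phi) + de) by rewrite /q0 addrA.
  by rewrite EZ !(mulrDr (v N)) !(expRD (v N * (s2 / 2))) -!mulrDr !ler_pM2l ?expR_gt0// I1 I2.
rewrite WN_step// -/h -[E N (fun w => _)]/(E N J) Qq0.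
exact: (combine_bounds v10 d0 d6 vd kZ Er EJ1 EJ2).
Unshelve. all: by end_near. Qed.

Lemma mgf t phi : (t <= T)%N -> (forall s, bm (phi s)) -> forall del, 0 < del ->
  \forall N \near \oo, expR (v N * (Qlim t phi - del)) <= E N (WN (N := N) t phi)
     <= expR (v N * (Qlim t phi + del)).
Proof.
elim: t phi => [|t IH] phi tT bphi del del0; first exact: mgf_init.
pose de := Num.min (del / 3) (6^-1 : R).
have d0 : 0 < de by rewrite lt_min divr_gt0//= invr_gt0.
have d6 : de <= 6^-1 by rewrite ge_min lexx orbT.
have d3 : de <= del / 3 by rewrite ge_min lexx.
have := mgf_step tT bphi (fun phi' b' => IH phi' (ltnW tT) b') d0 d6.
apply: filterS => N /andP[h1 h2].
have v0 : 0 <= v N by apply: mulr_ge0 => //; exact: sqr_ge0.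
apply/andP; split.
  by apply: le_trans h1; rewrite ler_expR ler_wpM2l//; lra.
by apply: le_trans h2 _; rewrite ler_expR ler_wpM2l//; lra.
Qed.

End ParticleSequence.

(** * Covariance recursion *)

Lemma sum_symmetric (R : comNzRingType) (n : nat) (f : nat -> nat -> R) :
  (forall r s, f r s = f s r) ->
  \sum_(r < n) \sum_(s < n) f r s = \sum_(s < n) (f s s + 2 * \sum_(r < s) f r s).
Proof.
move=> fC; elim: n => [|n IH]; first by rewrite !big_ord0.
rewrite big_ord_recr [in RHS]big_ord_recr /= -IH.
under eq_bigr do rewrite big_ord_recr/=.
rewrite big_split/= [X in _ + _ + X]big_ord_recr/=.
rewrite (eq_bigr (fun r : 'I_n => f r n) (fun r _ => fC n r)); ring.
Qed.

Section CovarianceAlgebra.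
Context (R : realType) (d : nat) (mu : {measure set (d.-tuple R) -> \bar R}).
Local Notation X := (d.-tuple R).
Variables (a0 : X -> R) (a : nat -> X -> X -> R) (g : nat -> X -> R) (T : nat).
Hypothesis model : hmm mu a0 a g T.

Let m := mt mu a0 a g.
Let L := Lop mu a g.
Let kap := kappa mu a0 a g.
Local Notation cent := (centered mu a0 a g).
Local Notation Var := (Vvar mu a0 a g).
Local Notation Diag := (Vdiag mu a0 a g).
Local Notation Low := (Vlow mu a0 a g).

(** The recursion of [Vvar] in polarised form. Its bilinearity can be proved along the recursion,
    and it then identifies [Vdiag], which is given only through values of [Vvar]. *)
Fixpoint Vbil (t : nat) (phi psi : X -> R) : R :=
  match t with
  | 0 => m 0 (fun x => cent 0 phi x * cent 0 psi x)
  | t'.+1 => m t'.+1 (fun x => cent t'.+1 phi x * cent t'.+1 psi x) +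
      (kap t'.+1) ^- 2 *
      Vbil t' (fun x => L t'.+1 phi x - m t'.+1 phi * L t'.+1 (fun=> 1) x)
              (fun x => L t'.+1 psi x - m t'.+1 psi * L t'.+1 (fun=> 1) x)
  end.

Lemma Vvar_Vbil t phi : Var t phi = Vbil t phi phi.
Proof.
elim: t phi => [|t IH] phi /=; first by [].
by rewrite IH.
Qed.

Lemma VbilC t phi psi : Vbil t phi psi = Vbil t psi phi.
Proof.
have mC s f h : m s (fun x => f x * h x) = m s (fun x => h x * f x).
  by have -> : (fun x => f x * h x) = (fun x => h x * f x) by apply/funext => x; rewrite mulrC.
elim: t phi psi => [|t IH] phi psi; first exact: mC.
exact: (congr2 +%R (mC t.+1 _ _) (congr1 ( *%R _) (IH _ _))).
Qed.

Lemma centered_lin t c phi1 phi2 : (t <= T)%N -> bm phi1 -> bm phi2 ->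
  cent t (fun x => phi1 x + c * phi2 x) = (fun x => cent t phi1 x + c * cent t phi2 x).
Proof.
move=> tT b1 b2; apply/funext => x; have pm := posfun_mt model tT.
rewrite /centered (posfunD pm b1 (bmZ c b2)) (posfunZ pm _ b2); ring.
Qed.

Lemma Lop_lin t c phi1 phi2 : (1 <= t <= T)%N -> bm phi1 -> bm phi2 ->
  L t (fun x => phi1 x + c * phi2 x) = (fun x => L t phi1 x + c * L t phi2 x).
Proof.
move=> tT b1 b2; apply/funext => x; have pL := posfun_Lop model x tT.
by have := posfunD pL b1 (bmZ c b2); rewrite /= (posfunZ pL _ b2).
Qed.

Lemma Lop_centered t phi : (1 <= t <= T)%N -> bm phi ->
  L t (cent t phi) = (fun x => L t phi x - m t phi * L t (fun=> 1) x).
Proof.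
move=> tT b; apply/funext => x; have pL := posfun_Lop model x tT.
by have := posfunB pL b (bm_cst _ (m t phi)); rewrite /= (posfun_cst pL).
Qed.

Lemma bm_Lop_centered t phi : (1 <= t <= T)%N -> bm phi -> bm (L t (cent t phi)).
Proof. by move=> tT b; apply: (bm_Lop model tT); exact: bm_centered. Qed.

Lemma VbilS t phi psi : (t.+1 <= T)%N -> bm phi -> bm psi ->
  Vbil t.+1 phi psi = m t.+1 (fun x => cent t.+1 phi x * cent t.+1 psi x) +
    (kap t.+1) ^- 2 * Vbil t (L t.+1 (cent t.+1 phi)) (L t.+1 (cent t.+1 psi)).
Proof. by move=> tT b1 b2; rewrite (Lop_centered _ b1)// (Lop_centered _ b2). Qed.

Lemma Vbil0 phi psi : Vbil 0 phi psi = m 0 (fun x => cent 0 phi x * cent 0 psi x).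
Proof. by []. Qed.

Opaque Vbil.

Lemma mt_mul_lin t c h1 h2 h : (t <= T)%N -> bm h1 -> bm h2 -> bm h ->
  m t (fun x => (h1 x + c * h2 x) * h x) = m t (fun x => h1 x * h x) + c * m t (fun x => h2 x * h x).
Proof.
move=> tT b1 b2 b; have pm := posfun_mt model tT.
have := posfunD pm (bmM b1 b) (bmZ c (bmM b2 b)); rewrite (posfunZ pm _ (bmM b2 b)) => <-.
by congr (mt _ _ _ _ _ _); apply/funext => x; ring.
Qed.

Lemma Vbil_linl t c phi1 phi2 psi : (t <= T)%N -> bm phi1 -> bm phi2 -> bm psi ->
  Vbil t (fun x => phi1 x + c * phi2 x) psi = Vbil t phi1 psi + c * Vbil t phi2 psi.
Proof.
elim: t phi1 phi2 psi => [|t IH] phi1 phi2 psi tT b1 b2 b.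
  by rewrite !Vbil0 centered_lin// mt_mul_lin//; exact: bm_centered.
have b12 : bm (fun x => phi1 x + c * phi2 x) by apply: bmD => //; exact: bmZ.
have tT1 : (1 <= t.+1 <= T)%N by [].
have c1 := bm_centered mu a0 a g t.+1 b1; have c2 := bm_centered mu a0 a g t.+1 b2.
have c0 := bm_centered mu a0 a g t.+1 b.
rewrite (VbilS tT b12 b) (VbilS tT b1 b) (VbilS tT b2 b) (centered_lin c tT b1 b2).
rewrite (mt_mul_lin c tT c1 c2 c0) (Lop_lin c tT1 c1 c2).
rewrite (IH _ _ _ (ltnW tT) (bm_Lop_centered tT1 b1) (bm_Lop_centered tT1 b2) (bm_Lop_centered tT1 b)).
have alg (A B D F k : R) : A + c * B + k * (D + c * F) = A + k * D + c * (B + k * F) by ring.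
exact: alg.
Qed.

Lemma Vbil_linr t c phi psi1 psi2 : (t <= T)%N -> bm phi -> bm psi1 -> bm psi2 ->
  Vbil t phi (fun x => psi1 x + c * psi2 x) = Vbil t phi psi1 + c * Vbil t phi psi2.
Proof. by move=> *; rewrite VbilC Vbil_linl// !(VbilC t phi). Qed.

Lemma Vdiag_Vbil t phi psi : (t <= T)%N -> bm phi -> bm psi -> Diag t phi psi = Vbil t phi psi.
Proof.
move=> tT b1 b2; rewrite /Vdiag !Vvar_Vbil.
have -> : (fun x => phi x + psi x) = (fun x => phi x + 1 * psi x).
  by apply/funext => x; rewrite mul1r.
have b12 : bm (fun x => phi x + 1 * psi x) by apply: bmD => //; exact: bmZ.
rewrite Vbil_linl// !Vbil_linr// (VbilC t psi phi) !mul1r.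
by field.
Qed.

Lemma Vlow_diag t phi psi : (t <= T)%N -> bm phi -> bm psi -> Low t t phi psi = Vbil t phi psi.
Proof. by case: t => [|t] tT b1 b2; rewrite /= ?eqxx; exact: Vdiag_Vbil. Qed.

Lemma VlowS r t phi psi : (r <= t)%N ->
  Low r t.+1 phi psi = (kap t.+1)^-1 * Low r t phi (L t.+1 (cent t.+1 psi)).
Proof. by move=> rt /=; rewrite ltn_eqF. Qed.

Lemma Vlow_linr r t c phi psi1 psi2 : (r <= t)%N -> (t <= T)%N ->
  bm phi -> bm psi1 -> bm psi2 ->
  Low r t phi (fun x => psi1 x + c * psi2 x) = Low r t phi psi1 + c * Low r t phi psi2.
Proof.
elim: t psi1 psi2 => [|t IH] psi1 psi2 rt tT b b1 b2.
  have b12 : bm (fun x => psi1 x + c * psi2 x) by apply: bmD => //; exact: bmZ.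
  by rewrite leqn0 in rt; move: rt => /eqP ->; rewrite !Vlow_diag// Vbil_linr.
have b12 : bm (fun x => psi1 x + c * psi2 x) by apply: bmD => //; exact: bmZ.
move: rt; rewrite leq_eqVlt => /predU1P[->|rt]; first by rewrite !Vlow_diag// Vbil_linr.
have tT1 : (1 <= t.+1 <= T)%N by [].
have c1 := bm_centered mu a0 a g t.+1 b1; have c2 := bm_centered mu a0 a g t.+1 b2.
have {}rt : (r <= t)%N by [].
rewrite !(VlowS _ _ rt) (centered_lin c tT b1 b2) (Lop_lin c tT1 c1 c2).
rewrite (IH _ _ rt (ltnW tT) b (bm_Lop_centered tT1 b1) (bm_Lop_centered tT1 b2)).
by rewrite mulrDr mulrCA.
Qed.

Lemma VlowZl r t c phi psi : (r <= t)%N -> (t <= T)%N -> bm phi -> bm psi ->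
  Low r t (fun x => c * phi x) psi = c * Low r t phi psi.
Proof.
have bilZ t' phi' psi' : (t' <= T)%N -> bm phi' -> bm psi' ->
    Vbil t' (fun x => c * phi' x) psi' = c * Vbil t' phi' psi'.
  move=> tT b1 b2; have b0 := bm_cst X (0 : R).
  have z : Vbil t' (fun=> 0) psi' = 0.
    have -> : (fun=> 0) = (fun x : X => (fun=> 0) x + (-1) * (fun=> 0) x :> R).
      by apply/funext => x; rewrite mulr0 addr0.
    by rewrite Vbil_linl// mulN1r subrr.
  have -> : (fun x => c * phi' x) = (fun x => (fun=> 0) x + c * phi' x).
    by apply/funext => x; rewrite add0r.
  by rewrite Vbil_linl// z add0r.
elim: t psi => [|t IH] psi rt tT b b1.
  by rewrite leqn0 in rt; move: rt => /eqP ->; rewrite !Vlow_diag ?bilZ//; exact: bmZ.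
move: rt; rewrite leq_eqVlt => /predU1P[->|rt].
  by rewrite !Vlow_diag ?bilZ//; exact: bmZ.
have tT1 : (1 <= t.+1 <= T)%N by [].
have {}rt : (r <= t)%N by [].
rewrite !(VlowS _ _ rt) (IH _ rt (ltnW tT) b (bm_Lop_centered tT1 b1)).
by rewrite mulrCA.
Qed.

Lemma VlowZr r t c phi psi : (r <= t)%N -> (t <= T)%N -> bm phi -> bm psi ->
  Low r t phi (fun x => c * psi x) = c * Low r t phi psi.
Proof.
move=> rt tT b1 b2; have b0 := bm_cst X (0 : R).
have z : Low r t phi (fun=> 0) = 0.
  have -> : (fun=> 0) = (fun x : X => (fun=> 0) x + (-1) * (fun=> 0) x :> R).
    by apply/funext => x; rewrite mulr0 addr0.
  by rewrite Vlow_linr// mulN1r subrr.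
have -> : (fun x => c * psi x) = (fun x => (fun=> 0) x + c * psi x).
  by apply/funext => x; rewrite add0r.
by rewrite Vlow_linr// z add0r.
Qed.

Let offdiag (t : nat) (phi : nat -> X -> R) (psi : X -> R) : R := \sum_(r < t) Low r t (phi r) psi.

Let Vsum (t : nat) (phi : nat -> X -> R) : R :=
  \sum_(s < t.+1) (Low s s (phi s) (phi s) + 2 * offdiag s phi (phi s)).

(** As [offdiag s] involves only indices below [s], the function of index [t] occurs in the last
    summand alone, which bilinearity expands. *)
Lemma Vsum_fold_last t phi c chi : (t.+1 <= T)%N -> (forall s, bm (phi s)) -> bm chi ->
  Vsum t (fun s => if s == t then (fun x => phi t x + c * chi x) else phi s) =
  Vsum t phi + 2 * c * (Vbil t (phi t) chi + offdiag t phi chi) + c ^+ 2 * Vbil t chi chi.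
Proof.
move=> tT b bc; set phi' := fun s => _.
have tT' := ltnW tT.
have phiE s : (s < t)%N -> phi' s = phi s by move=> st; rewrite /phi' ltn_eqF.
have phitE : phi' t = (fun x => phi t x + c * chi x) by rewrite /phi' eqxx.
have bt : bm (fun x => phi t x + c * chi x) by apply: bmD => //; exact: bmZ.
have offE s psi : (s <= t)%N -> offdiag s phi' psi = offdiag s phi psi.
  move=> st; apply: eq_bigr => r _; rewrite phiE//.
  exact: leq_trans (ltn_ord r) st.
rewrite {1}/Vsum big_ord_recr/= phitE.
rewrite (eq_bigr (fun s : 'I_t => Low s s (phi s) (phi s) + 2 * offdiag s phi (phi s))); last first.
  move=> s _; rewrite (phiE _ (ltn_ord s)) offE//; exact: ltnW.
rewrite /Vsum [in RHS]big_ord_recr/=.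
have -> : offdiag t phi' (fun x => phi t x + c * chi x) = offdiag t phi (phi t) + c * offdiag t phi chi.
  rewrite offE// /offdiag mulr_sumr -big_split; apply: eq_bigr => r _.
  by rewrite (Vlow_linr c (ltnW (ltn_ord r)) tT' (b r) (b t) bc).
rewrite (Vlow_diag tT' bt bt) (Vlow_diag tT' (b t) (b t)) (Vbil_linl c tT' (b t) bc bt).
rewrite (Vbil_linr c tT' (b t) (b t) bc) (Vbil_linr c tT' bc (b t) bc) (VbilC t chi (phi t)).
have alg (A B C D F G : R) : A + (B + c * C + c * (C + c * D) + 2 * (F + c * G)) =
    A + (B + 2 * F) + 2 * c * (C + G) + c ^+ 2 * D by ring.
exact: alg.
Qed.

(** Folding adds kappa^-1 * chi to phi_t. The square of this term is the part kappa^-2 V_t(chi) of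
    the variance at time t+1, and its cross terms are the covariances of time t+1 with all earlier
    times, by [VlowS]. *)
Lemma Qlim_Vlow t phi : (t <= T)%N -> (forall s, bm (phi s)) ->
  2 * Qlim mu a0 a g t phi = Vsum t phi.
Proof.
elim: t phi => [|t IH] phi tT b.
  rewrite /Vsum big_ord1 /offdiag big_ord0 mulr0 addr0 (Vlow_diag tT (b 0) (b 0)).
  by rewrite Vbil0 -[Qlim _ _ _ _ _ _]/(m 0 (fun x => cent 0 (phi 0) x ^+ 2) / 2) mulrC divfK// pnatr_eq0.
have tT1 : (1 <= t.+1 <= T)%N by [].
have tT' := ltnW tT.
set chi := L t.+1 (cent t.+1 (phi t.+1)).
have bchi : bm chi by exact: bm_Lop_centered.
rewrite -[Qlim _ _ _ _ _ _]/(m t.+1 (fun x => cent t.+1 (phi t.+1) x ^+ 2) / 2 +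
  Qlim mu a0 a g t (fold_last mu a0 a g t (kap t.+1)^-1 phi)).
rewrite mulrDr (IH _ tT' (bm_fold_last model _ tT b)) (Vsum_fold_last _ tT b bchi).
have -> : Vsum t.+1 phi = Vsum t phi + (Low t.+1 t.+1 (phi t.+1) (phi t.+1) + 2 * offdiag t.+1 phi (phi t.+1)).
  by rewrite /Vsum big_ord_recr.
have -> : offdiag t.+1 phi (phi t.+1) = (kap t.+1)^-1 * (offdiag t phi chi + Vbil t (phi t) chi).
  rewrite /offdiag big_ord_recr/= -(Vlow_diag tT' (b t) bchi) mulrDr mulr_sumr; congr (_ + _).
    by apply: eq_bigr => r _; exact: (VlowS _ _ (ltnW (ltn_ord r))).
  exact: (VlowS _ _ (leqnn t)).
rewrite (Vlow_diag tT (b t.+1) (b t.+1)) (VbilS tT (b t.+1) (b t.+1)) -/chi.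
have alg (k A B C D F : R) : 2 * (A / 2) + (B + 2 * k^-1 * (C + D) + k^-1 ^+ 2 * F) =
    B + (A + k ^- 2 * F + 2 * (k^-1 * (D + C))).
  rewrite exprVn mulrC divfK ?pnatr_eq0//; ring.
exact: alg.
Qed.

Lemma quadratic_Vmat (psi : nat -> X -> R) (lam : 'rV[R]_T.+1) : (forall s, bm (psi s)) ->
  (lam *m Vmat mu a0 a g T psi *m lam^T) 0 0 =
  2 * Qlim mu a0 a g T (fun s x => lam 0 (inord s) * psi s x).
Proof.
move=> b; have bl s : bm (fun x => lam 0 (inord s) * psi s x) by exact: bmZ.
rewrite (Qlim_Vlow (leqnn T) bl).
pose f r s := lam 0 (inord r) * lam 0 (inord s) * Vcov mu a0 a g r s (psi r) (psi s).
have fC r s : f r s = f s r.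
  rewrite /f [lam 0 (inord r) * _]mulrC; congr (_ * _); rewrite /Vcov.
  by case: (ltngtP r s) => // ->.
transitivity (\sum_(r < T.+1) \sum_(s < T.+1) f r s).
  rewrite mxE exchange_big; apply: eq_bigr => s _; rewrite !mxE mulr_suml.
  apply: eq_bigr => r _; rewrite !mxE /f !inord_val; ring.
rewrite sum_symmetric//; apply: eq_bigr => s _.
have sT : (s <= T)%N by rewrite -ltnS.
have bs := b s; congr (_ + 2 * _).
  by rewrite /f /Vcov leqnn (VlowZl _ (leqnn s) sT bs (bl s)) (VlowZr _ (leqnn s) sT bs bs) mulrA.
apply: eq_bigr => r _; have rs := ltnW (ltn_ord r).
by rewrite /f /Vcov rs (VlowZl _ rs sT (b r) (bl s)) (VlowZr _ rs sT (b r) bs) mulrA.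
Qed.

End CovarianceAlgebra.

(** * Quadratic rate functions *)

Section Cube.
Context (R : realType) (n : nat).
Implicit Types (x y lam : 'rV[R]_n).

Definition cube x (e : R) : set 'rV[R]_n := [set y | forall j, `|y 0 j - x 0 j| < e].

Lemma nbhs_cube x e : 0 < e -> nbhs x (cube x e).
Proof.
move=> e0; apply/nbhs_ballP; exists e => // y [_ xy] j.
by have := xy 0 j; rewrite /ball/= distrC.
Qed.

Lemma nbhs_cubeP x (U : set 'rV[R]_n) : nbhs x U -> exists2 e, 0 < e & cube x e `<=` U.
Proof.
move=> /nbhs_ballP[e /= e0 eU]; exists e => // y xy; apply: eU; split => // i j.
by rewrite ord1 /ball/= distrC.
Qed.

Definition dot x lam : R := \sum_(i < n) x 0 i * lam 0 i.

Lemma dotE x lam : dot x lam = (x *m lam^T) 0 0.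
Proof. by rewrite mxE; apply: eq_bigr => i _; rewrite mxE. Qed.

Lemma dot_delta x j : dot x (delta_mx 0 j) = x 0 j.
Proof.
rewrite /dot (bigD1 j)//= mxE !eqxx mulr1 big1 ?addr0// => i ij.
by rewrite mxE (negbTE ij) andbF mulr0.
Qed.

Lemma dotDr x lam1 lam2 : dot x (lam1 + lam2) = dot x lam1 + dot x lam2.
Proof. by rewrite -big_split; apply: eq_bigr => i _; rewrite mxE mulrDr. Qed.

Lemma dotZr x c lam : dot x (c *: lam) = c * dot x lam.
Proof. by rewrite mulr_sumr; apply: eq_bigr => i _; rewrite mxE mulrCA. Qed.

Lemma dot_lipschitz x y e lam : 0 <= e -> (forall j, `|y 0 j - x 0 j| <= e) ->
  `|dot y lam - dot x lam| <= e * \sum_(j < n) `|lam 0 j|.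
Proof.
move=> e0 h; rewrite /dot -sumrB mulr_sumr; apply: le_trans (ler_norm_sum _ _ _) _.
by apply: ler_sum => j _; rewrite -mulrBl normrM ler_wpM2r.
Qed.

Lemma open_half_space lam a : open [set x | a < dot x lam].
Proof.
rewrite openE => x /= ax; set W := \sum_(j < n) `|lam 0 j|.
have W0 : 0 <= W by apply: sumr_ge0.
have W1 : 0 < W + 1 by lra.
have e0 : 0 < (dot x lam - a) / (W + 1) by rewrite divr_gt0// subr_gt0.
apply: filterS (nbhs_cube x e0) => y xy /=.
have := dot_lipschitz lam (ltW e0) (fun j => ltW (xy j)); rewrite -/W.
have : (dot x lam - a) / (W + 1) * W < dot x lam - a.
  by rewrite mulrAC ltr_pdivrMr// ltr_pM2l ?subr_gt0//; lra.
by rewrite ler_norml => h /andP[]; lra.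
Qed.

(** An open set is a countable union of cubes with rational centres and radii 1 / (k + 1), and the
    preimage of a cube is a finite intersection of conditions on coordinates. *)
Lemma borel_preimage_measurable dO (Om : measurableType dO) (F : Om -> 'rV[R]_n) :
  (forall j, measurable_fun setT (fun w => F w 0 j)) ->
  forall G, borel_rV G -> measurable (F @^-1` G).
Proof.
move=> mF; apply: smallest_sub.
  split; first by rewrite preimage_set0.
  - by move=> A mA; rewrite setTD preimage_setC; exact: measurableC.
  - by move=> A mA; rewrite preimage_bigcup; exact: bigcup_measurable.
move=> U oU; rewrite /=.
pose B (c : 'rV[rat]_n) (k : nat) := cube (\row_j ratr (c 0 j)) k.+1%:R^-1.
(* The cubes are enumerated through [pickle]; numbers that encode none, and cubes not contained in
   [U], contribute the empty set. *)
pose Bn i := if unpickle i is Some (c, k) then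
   if pselect (B c k `<=` U) then F @^-1` (B c k) else set0 else set0.
have -> : F @^-1` U = \bigcup_i Bn i.
  apply/seteqP; split => w /=; last first.
    move=> [i _]; rewrite /Bn; case: (unpickle i) => // -[c k].
    by case: pselect => // BU; exact: BU.
  move=> Uw; have [e e0 eU] := nbhs_cubeP (open_nbhs_nbhs (conj oU Uw)).
  (* Two points of a cube of this radius have coordinates less than [e] apart, so a cube that
     contains [F w] lies in [U]. *)
  have [k hk] : exists k, k.+1%:R^-1 < e / 2.
    exists (Num.truncn (e / 2)^-1); rewrite invf_plt ?posrE ?divr_gt0//.
    exact: truncnS_gt.
  have k0 : (0 : R) < k.+1%:R^-1 by [].
  have /choice[c hc] : forall j, exists q : rat, ratr q \in `](F w 0 j), (F w 0 j + k.+1%:R^-1)[%R.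
    by move=> j; apply: rat_in_itvoo; rewrite ltrDl.
  have wB : B (\row_j c j) k (F w).
    move=> j; rewrite !mxE; have := hc j; rewrite in_itv/= => /andP[h1 h2].
    move: k0 h1 h2; move: (k.+1%:R^-1) (F w 0 j) (ratr (c j)) => r u v k0 h1 h2.
    by rewrite ltr_norml; apply/andP; split; lra.
  exists (pickle (\row_j c j, k)) => //; rewrite /Bn pickleK; case: pselect => // nBU.
  exfalso; apply: nBU => z zB; apply: eU => j.
  have := wB j; have := zB j; rewrite !mxE => h1 h2.
  rewrite -[z 0 j - _](subrKA (ratr (c j))).
  apply: le_lt_trans (ler_normD _ _) _; rewrite distrC in h2.
  move: hk h1 h2; move: (k.+1%:R^-1) `|_| `|_| => r u v; lra.
apply: bigcup_measurable => i _; rewrite /Bn; case: (unpickle i) => // -[c k].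
case: pselect => [BU|nBU] //=.
have -> : F @^-1` B c k = \bigcap_(j in [set: 'I_n]) [set w | `|F w 0 j - ratr (c 0 j)| < k.+1%:R^-1].
  apply/seteqP; split => w /= h j; first by move=> _; have := h j; rewrite mxE.
  by rewrite mxE; exact: (h j I).
apply: fin_bigcap_measurable; first exact: finite_finset.
move=> j _; have mj : measurable_fun setT (fun w => `|F w 0 j - ratr (c 0 j)|).
  by apply: measurableT_comp => //; apply: measurable_funB.
have := measurable_fun_ltr mj (@measurable_cst _ _ _ _ setT (k.+1%:R^-1 : R)).
by move=> /(_ measurableT [set true] I); rewrite setTI.
Qed.

End Cube.

Section QuadraticRate.
Context (R : realType) (n : nat) (V : 'M[R]_n).
Hypothesis Vsym : V^T = V.
Implicit Types (x lam : 'rV[R]_n).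

Definition quad lam : R := (lam *m V *m lam^T) 0 0.

Lemma rateI_ge x lam : ((dot x lam - 2^-1 * quad lam)%:E <= rateI V x)%E.
Proof. by apply: ereal_sup_ubound; exists lam. Qed.

Lemma quadD lam eta s :
  quad (lam + s *: eta) = quad lam + 2 * s * dot (lam *m V) eta + s ^+ 2 * quad eta.
Proof.
have E : dot (lam *m V) eta = (eta *m V *m lam^T) 0 0.
  by rewrite dotE -[in LHS](trmxK (lam *m V *m eta^T)) mxE !trmx_mul trmxK Vsym mulmxA.
rewrite /quad linearD linearZ/= !mulmxDl !mulmxDr -!scalemxAl -!scalemxAr !mxE.
have -> : \sum_j (lam *m V) 0 j * eta^T j 0 = dot (lam *m V) eta by rewrite dotE mxE.
have -> : \sum_j (eta *m V) 0 j * lam^T j 0 = dot (lam *m V) eta by rewrite E mxE.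
ring.
Qed.

Lemma quad_delta j : quad (delta_mx 0 j) = V j j.
Proof.
by rewrite /quad -dotE dot_delta mxE (bigD1 j)//= mxE !eqxx mul1r big1 ?addr0// => i ij;
  rewrite mxE (negbTE ij) andbF mul0r.
Qed.

Lemma quadZ s lam : quad (s *: lam) = s ^+ 2 * quad lam.
Proof. by rewrite /quad linearZ/= -!scalemxAl -!scalemxAr !mxE; ring. Qed.

(* A point outside the row space of V is separated from it by a vector in the kernel of V. *)
Lemma rateI_fin_range x (c : R) : (rateI V x <= c%:E)%E -> exists lam, x = lam *m V.
Proof.
move=> Ic; have [/submxP[D ->]|xV] := boolP (x <= V)%MS; first by exists D.
exfalso; rewrite submxE in xV.
have [j xj] : exists j, (x *m cokermx V) 0 j != 0.
  apply/existsP; apply: contraR xV => /existsPn h; apply/eqP/rowP => j.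
  by have := h j; rewrite negbK mxE => /eqP ->; rewrite mxE.
pose eta : 'rV[R]_n := (col j (cokermx V))^T.
have dx : dot x eta = (x *m cokermx V) 0 j.
  by rewrite dotE trmxK !mxE; apply: eq_bigr => i _; rewrite mxE.
have q0 : quad eta = 0.
  have VC : V *m eta^T = 0.
    apply/colP => i; have := congr1 (fun M : 'M[R]_n => M i j) (mulmx_coker V).
    rewrite [LHS]mxE [RHS]mxE => h; rewrite trmxK [LHS]mxE [RHS]mxE -[RHS]h.
    by apply: eq_bigr => l _; rewrite mxE.
  by rewrite /quad -mulmxA VC mulmx0 mxE.
have := le_trans (rateI_ge x (((c + 1) / dot x eta) *: eta)) Ic.
rewrite quadZ q0 !mulr0 subr0 dotZr divfK ?dx// lee_fin; lra.
Qed.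

Lemma rateI_ge0 x : (0 <= rateI V x)%E.
Proof.
have := rateI_ge x (0 *: 0); rewrite dotZr quadZ expr0n/= !mul0r mulr0 subr0.
by [].
Qed.

Lemma rateI_gt x (c : R) : (c%:E < rateI V x)%E -> exists lam, c < dot x lam - 2^-1 * quad lam.
Proof. by move=> /ereal_sup_gt[_ [lam _ <-]]; rewrite lte_fin; exists lam. Qed.

Lemma rateI_lsc : lower_semicontinuous (rateI V).
Proof.
move=> x c /rateI_gt[lam h].
exists [set y | c + 2^-1 * quad lam < dot y lam].
  apply: open_nbhs_nbhs; split; first exact: open_half_space.
  by rewrite /=; lra.
move=> y /= hy; apply: lt_le_trans (rateI_ge y lam); rewrite lte_fin; lra.
Qed.

Lemma good_rateI : good_rate_function (rateI V).
Proof.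
split; [exact: rateI_ge0|exact: rateI_lsc|] => c.
apply: bounded_closed_compact; last first.
  have -> : [set x | rateI V x <= c%:E]%E = ~` [set x | c%:E < rateI V x]%E.
    by apply/seteqP; split => x /=; [move=> h; apply/negP; rewrite -leNgt|move/negP; rewrite -leNgt].
  apply: open_closedC; exact: (lower_semicontinuousP _).1 rateI_lsc c.
pose B := `|c| + \sum_(j < n) `|V j j|.
have B0 : 0 <= B by rewrite addr_ge0// sumr_ge0.
exists B; split; first by rewrite num_real.
move=> K BK x /= Ic; apply: le_trans (ltW BK); rewrite -[leLHS]/(mx_norm x) mx_normrE.
apply: bigmax_le => // -[i j] _ /=; rewrite ord1.
have Vj : `|V j j| <= \sum_(j < n) `|V j j|.
  by rewrite [leRHS](bigD1 j)//= lerDl sumr_ge0.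
(* Testing the supremum at plus or minus a unit vector bounds that coordinate by c + V_jj / 2 on the
   level set. *)
have h s : `|s| = 1 -> s * x 0 j <= B.
  move=> s1; have := le_trans (rateI_ge x (s *: delta_mx 0 j)) Ic.
  have s2 : s ^+ 2 = 1 by rewrite -real_normK ?num_real// s1 expr1n.
  rewrite dotZr quadZ quad_delta dot_delta s2 mul1r lee_fin => h.
  have := ler_norm (V j j); have := ler_norm c; have := normr_ge0 (V j j); rewrite /B; lra.
have h1 := h 1 (normr1 _); have h2 := h (-1) (normrN1 _).
by rewrite ler_norml; apply/andP; split; lra.
Qed.

End QuadraticRate.

(** * From exponential moments to deviations *)

Section ExtendedReals.
Context (R : realType).
Local Open Scope ereal_scope.

Lemma elog_le (s c p : R) : (0 < s)%R -> (0 <= p)%R -> (p <= expR (s * c))%R ->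
  (s^-1)%:E * elog p%:E <= c%:E.
Proof.
move=> s0 p0 pc; rewrite /elog; case: eqP => [_|/eqP pn0].
  by rewrite gt0_muleNy ?lte_fin ?invr_gt0// leNye.
have pp : (0 < p)%R by rewrite lt_neqAle p0 andbT eq_sym; move: pn0; rewrite eqe.
rewrite -EFinM lee_fin/= ler_pdivrMl// -(expRK (s * c)%R).
by rewrite ler_ln ?posrE ?expR_gt0.
Qed.

Lemma elog_ge (s c p : R) : (0 < s)%R -> (expR (s * c) <= p)%R ->
  c%:E <= (s^-1)%:E * elog p%:E.
Proof.
move=> s0 pc; have pp : (0 < p)%R := lt_le_trans (expR_gt0 _) pc.
rewrite /elog eqe gt_eqF// -EFinM lee_fin/= ler_pdivlMl// -(expRK (s * c)%R).
by rewrite ler_ln ?posrE ?expR_gt0.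
Qed.

Lemma limn_esup_le (u : (\bar R)^nat) c : (\forall N \near \oo, u N <= c) -> limn_esup u <= c.
Proof.
move=> h; apply: (@le_trans _ _ (ereal_sup (u @` [set N | u N <= c]))).
  by apply: ereal_inf_lbound; exists [set N | u N <= c].
by apply: ge_ereal_sup => _ [N h' <-].
Qed.

Lemma limn_einf_ge (u : (\bar R)^nat) c : (\forall N \near \oo, c <= u N) -> c <= limn_einf u.
Proof.
move=> h; rewrite /limn_einf leeNr; apply: limn_esup_le.
by apply: filterS h => N; rewrite leeN2.
Qed.

Lemma le_oppe_of_lt (l y : \bar R) : (forall c : R, c%:E < y -> l <= (- c)%:E) -> l <= - y.
Proof.
case: y => [r||] h; last by rewrite /= leey.
  apply/lee_addgt0Pr => e e0; have := h (r - e)%R.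
  by rewrite lte_fin ltrBlDr ltrDl => /(_ e0); rewrite opprB addrC EFinD.
rewrite /=; case: l h => [l||] h; last by [].
  by exfalso; have := h (- l + 1)%R (ltry _); rewrite lee_fin; lra.
by have := h 0%R (ltry _).
Qed.

End ExtendedReals.

Section MomentsToDeviations.
Context (R : realType) (n : nat) (V : 'M[R]_n).
Hypothesis Vsym : V^T = V.
Context (dO : nat -> measure_display) (Om : forall N : nat, measurableType (dO N))
  (P : forall N : nat, probability (Om N) R) (M : forall N : nat, Om N -> 'rV[R]_n)
  (s : nat -> R).
Hypothesis s_large : forall K, \forall N \near \oo, K <= s N.
Hypothesis bM : forall N j, bm (fun w => @M N w 0 j).
Local Notation E N := (Ex (P N)).
Local Notation emgf lam N := (Ex (P N) (fun w => expR (s N * dot (@M N w) lam))).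
Hypothesis mgf_lim : forall lam del, 0 < del -> \forall N \near \oo,
  expR (s N * (2^-1 * quad V lam - del)) <= emgf lam N
    <= expR (s N * (2^-1 * quad V lam + del)).

Let bdot lam N : bm (fun w => expR (s N * dot (@M N w) lam)).
Proof.
apply: bm_expR; apply: bmZ; apply: bm_sum => j.
by apply: bmM; [exact: bM|exact: bm_cst].
Qed.

Let bm_cube x del N : bm (\1_[set w | cube x del (@M N w)] : Om N -> R).
Proof.
apply: bm_indic.
have -> : [set w | cube x del (@M N w)] =
    \bigcap_(j in [set: 'I_n]) [set w | `|@M N w 0 j - x 0 j| < del].
  by apply/seteqP; split => w /= h j; [move=> _; exact: h|exact: (h j I)].
apply: fin_bigcap_measurable; first exact: finite_finset.
move=> j _; have mj : measurable_fun setT (fun w => `|@M N w 0 j - x 0 j|).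
  by apply: measurableT_comp => //; apply: measurable_funB => //; case: (bM N j).
have := measurable_fun_ltr mj (@measurable_cst _ _ _ _ setT (del : R)).
by move=> /(_ measurableT [set true] I); rewrite setTI.
Qed.

(** In the half-space of [lam] the function [G lam] is at least 1, and its mean is at most exp(s (-a
    + ga / 2)) by the limit at [lam]. The number of half-spaces is absorbed by exp(s ga / 2). *)
Lemma half_spaces_upper (ls : seq 'rV[R]_n) (a ga : R) (A : forall N, set (Om N)) :
  (forall N, measurable (A N)) -> 0 < ga ->
  (forall N w, A N w -> exists2 lam, lam \in ls & a < dot (@M N w) lam - 2^-1 * quad V lam) ->
  \forall N \near \oo, E N \1_(A N) <= expR (s N * (- a + ga)).
Proof.
move=> mA ga0 hA.
pose G lam N (w : Om N) := expR (- (s N * (a + 2^-1 * quad V lam))) * expR (s N * dot (@M N w) lam).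
have bG lam N : bm (@G lam N) by apply: bmZ; exact: bdot.
have hs : \forall N \near \oo, \sum_(lam <- ls) E N (@G lam N) <=
    (size ls)%:R * expR (s N * (- a + ga / 2)).
  have ga2 : 0 < ga / 2 by rewrite divr_gt0.
  elim: ls {hA} => [|lam ls IH].
    by apply: nearW => N; rewrite big_nil mul0r.
  apply: filterS2 IH (mgf_lim lam ga2) => N h1 /andP[_ h2].
  rewrite big_cons /= -natr1 mulrDl mul1r addrC lerD//.
  have -> : E N (@G lam N) = expR (- (s N * (a + 2^-1 * quad V lam))) * emgf lam N.
    by rewrite -(ExZ (P N) _ (bdot lam N)).
  apply: le_trans (ler_wpM2l (expR_ge0 _) h2) _.
  by rewrite -expRD ler_expR; lra.
have sz := s_large ((size ls)%:R / (ga / 2)).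
have s0 := s_large 0.
near=> N.
have h1 : \sum_(lam <- ls) E N (@G lam N) <= (size ls)%:R * expR (s N * (- a + ga / 2)).
  by near: N.
have h2 : (size ls)%:R <= expR (s N * (ga / 2)).
  have : (size ls)%:R / (ga / 2) <= s N by near: N.
  rewrite ler_pdivrMr ?divr_gt0// => h; apply: le_trans h _.
  by apply: le_trans (expR_ge1Dx _); rewrite lerDr.
have s00 : 0 <= s N by near: N.
apply: (@le_trans _ _ (\sum_(lam <- ls) E N (@G lam N))).
  rewrite -(posfun_sum (posfun_Ex (P N)))//; apply: Ex_le.
  - exact: bm_indic.
  - exact: bm_sum.
  move=> w; rewrite indicE; have [Aw|Aw] := pselect (A N w); last first.
    by rewrite memNset// sumr_ge0// => lam _; rewrite mulr_ge0 ?expR_ge0.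
  rewrite mem_set//; have [lam lamls h] := hA N w Aw.
  rewrite (big_rem lam)//= ler_wpDr//.
    by rewrite sumr_ge0// => lam' _; rewrite mulr_ge0 ?expR_ge0.
  rewrite /G -expRD -[leLHS]expR0 ler_expR addrC subr_ge0 ler_wpM2l//; lra.
apply: le_trans h1 _.
have -> : s N * (- a + ga) = s N * (ga / 2) + s N * (- a + ga / 2) by lra.
by rewrite expRD ler_wpM2r ?expR_ge0.
Unshelve. all: by end_near. Qed.

(* Exponential tilting by lam without changing the measure: outside the cube around lam *m V
   some coordinate deviates, and there tilting further by a multiple of a unit vector wins. *)
Lemma cube_lower lam (del ga : R) : 0 < del -> 0 < ga ->
  \forall N \near \oo, expR (s N * (- (2^-1 * quad V lam) - ga)) <=
    E N \1_[set w | cube (lam *m V) del (@M N w)].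
Proof.
have alg1 (k X Y : R) : 4 * k * X <= Y * X -> k * (2 * X) <= 2^-1 * (Y * X) by lra.
have alg2 (A1 A2 A3 : R) : A1 * A2 <= A3 -> 2 * A2 <= A1 * A2 -> A2 <= 2^-1 * A3 by lra.
have alg3 (A1 A2 A3 A4 : R) : A1 <= A2 -> A2 <= A3 + A4 -> A4 <= 2^-1 * A1 -> 2^-1 * A1 <= A3.
  by lra.
have alg4 (k l c : R) : l <= c / 4 -> c / 2 + (2 * k + c / 4 + (- k - c)) <= k - l by lra.
have two (A1 A2 A3 : R) : A1 <= A3 -> A2 <= A3 -> A1 + A2 <= 2 * A3 by lra.
move=> del0 ga0; set x := lam *m V; set q := 2^-1 * quad V lam.
have dx : dot x lam = 2 * q by rewrite dotE -/(quad V lam) /q; lra.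
pose W := \sum_(j < n) `|lam 0 j|; pose D := \sum_(j < n) `|V j j|.
have W0 : 0 <= W by apply: sumr_ge0.
have D0 : 0 <= D by apply: sumr_ge0.
have W1 : 0 < 4 * (W + 1) by lra.
have D1 : 0 < 2 * (D + 1) by lra.
(* In a cube of this smaller radius the tilt [dot _ lam] stays within [ga / 4] of its value at
   [x]. *)
have [de [de0 dedel deW]] : exists de, [/\ 0 < de, de <= del & de * W <= ga / 4].
  exists (Num.min del (ga / (4 * (W + 1)))).
  have i1 : Num.min del (ga / (4 * (W + 1))) <= del by rewrite ge_min lexx.
  have i2 : Num.min del (ga / (4 * (W + 1))) <= ga / (4 * (W + 1)) by rewrite ge_min lexx orbT.
  have i0 : 0 < Num.min del (ga / (4 * (W + 1))) by rewrite lt_min del0 divr_gt0.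
  split => //; move: (Num.min _ _) i0 i2 => de i0; rewrite ler_pdivlMr//; lra.
(* Extra tilt so small that its quadratic cost sg^2 V_jj / 2 is at most a quarter of the gain
   [sg * de]; [g1] takes at most another quarter. *)
pose sg := de / (2 * (D + 1)).
have sg0 : 0 < sg by rewrite divr_gt0.
have sgD : sg * D <= de / 2.
  have : sg * (2 * (D + 1)) = de by rewrite divfK// gt_eqF.
  by lra.
have sgde : 0 < sg * de by rewrite mulr_gt0.
pose g1 := Num.min (ga / 4) (sg * de / 4).
have g10 : 0 < g1 by rewrite lt_min !divr_gt0.
have g1a : g1 <= ga / 4 by rewrite ge_min lexx.
have g1b : g1 <= sg * de / 4 by rewrite ge_min lexx orbT.
(* [F] dominates the tilted integrand where coordinate [j] is off by at least [de] on the side given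
   by the sign of [tau]. As [x = lam *m V] is the gradient of half the quadratic form at [lam], the
   first-order term in [tau] cancels [tau * x 0 j], and [- (sg * de)] decides. *)
pose F N (tau : R) j (w : Om N) := expR (- (s N * (sg * de + tau * x 0 j))) *
  expR (s N * dot (@M N w) (lam + tau *: delta_mx 0 j)).
have bF N tau j : bm (@F N tau j) by apply: bmZ; exact: bdot.
have FE tau j : tau = sg \/ tau = - sg -> \forall N \near \oo,
    E N (@F N tau j) <= expR (s N * (q - sg * de / 2)).
  move=> htau; have t2 : tau ^+ 2 = sg ^+ 2 by case: htau => ->; rewrite ?sqrrN.
  apply: filterS2 (s_large 0) (mgf_lim (lam + tau *: delta_mx 0 j) g10) => N s0 /andP[_ h2].
  have -> : E N (@F N tau j) = expR (- (s N * (sg * de + tau * x 0 j))) *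
      emgf (lam + tau *: delta_mx 0 j) N.
    by rewrite -(ExZ (P N) _ (bdot _ N)).
  apply: le_trans (ler_wpM2l (expR_ge0 _) h2) _; rewrite -expRD ler_expR.
  rewrite quadD// quad_delta t2 dot_delta -/x.
  have Vj : sg * V j j <= de / 2.
    apply: le_trans sgD; rewrite ler_pM2l//; apply: le_trans (ler_norm _) _.
    by rewrite /D [leRHS](bigD1 j)//= lerDl sumr_ge0.
  have Vj2 : sg * (sg * V j j) <= sg * (de / 2) by rewrite ler_pM2l.
  have sq : sg ^+ 2 * V j j = sg * (sg * V j j) by rewrite expr2 mulrA.
  rewrite sq -mulrN -mulrDr ler_wpM2l//; rewrite /q; lra.
have FE1 : \forall N \near \oo, forall j, E N (@F N sg j) <= expR (s N * (q - sg * de / 2)).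
  by apply: filter_forall => j; apply: FE; left.
have FE2 : \forall N \near \oo, forall j, E N (@F N (- sg) j) <= expR (s N * (q - sg * de / 2)).
  by apply: filter_forall => j; apply: FE; right.
have FE12 : \forall N \near \oo, forall j, E N (@F N sg j) <= expR (s N * (q - sg * de / 2)) /\
    E N (@F N (- sg) j) <= expR (s N * (q - sg * de / 2)).
  by apply: filterS2 FE1 FE2 => N k1 k2 j; split.
pose B N := [set w | cube x del (@M N w)].
near=> N.
have s00 : 0 <= s N by near: N; exact: s_large.
have h1 : expR (s N * (q - g1)) <= emgf lam N.
  suff /andP[] : expR (s N * (q - g1)) <= emgf lam N <= expR (s N * (q + g1)) by [].
  by near: N; exact: mgf_lim.
have h23 : forall j, E N (@F N sg j) <= expR (s N * (q - sg * de / 2)) /\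
    E N (@F N (- sg) j) <= expR (s N * (q - sg * de / 2)).
  near: N; exact FE12.
have h4 : 4 * n%:R <= s N * (sg * de / 4).
  have : 4 * n%:R / (sg * de / 4) <= s N by near: N; exact: s_large.
  by rewrite ler_pdivrMr// divr_gt0.
have h5 : 1 <= s N * (ga / 2).
  have : 1 / (ga / 2) <= s N by near: N; exact: s_large.
  by rewrite ler_pdivrMr// divr_gt0.
have b1 : bm (\1_(B N) : Om N -> R) by exact: bm_cube.
have bSum : bm (fun w => \sum_(j < n) (@F N sg j w + @F N (- sg) j w)).
  by apply: bm_sum => j; exact: bmD.
have key : emgf lam N <= expR (s N * (2 * q + ga / 4)) * E N \1_(B N) +
    \sum_(j < n) (E N (@F N sg j) + E N (@F N (- sg) j)).
  have -> : \sum_(j < n) (E N (@F N sg j) + E N (@F N (- sg) j)) =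
      E N (fun w => \sum_(j < n) (@F N sg j w + @F N (- sg) j w)).
    rewrite (posfun_sum (posfun_Ex (P N))); last by move=> j; exact: bmD.
    by apply: eq_bigr => j _; rewrite ExD.
  rewrite -(ExZ _ _ b1) -ExD//; last exact: bmZ.
  apply: Ex_le; [exact: bdot|by apply: bmD => //; exact: bmZ|] => w.
  have F0 tau j : 0 <= @F N tau j w by rewrite mulr_ge0 ?expR_ge0.
  have S0 : 0 <= \sum_(j < n) (@F N sg j w + @F N (- sg) j w).
    by apply: sumr_ge0 => j _; exact: addr_ge0.
  have [hc|hc] := pselect (cube x de (@M N w)).
    have Bw : B N w by move=> j; apply: lt_le_trans (hc j) _.
    rewrite indicE mem_set// mulr1 ler_wpDr// ler_expR ler_wpM2l//.
    have := dot_lipschitz lam (ltW de0) (fun j => ltW (hc j)).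
    by rewrite dx ler_norml -/W => /andP[_ ?]; lra.
  have [j hj] : exists j, de <= `|@M N w 0 j - x 0 j|.
    by move/existsNP : hc => [j /negP]; rewrite -leNgt; exists j.
  rewrite ler_wpDl ?mulr_ge0 ?expR_ge0 ?indicE//.
  rewrite (bigD1 j)//= ler_wpDr//; first by apply: sumr_ge0 => i _; exact: addr_ge0.
  have step tau : sg * de <= tau * (@M N w 0 j - x 0 j) ->
      expR (s N * dot (@M N w) lam) <= @F N tau j w.
    move=> ht; rewrite /F -expRD ler_expR dotDr dotZr dot_delta.
    have : s N * (sg * de) <= s N * (tau * (@M N w 0 j - x 0 j)) by rewrite ler_wpM2l.
    lra.
  move: hj; case: ger0P => _ hj.
    by rewrite ler_wpDr//; apply: step; rewrite ler_pM2l.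
  by rewrite ler_wpDl//; apply: step; rewrite mulNr -mulrN ler_pM2l.
have sumF : \sum_(j < n) (E N (@F N sg j) + E N (@F N (- sg) j)) <=
    2^-1 * expR (s N * (q - g1)).
  apply: (@le_trans _ _ (\sum_(j < n) (2 * expR (s N * (q - sg * de / 2))))).
    apply: ler_sum => j _; have [k1 k2] := h23 j.
    exact: (two _ _ _ k1 k2).
  rewrite sumr_const card_ord -[leLHS]mulr_natl.
  have -> : expR (s N * (q - g1)) = expR (s N * (sg * de / 2 - g1)) * expR (s N * (q - sg * de / 2)).
    by rewrite -expRD; congr expR; lra.
  have h6 : 4 * n%:R <= expR (s N * (sg * de / 2 - g1)).
    apply: le_trans (expR_ge1Dx _); apply: le_trans h4 _.
    rewrite ler_wpDl// ler_wpM2l//; lra.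
  exact: (alg1 _ _ _ (ler_wpM2r (expR_ge0 (s N * (q - sg * de / 2))) h6)).
rewrite -/(B N) -(@ler_pM2l _ (expR (s N * (2 * q + ga / 4)))) ?expR_gt0//.
have h7 : expR (s N * (2 * q + ga / 4)) * expR (s N * (- q - ga)) <= 2^-1 * expR (s N * (q - g1)).
  have h6 : 2 <= expR (s N * (ga / 2)).
    by apply: le_trans (expR_ge1Dx _); rewrite -[2]/(1 + 1) lerD2l.
  rewrite -expRD.
  have h8 : expR (s N * (ga / 2)) * expR (s N * (2 * q + ga / 4) + s N * (- q - ga)) <= expR (s N * (q - g1)).
    by rewrite -expRD ler_expR -!mulrDr ler_wpM2l//; exact: alg4.
  exact: (alg2 _ _ _ h8 (ler_wpM2r (expR_ge0 (s N * (2 * q + ga / 4) + s N * (- q - ga))) h6)).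
exact: le_trans h7 (alg3 _ _ _ _ h1 key sumF).
Unshelve. all: by end_near. Qed.

(** [C] need not be compact. Half-spaces at plus and minus the unit vectors cover it outside a
    bounded set, and the rest is compact, so finitely many half-spaces suffice there. This takes the
    place of exponential tightness. *)
Lemma finite_half_spaces (a : R) (C : set 'rV[R]_n) : closed C ->
  (a%:E < ereal_inf (rateI V @` C))%E ->
  exists ls : seq 'rV[R]_n, forall x, C x ->
    exists2 lam, lam \in ls & a < dot x lam - 2^-1 * quad V lam.
Proof.
move=> cC aC.
pose U lam := [set x | a + 2^-1 * quad V lam < dot x lam].
have oU lam : open (U lam) by exact: open_half_space.
pose e (z : R) j : 'rV[R]_n := z *: delta_mx 0 j.
pose K := C `&` \bigcap_(j in [set: 'I_n]) (~` U (e 1 j) `&` ~` U (e (-1) j)).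
have cK : compact K.
  apply: bounded_closed_compact; last first.
    apply: closedI => //; apply: closed_bigI => j _.
    by apply: closedI; exact: open_closedC.
  pose B := `|a| + \sum_(j < n) `|V j j|.
  have B0 : 0 <= B by rewrite addr_ge0// sumr_ge0.
  exists B; split; first by rewrite num_real.
  move=> b Bb x /= [_ Kx]; apply: le_trans (ltW Bb); rewrite -[leLHS]/(mx_norm x) mx_normrE.
  apply: bigmax_le => // -[i j] _ /=; rewrite ord1.
  have Vj : `|V j j| <= \sum_(j < n) `|V j j|.
    by rewrite [leRHS](bigD1 j)//= lerDl sumr_ge0.
  have h z : z ^+ 2 = 1 -> ~ U (e z j) x -> z * x 0 j <= B.
    move=> z2 /negP; rewrite -leNgt /e dotZr quadZ quad_delta dot_delta z2 mul1r => h.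
    have := ler_norm (V j j); have := ler_norm a; have := normr_ge0 (V j j); rewrite /B; lra.
  have [/(h 1)h1 /(h (-1))h2] := Kx j I.
  have := h1 (expr1n _ _); have := h2 (etrans (sqrrN 1) (expr1n _ _)).
  by rewrite ler_norml => *; apply/andP; split; lra.
move: cK; rewrite compact_cover => /(_ _ setT U (fun lam _ => oU lam)).
case.
  move=> x [Cx _]; have : (a%:E < rateI V x)%E.
    by apply: lt_le_trans aC _; apply: ereal_inf_lbound; exists x.
  by move=> /rateI_gt[lam h]; exists lam => //; rewrite /U/=; lra.
move=> D _ KD.
exists (finmap.enum_fset D ++ [seq e 1 j | j : 'I_n] ++ [seq e (-1) j | j : 'I_n]) => x Cx.
have [Kx|] := pselect (K x).
  have [lam /= lD h] := KD x Kx; exists lam; first by rewrite mem_cat lD.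
  by move: h; rewrite /U/=; lra.
move=> /not_andP[//|/existsNP[j /not_implyP[_ /not_andP[|]]]] /contrapT h.
  exists (e 1 j); last by move: h; rewrite /U/=; lra.
  by rewrite !mem_cat (map_f (e 1)) ?orbT// mem_enum.
exists (e (-1) j); last by move: h; rewrite /U/=; lra.
by rewrite !mem_cat (map_f (e (-1))) ?orbT// mem_enum.
Qed.

Lemma dev_principle_of_mgf :
  dev_principle s (fun N G => P N (@M N @^-1` G)) (rateI V).
Proof.
move=> G bG u.
have mG N : measurable (@M N @^-1` G).
  by apply: borel_preimage_measurable bG => j; case: (bM N j).
have PE N : P N (@M N @^-1` G) = (E N \1_(@M N @^-1` G))%:E by exact: Ex_indic.
have p0 N : 0 <= E N \1_(@M N @^-1` G).
  by apply: (posfun_ge0 (posfun_Ex (P N))) => [|w]; [exact: bm_indic|rewrite indicE].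
split; last 2 first.
- exact: limn_einf_sup.
- apply: le_oppe_of_lt => a /(finite_half_spaces (@closed_closure _ G))[ls hls].
  apply/lee_addgt0Pr => ga ga0; apply: limn_esup_le.
  have hu := half_spaces_upper (ls := ls) mG ga0 (fun N w Gw => hls _ (subset_closure Gw)).
  apply: filterS2 (s_large 1) hu => N s1 h; rewrite -EFinD /u PE; apply: elog_le => //.
  exact: lt_le_trans s1.
rewrite leeNl; apply: le_ereal_inf_tmp => _ [x Gx <-].
rewrite leeNl.
have : (rateI V x = +oo \/ exists r : R, rateI V x = r%:E)%E.
  by have := rateI_ge0 V x; case: (rateI V x) => [r|//|//] _; [right; exists r|left].
case=> [->|[r Er]]; first by rewrite leNye.
have [lam xlam] : exists lam, x = lam *m V by apply: (rateI_fin_range (c := r)); rewrite Er.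
(* At [x = lam *m V] the competitor [lam] gives the supremum at least <x, lam> - quad / 2 = quad /
   2, the exponent attained by [cube_lower]. *)
apply: (@le_trans _ _ (- (2^-1 * quad V lam))%:E).
  rewrite EFinN leeN2; have := rateI_ge V x lam.
  by rewrite xlam dotE -/(quad V lam); apply: le_trans; rewrite lee_fin; lra.
have [de de0 deG] := nbhs_cubeP Gx.
apply/lee_addgt0Pr => ga ga0; rewrite -leeBlDr//; apply: limn_einf_ge.
apply: filterS2 (s_large 1) (cube_lower lam de0 ga0) => N s1 h.
rewrite /u PE; apply: elog_ge; first exact: lt_le_trans s1.
apply: le_trans h _; apply: Ex_le => [||w]; [exact: bm_cube|exact: bm_indic|].
rewrite !indicE ler_nat; case: (boolP (w \in _)) => // /set_mem /= hw.
by rewrite mem_set//=; apply: deG; rewrite xlam.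
Qed.

End MomentsToDeviations.

Theorem theorem3p1 (R : realType) (d m : nat)
  (mu : {measure set (d.-tuple R) -> \bar R})
  (nu : {measure set (m.-tuple R) -> \bar R})
  (a0 : d.-tuple R -> R) (a : nat -> d.-tuple R -> d.-tuple R -> R)
  (b : nat -> d.-tuple R -> m.-tuple R -> R)
  (T : nat) (y : nat -> m.-tuple R) (psi : nat -> d.-tuple R -> R)
  (bN : nat -> R)
  (dO : nat -> measure_display) (Om : forall N : nat, measurableType (dO N))
  (P : forall N : nat, probability (Om N) R)
  (xs : forall N : nat, nat -> nat -> Om N -> d.-tuple R) :
  (* reference measure *)
  sigma_finite setT mu ->
  (* hidden Markov model: initial density, transition and observation densities *)
  measurable_fun setT a0 -> (forall x, 0 <= a0 x) ->
  (\int[mu]_x (a0 x)%:E = 1)%E ->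
  (forall t, (1 <= t)%N ->
     [/\ measurable_fun setT (fun p : d.-tuple R * d.-tuple R => a t p.1 p.2),
         (forall x x', 0 <= a t x x') &
         (forall x, \int[mu]_x' (a t x x')%:E = 1)%E]) ->
  (forall t, (1 <= t)%N ->
     [/\ measurable_fun setT (fun p : d.-tuple R * m.-tuple R => b t p.1 p.2),
         (forall x v, 0 <= b t x v) &
         (forall x, \int[nu]_v (b t x v)%:E = 1)%E]) ->
  (* Assumption A-0 (for the fixed observations y_1, ..., y_T) *)
  (forall t, (1 <= t <= T)%N ->
     exists C : R, forall x,
       (0 < \int[mu]_u (a t x u * b t u (y t))%:E <= C%:E)%E) ->
  (* psi_0, ..., psi_T bounded measurable *)
  (forall t, (t <= T)%N ->
     measurable_fun setT (psi t) /\ exists M : R, forall x, `|psi t x| <= M) ->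
  (* the sequence b_N *)
  (forall N, 0 < bN N) ->
  bN @ \oo --> +oo ->
  (fun N => Num.sqrt N%:R / bN N) @ \oo --> +oo ->
  (* for each N, (xs N i t)_{i<N, t<=T} is the particle filter with N particles *)
  (forall N, particle_law mu a0 a (fun t x => b t x (y t)) (P N) T N (xs N)) ->
  let g := fun t x => b t x (y t) in
  let V := Vmat mu a0 a g T psi in
  good_rate_function (rateI V) /\
  dev_principle (fun N => bN N ^+ 2)
    (fun N G => P N (Mvec mu a0 a g T N bN psi (xs N) @^-1` G))
    (rateI V).
Proof.
move=> smu ma0 a0_ge0 a0_1 ha hb hC hpsi b0 binf sqb law g V.
have model : hmm mu a0 a g T.
  split => //.
  - by split=> //; split => //; rewrite a0_1 ltry.
  - by move=> t /andP[t1 _]; exact: ha.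
  - move=> t /andP[t1 _]; have [mb b_ge0 _] := hb t t1.
    by split=> [|x]; [exact: (measurable_fun_pair1 (y t) mb)|exact: b_ge0].
(* The moment lemmas quantify over all indices, so the family is extended by 0 beyond [T]; the
   matrix does not see this. *)
pose psi' s := if (s <= T)%N then psi s else (fun=> 0).
have bpsi s : bm (psi' s).
  by rewrite /psi'; case: ifPn => sT; [exact: hpsi|exact: bm_cst].
have VE : V = Vmat mu a0 a g T psi'.
  have jT (j : 'I_T.+1) : (j <= T)%N by rewrite -ltnS.
  by apply/matrixP => i j; rewrite !mxE /psi' !jT.
have Vsym : V^T = V.
  by apply/matrixP => i j; rewrite !mxE /Vcov; case: (ltngtP i j) => // ->.
have s_large K : \forall N \near \oo, K <= bN N ^+ 2.
  move/cvgryPge: binf => /(_ (Num.max 1 K)) h; apply: filterS h => N.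
  by rewrite ge_max => /andP[h1 h2]; apply: le_trans h2 _; rewrite expr2 ler_peMl// ltW.
pose eps (N : nat) : R := bN N / Num.sqrt N%:R.
have sq0 (N : nat) : (0 < N)%N -> 0 < Num.sqrt N%:R :> R by move=> N0; rewrite sqrtr_gt0 ltr0n.
have eps0 (N : nat) : (0 < N)%N -> 0 < eps N by move=> N0; rewrite divr_gt0// sq0.
have veps (N : nat) : (0 < N)%N -> N%:R * eps N ^+ 2 = bN N ^+ 2.
  by move=> N0; rewrite exprMn exprVn sqr_sqrtr// mulrCA divff ?mulr1// pnatr_eq0 -lt0n.
(* At [N = 0] the quotient defining [eps] is a division by zero with value 0, so identities
   involving it are taken for positive [N]. *)
have posN : \forall N \near \oo, (0 < N)%N by exists 1%N.
have v_large K : \forall N \near \oo, K <= N%:R * eps N ^+ 2.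
  by apply: filterS2 (s_large K) posN => N h N0; rewrite veps.
have eps_small del : 0 < del -> \forall N \near \oo, eps N <= del.
  move=> d0; move/cvgryPge: sqb => /(_ del^-1) h'; apply: filterS2 h' posN => N h N0.
  have := h; rewrite -[leRHS]invf_div lef_pV2 ?posrE//; exact: eps0.
pose M N := Mvec mu a0 a g T N bN psi (xs N).
have bM (N : nat) j : bm (fun w => M N w 0 j).
  have jT : (j <= T)%N by rewrite -ltnS.
  have -> : (fun w => M N w 0 j) = (fun w => (bN N * Num.sqrt N%:R)^-1 *
      \sum_(i < N) (psi j (xs N i j w) - mt mu a0 a g j (psi j))).
    by apply/funext => w; rewrite mxE.
  apply: bmZ; apply: bm_sum => i; apply: bmB; last exact: bm_cst.
  apply: bm_comp; last exact: hpsi.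
  by have [mx _ _] := law N; exact: mx.
split; first exact: good_rateI.
apply: (dev_principle_of_mgf Vsym s_large bM) => lam del del0.
pose phi s x := lam 0 (inord s) * psi' s x.
have bphi s : bm (phi s) by exact: bmZ.
apply: filterS2 (mgf model law eps0 eps_small v_large (leqnn T) bphi del0) posN => N h N0.
have q2 : 2^-1 * quad V lam = Qlim mu a0 a g T phi.
  by rewrite /quad VE (quadratic_Vmat model lam bpsi) mulKf// pnatr_eq0.
(* Both sides carry the factor b_N / sqrt N in front of the sums over particles: b_N^2 / (b_N sqrt
   N) on the left, N eps / N on the right. *)
have WE w : bN N ^+ 2 * dot (M N w) lam = N%:R * (eps N * @SN R d mu a0 a g dO Om xs N T phi w).
  rewrite /SN /dot !mulr_sumr; apply: eq_bigr => t _.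
  have tT : (t <= T)%N by rewrite -ltnS.
  rewrite mxE /cem /phi inord_val (posfunZ (posfun_emp (xs N) N0 t w) _ (bpsi t)).
  rewrite (posfunZ (posfun_mt model tT) _ (bpsi t)) -mulrBr.
  have -> : psi' t = psi t by rewrite /psi' tT.
  rewrite sumrB sumr_const card_ord -[mt _ _ _ _ _ _ *+ N]mulr_natl.
  have alg (c r k S l l' : R) : c != 0 -> r != 0 -> k = r ^+ 2 ->
      c ^+ 2 * ((c * r)^-1 * (S - k * l) * l') = k * (c / r * (l' * (k^-1 * S - l))).
    by move=> c0 r0 ->; field; rewrite c0 r0.
  by apply: alg; rewrite ?sqr_sqrtr// gt_eqF// sq0.
have -> : (fun w => expR (bN N ^+ 2 * dot (M N w) lam)) = @WN R d mu a0 a g dO Om xs eps N T phi.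
  apply/funext => w; exact: (congr1 expR (WE w)).
by rewrite q2 -(veps N N0); exact: h.
Qed.
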